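(* Let $\mathbf{B}\in\mathbb{R}^{n\times n}$ be symmetric with $\|\mathbf{B}\|\le 1/2$, $\mathbf{x}\in\mathbb{R}^n$ nonzero, $0<\epsilon<1$ and $0<\gamma<1$. Let $B=\log\left(\frac{n}{\epsilon\gamma}\right)$ and $q=O(\gamma^{-2}\log(1/\epsilon))$, and let $$p_q(x)=\sum_{i=0}^q\left(x(1-x^2)^i\prod_{j=1}^i\frac{2j-1}{2j}\right).$$ Suppose the Lanczos algorithm (see context) is run on $\mathbf{B}$ and $\mathbf{x}$ with $f(x)=p_q(x)$, which is a function $h=p_q$ satisfying $$h(x)\in\begin{cases}[0,\epsilon] & \text{for } x<-\gamma,\\ [0,1] & \text{for } x\in[-\gamma,\gamma],\\ [1-\epsilon,1] & \text{for } x\ge\gamma.\end{cases}$$ After $k=O(\gamma^{-1}\log(1/(\epsilon\gamma)))$ iterations on a computer satisfying Requirement 1, and Requirement 2 for applying $\mathbf{B}$, to precision $\epsilon_{mach}=2^{-\Omega(B)}$ (e.g. a computer with $\Omega(B)$ bits of precision), the algorithm outputs $\mathbf{y}$ with $$\|p_q(\mathbf{B})\mathbf{x}-\mathbf{y}\|\le\epsilon\|\mathbf{x}\|.$$ The total runtime is $O(\mathrm{mv}(\mathbf{B})k+k^2B+kB^2)$, where $\mathrm{mv}(\mathbf{B})$ is the time required to multiply $\mathbf{B}$ by a vector to the precision required by Requirement 2.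
   Context: $\|\cdot\|$ is the Euclidean norm for vectors and the spectral norm for matrices; $f(\mathbf{M})=\mathbf{V}f(\mathbf{\Lambda})\mathbf{V}^T$ for symmetric $\mathbf{M}=\mathbf{V}\mathbf{\Lambda}\mathbf{V}^T$ (eigendecomposition), with $f$ applied to each diagonal entry of $\mathbf{\Lambda}$. The number $B$ (a scalar) is distinct from the matrix $\mathbf{B}$. Floating-point model. $\mathrm{fl}(\cdot)$ denotes the computed result. Requirement 1: for $\circ\in\{+,-,\times,\div\}$, $\mathrm{fl}(x\circ y)=(1+\delta)(x\circ y)$ and $\mathrm{fl}(\sqrt{x})=(1+\delta)\sqrt{x}$ with $|\delta|\le\epsilon_{mach}$. Requirement 2 (for the input matrix $\mathbf{B}$): for every $\mathbf{w}\in\mathbb{R}^n$, $\|\mathrm{fl}(\mathbf{B}\mathbf{w})-\mathbf{B}\mathbf{w}\|\le 2n^{3/2}\|\mathbf{B}\|\|\mathbf{w}\|\epsilon_{mach}$. Overflow and underflow are ignored. Runtimes are in the unit-cost RAM model, the scalar function $f$ can be evaluated to relative error $\epsilon_{mach}$ in $O(1)$ time, and $\mathrm{mv}(\mathbf{B})=\Omega(n)$. Lanczos algorithm (input symmetric $\mathbf{A}$, number of iterations $k$, vector $\mathbf{x}$, function $f$): set $\mathbf{q}_0=\mathbf{0}$, $\mathbf{q}_1=\mathbf{x}/\|\mathbf{x}\|$, $\beta_1=0$. For $i=1,\dots,k$: $\mathbf{q}_{i+1}\leftarrow\mathbf{A}\mathbf{q}_i-\beta_i\mathbf{q}_{i-1}$;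 $\alpha_i\leftarrow\langle\mathbf{q}_{i+1},\mathbf{q}_i\rangle$; $\mathbf{q}_{i+1}\leftarrow\mathbf{q}_{i+1}-\alpha_i\mathbf{q}_i$; $\beta_{i+1}\leftarrow\|\mathbf{q}_{i+1}\|$; if $\beta_{i+1}=0$ exit the loop; $\mathbf{q}_{i+1}\leftarrow\mathbf{q}_{i+1}/\beta_{i+1}$. Let $\mathbf{T}$ be the symmetric tridiagonal matrix with diagonal $\alpha_1,\dots,\alpha_k$ and off-diagonal $\beta_2,\dots,\beta_k$, and $\mathbf{Q}=[\mathbf{q}_1,\dots,\mathbf{q}_k]$ (if the loop exits early at iteration $i$, use the first $i$ coefficients and vectors). Return $\mathbf{y}=\|\mathbf{x}\|\cdot\mathbf{Q}f(\mathbf{T})\mathbf{e}_1$, where $\mathbf{e}_1$ is the first standard basis vector. The final step is carried out in floating point using the Gu–Eisenstat tridiagonal eigendecomposition: for $ck^3\log k\cdot\epsilon_{mach}\le\epsilon_1\le 1/2$ ($c$ a fixed constant) it computes in $O(k^2\log\frac{k}{\epsilon_1}+k\log^2\frac{k}{\epsilon_1})$ time matrices $\tilde{\mathbf{V}}$ and diagonal $\tilde{\mathbf{\Lambda}}$ with $\|\tilde{\mathbf{V}}\tilde{\mathbf{\Lambda}}\tilde{\mathbf{V}}^T-\mathbf{T}\|\le\epsilon_1\|\mathbf{T}\|$ and $\|\tilde{\mathbf{V}}^T\tilde{\mathbf{V}}-\mathbf{I}\|\le\epsilon_1$; it is called with $\epsilon_1=2^{-\Theta(B)}$ for a suitable hidden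 constant, and $f(\mathbf{T})\mathbf{e}_1$ is computed as $\tilde{\mathbf{V}}f(\tilde{\mathbf{\Lambda}})\tilde{\mathbf{V}}^T\mathbf{e}_1$. Asymptotic notation: the quantities $q$, $k$, $\log(1/\epsilon_{mach})$ are taken to be suitable (sufficiently large) absolute constants times the indicated expressions, where each expression inside $O(\cdot)$ or $\Omega(\cdot)$, including its logarithmic factors, is read as at least $1$.
   Formalization: The bracket property fails as printed (p_q is odd, p_q(-1) = -1, and it is unbounded beyond [-1,1]); instead, on [-1,1], p_q is shown to satisfy the sign-function brackets and (1+p_q)/2 the printed ones. *)

(* Defs.v *)
From HB Require Import structures.
From mathcomp Require Import all_boot all_order all_algebra.
From mathcomp Require Import all_classical all_reals all_analysis.

Set Implicit Arguments.
Unset Strict Implicit.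
Unset Printing Implicit Defensive.

Import Order.TTheory GRing.Theory Num.Theory.
Local Open Scope classical_set_scope.
Local Open Scope ring_scope.

Section LinearAlgebra.
Context {R : realType}.

(* The library norm on matrices is the max norm, hence the two norms below. *)
Definition enorm n (v : 'cV[R]_n) : R := Num.sqrt (\sum_i v i ord0 ^+ 2).

Definition spnorm m n (M : 'M[R]_(m, n)) : R :=
  sup [set enorm (M *m v) | v in [set v : 'cV[R]_n | enorm v <= 1]].

Definition eigendecomposition n (M : 'M[R]_n) : set ('M[R]_n * 'rV[R]_n) :=
  [set VL | VL.1^T *m VL.1 = 1%:M /\ M = VL.1 *m diag_mx VL.2 *m VL.1^T].

(* f(M) = V f(Lambda) V^T. A symmetric M has an eigendecomposition, and the
   value does not depend on which one is selected; the default pair is only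
   reached when M is not symmetric. *)
Definition mxfun n (f : R -> R) (M : 'M[R]_n) : 'M[R]_n :=
  let VL := xget (1%:M, 0) (eigendecomposition M) in
  VL.1 *m diag_mx (map_mx f VL.2) *m VL.1^T.

Definition symtridiag n (T : 'M[R]_n) : Prop :=
  T^T = T /\ forall i j : 'I_n, (i.+1 < j)%N -> T i j = 0.

End LinearAlgebra.

(* log, read as at least 1. *)
Definition log1 {R : realType} (x : R) : R := Num.max 1 (ln x).

Definition ceiln {R : realType} (x : R) : nat := `|Num.ceil x|%N.

(* A computation is a result together with the number of unit-cost steps. *)
Definition timed (A : Type) : Type := (A * nat)%type.
Definition ret A (a : A) : timed A := (a, 0%N).
Definition bind A C (c : timed A) (f : A -> timed C) : timed C :=
  ((f c.1).1, (c.2 + (f c.1).2)%N).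

Notation "'let!' x := c 'in' d" := (bind c (fun x => d))
  (at level 200, x name, c at level 100, d at level 200).

Section FloatingPoint.
Context {R : realType}.

Record arith := Arith {
  fl_add : R -> R -> R;
  fl_sub : R -> R -> R;
  fl_mul : R -> R -> R;
  fl_div : R -> R -> R;
  fl_sqrt : R -> R }.

Definition rel_approx (u y z : R) : Prop :=
  exists2 delta : R, `|delta| <= u & z = (1 + delta) * y.

Definition requirement1 (F : arith) (u : R) : Prop :=
  [/\ forall x y, rel_approx u (x + y) (fl_add F x y),
      forall x y, rel_approx u (x - y) (fl_sub F x y),
      forall x y, rel_approx u (x * y) (fl_mul F x y),
      forall x y, y != 0 -> rel_approx u (x / y) (fl_div F x y)
    & forall x, 0 <= x -> rel_approx u (Num.sqrt x) (fl_sqrt F x)].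

Definition requirement2 n (B : 'M[R]_n) (mulB : 'cV[R]_n -> timed 'cV[R]_n)
    (u : R) : Prop :=
  forall w : 'cV[R]_n, enorm ((mulB w).1 - B *m w) <=
    2 * n%:R `^ (3 / 2) * spnorm B * enorm w * u.

(* fc evaluates f to relative error u in at most C steps. *)
Definition evaluates (f : R -> R) (fc : R -> timed R) (u C : R) : Prop :=
  forall x, rel_approx u (f x) (fc x).1 /\ (fc x).2%:R <= C.

(* Specification of the Gu-Eisenstat tridiagonal eigensolver: eig T e1 returns
   (V, Lambda), with the diagonal matrix Lambda stored as a row vector. *)
Definition gu_eisenstat (eig : forall m, 'M[R]_m -> R -> timed ('M[R]_m * 'rV[R]_m))
    (u c C : R) : Prop :=
  forall m (T : 'M[R]_m) (e1 : R), (0 < m)%N -> symtridiag T -> 0 < e1 ->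
    c * m%:R ^+ 3 * log1 m%:R * u <= e1 -> e1 <= 1 / 2 ->
    let V := (eig m T e1).1.1 in
    let Lambda := diag_mx (eig m T e1).1.2 in
    [/\ spnorm (V *m Lambda *m V^T - T) <= e1 * spnorm T,
        spnorm (V^T *m V - 1%:M) <= e1
      & (eig m T e1).2%:R <=
          C * (m%:R ^+ 2 * log1 (m%:R / e1) + m%:R * log1 (m%:R / e1) ^+ 2)].

Section Program.
Variable F : arith.

Definition add (x y : R) : timed R := (fl_add F x y, 1%N).
Definition sub (x y : R) : timed R := (fl_sub F x y, 1%N).
Definition mul (x y : R) : timed R := (fl_mul F x y, 1%N).
Definition div (x y : R) : timed R := (fl_div F x y, 1%N).
Definition sqrtc (x : R) : timed R := (fl_sqrt F x, 1%N).
Definition is_zero (x : R) : timed bool := (x == 0, 1%N).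

Definition tabulate n (g : 'I_n -> timed R) : timed 'cV[R]_n :=
  (\col_i (g i).1, \sum_i (g i).2)%N.

Definition sum_seq (s : seq R) : timed R :=
  foldl (fun acc x => let! a := acc in add a x) (ret 0) s.

Definition dot n (v w : 'cV[R]_n) : timed R :=
  let! p := tabulate (fun i => mul (v i ord0) (w i ord0)) in
  sum_seq [seq p i ord0 | i <- enum 'I_n].

Definition norm n (v : 'cV[R]_n) : timed R := let! s := dot v v in sqrtc s.

Definition vsub n (v w : 'cV[R]_n) : timed 'cV[R]_n :=
  tabulate (fun i => sub (v i ord0) (w i ord0)).

Definition vscale n (a : R) (v : 'cV[R]_n) : timed 'cV[R]_n :=
  tabulate (fun i => mul a (v i ord0)).

Definition vdiv n (v : 'cV[R]_n) (a : R) : timed 'cV[R]_n :=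
  tabulate (fun i => div (v i ord0) a).

Definition mulmxv m n (M : 'M[R]_(m, n)) (v : 'cV[R]_n) : timed 'cV[R]_m :=
  tabulate (fun i => dot (row i M)^T v).

Section Lanczos.
Variables (n : nat) (mulA : 'cV[R]_n -> timed 'cV[R]_n).

(* At most k further iterations, the first of them with beta = beta_i,
   qprev = q_(i-1) and q = q_i. Returns one triple (alpha_i, beta_i, q_i) per
   iteration performed. *)
Fixpoint lanczos_loop (k : nat) (beta : R) (qprev q : 'cV[R]_n) :
    timed (seq (R * R * 'cV[R]_n)) :=
  if k is k'.+1 then
    let! a := mulA q in
    let! b := vscale beta qprev in
    let! v := vsub a b in
    let! alpha := dot v q in
    let! d := vscale alpha q in
    let! w := vsub v d in
    let! beta' := norm w in
    let! stop := is_zero beta' in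
    if stop then ret [:: (alpha, beta, q)]
    else
      let! q' := vdiv w beta' in
      let! rest := lanczos_loop k' beta' q q' in
      ret ((alpha, beta, q) :: rest)
  else ret [::].

Definition coef_alpha (s : seq (R * R * 'cV[R]_n)) (i : nat) : R :=
  (nth (0, 0, 0) s i).1.1.
Definition coef_beta (s : seq (R * R * 'cV[R]_n)) (i : nat) : R :=
  (nth (0, 0, 0) s i).1.2.

(* With indices starting at 0, the entry (i, i.+1) is the beta recorded with
   the triple of index i.+1; the beta of the first triple (zero) is unused. *)
Definition tridiag (s : seq (R * R * 'cV[R]_n)) : 'M[R]_(size s) :=
  \matrix_(i, j)
    if i == j then coef_alpha s i
    else if j == i.+1 :> nat then coef_beta s j
    else if i == j.+1 :> nat then coef_beta s i
    else 0.

Definition basis_mx (s : seq (R * R * 'cV[R]_n)) : 'M[R]_(n, size s) :=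
  \matrix_(i, j) (nth (0, 0, 0) s j).2 i ord0.

(* fc is the evaluator of the scalar function f, eig the tridiagonal
   eigensolver, called with accuracy e1. *)
Definition lanczos (fc : R -> timed R)
    (eig : forall m, 'M[R]_m -> R -> timed ('M[R]_m * 'rV[R]_m)) (e1 : R)
    (k : nat) (x : 'cV[R]_n) : timed 'cV[R]_n :=
  let! nx := norm x in
  let! q1 := vdiv x nx in
  let! s := lanczos_loop k 0 0 q1 in
  let! VL := eig (size s) (tridiag s) e1 in
  let! g := mulmxv VL.1^T (\col_i (i == 0%N :> nat)%:R) in
  let! fL := tabulate (fun i => fc (VL.2 ord0 i)) in
  let! h := tabulate (fun i => mul (fL i ord0) (g i ord0)) in
  let! z := mulmxv VL.1 h in
  let! y := mulmxv (basis_mx s) z in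
  vscale nx y.

End Lanczos.
End Program.
End FloatingPoint.

Arguments arith : clear implicits.

Definition step_poly {R : realType} (q : nat) (x : R) : R :=
  \sum_(0 <= i < q.+1)
    x * (1 - x ^+ 2) ^+ i * \prod_(1 <= j < i.+1) ((2 * j%:R - 1) / (2 * j%:R)).

(* step_poly q is odd and is a truncated series of x / sqrt(x^2) on [-1, 1]: it
   approximates the sign function there, and (1 + step_poly q x) / 2 the step
   function. Outside [-1, 1] it is in general unbounded in q, hence the
   restriction of the conditions below to [-1, 1]. *)
Definition approx_step {R : realType} (gamma eps : R) (h : R -> R) : Prop :=
  forall x : R, -1 <= x <= 1 ->
    [/\ x < - gamma -> 0 <= h x <= eps,
        - gamma <= x <= gamma -> 0 <= h x <= 1
      & gamma <= x -> 1 - eps <= h x <= 1].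

Definition approx_sign {R : realType} (gamma eps : R) (h : R -> R) : Prop :=
  forall x : R, -1 <= x <= 1 ->
    [/\ x < - gamma -> -1 <= h x <= -1 + eps,
        - gamma <= x <= gamma -> -1 <= h x <= 1
      & gamma <= x -> 1 - eps <= h x <= 1].

(* Main.v *)
(* Paige's theorem, that the eigenvalues of the computed T stay close to those of B, can
   be avoided here: the norm of B is at most 1/2 and p_q is tame on [-1, 1], so a cruder
   bound on T suffices. In finite precision consecutive Lanczos vectors stay
   orthogonal up to an error growing linearly with the iteration, so that
   beta_i^2 + alpha_i^2 + beta_(i+1)^2 <= 27/100 and the absolute row sums of T are at
   most 9/10.

   Put Y = 1 - x^2, so that p_q is a combination of x Y^i with coefficients in [0, 1].
   Writing Y^i as a convex combination of Chebyshev polynomials T_l(Y), evaluation at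
   (z + 1/z)/2 shows that the degrees above k/4 have weight exp(- Omega(k gamma)).
   For the remaining degrees T_l(Y_B) q_1 - Q T_l(Y_T) e_1 obeys the Chebyshev recurrence
   with a small forcing term, and the norms of T_l and U_l on contractions are bounded
   through Pell's identity, without any spectral calculus. *)
Require Import Defs.
From HB Require Import structures.
From mathcomp Require Import all_boot all_order all_algebra.
From mathcomp Require Import all_classical all_reals all_analysis.
From mathcomp Require Import -(notations) complex.
From mathcomp Require Import ring lra zify.
Set Implicit Arguments.
Unset Strict Implicit.
Unset Printing Implicit Defensive.
Import Order.TTheory GRing.Theory Num.Theory.
Local Open Scope ring_scope.

(** * Euclidean norm and operator bounds *)

Section Euclidean.
Context {R : realType}.

(** A bound below 1 on T is essential: p_q blows up outside [-1, 1], and the Chebyshev estimates are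
    stated for contractions. The constants stem from the squared norm 1/4 of B: the recurrence gives
    beta_(i+1)^2 <= 1/4 - alpha_i^2 - beta_i^2 up to rounding and drift, 2/100 is granted to these,
    and 3 * 27/100 = (9/10)^2.

    Two obstacles shape the Krylov part. Up to logarithms the degree of p_q is of order gamma^-2
    while only gamma^-1 columns are available, and the last column of B Q - Q T need not be small;
    so the recurrence error is controlled only for T_l(Y) with 2 l < k - 1. Moreover the columns of
    Q may lose global orthogonality, so Q is bounded only by 2 k, a polynomial loss absorbed by the
    precision and by the constant in k.

    The spectral theorem serves only to identify [mxfun] with [horner_mx]. The computed eigenvectors
    are treated as an approximate intertwiner between T and a diagonal matrix, without matching
    eigenvalues. *)

Lemma normrM_le (x y a b : R) : `|x| <= a -> `|y| <= b -> `|x * y| <= a * b.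
Proof. by move=> xa yb; rewrite normrM ler_pM. Qed.

Definition dotp n (u v : 'cV[R]_n) : R := \sum_i u i ord0 * v i ord0.

Section Dotp.
Variable n : nat.
Implicit Types (u v w : 'cV[R]_n) (a : R).

Lemma dotpC u v : dotp u v = dotp v u.
Proof. by apply: eq_bigr => i _; rewrite mulrC. Qed.

Lemma dotpDl u v w : dotp (u + v) w = dotp u w + dotp v w.
Proof. by rewrite -big_split; apply: eq_bigr => i _; rewrite mxE mulrDl. Qed.

Lemma dotpZl a u w : dotp (a *: u) w = a * dotp u w.
Proof. by rewrite mulr_sumr; apply: eq_bigr => i _; rewrite mxE mulrA. Qed.

Lemma dotpNl u w : dotp (- u) w = - dotp u w.
Proof. by rewrite -scaleN1r dotpZl mulN1r. Qed.

Lemma dotpBl u v w : dotp (u - v) w = dotp u w - dotp v w.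
Proof. by rewrite dotpDl dotpNl. Qed.

Lemma dotpDr u v w : dotp w (u + v) = dotp w u + dotp w v.
Proof. by rewrite !(dotpC w) dotpDl. Qed.

Lemma dotpBr u v w : dotp w (u - v) = dotp w u - dotp w v.
Proof. by rewrite !(dotpC w) dotpBl. Qed.

Lemma dotpZr a u w : dotp w (a *: u) = a * dotp w u.
Proof. by rewrite !(dotpC w) dotpZl. Qed.

Lemma dotp0l v : dotp 0 v = 0.
Proof. by rewrite -(scale0r 0) dotpZl mul0r. Qed.

Lemma dotpvv_ge0 v : 0 <= dotp v v.
Proof. by apply: sumr_ge0 => i _; rewrite -expr2 sqr_ge0. Qed.

Lemma enormE v : enorm v = Num.sqrt (dotp v v).
Proof. by congr Num.sqrt; apply: eq_bigr => i _; rewrite expr2. Qed.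

Lemma enorm_ge0 v : 0 <= enorm v.
Proof. exact: sqrtr_ge0. Qed.

Lemma sqr_enorm v : enorm v ^+ 2 = dotp v v.
Proof. by rewrite enormE sqr_sqrtr // dotpvv_ge0. Qed.

Lemma enorm_le v a : 0 <= a -> dotp v v <= a ^+ 2 -> enorm v <= a.
Proof. by move=> a0 h; rewrite -(ler_pXn2r (n := 2)) ?nnegrE ?enorm_ge0 // sqr_enorm. Qed.

Lemma enorm0 : enorm (0 : 'cV[R]_n) = 0.
Proof. by rewrite enormE dotp0l sqrtr0. Qed.

Lemma enormZ a v : enorm (a *: v) = `|a| * enorm v.
Proof. by rewrite !enormE dotpZl dotpZr mulrA -expr2 sqrtrM ?sqr_ge0 // sqrtr_sqr. Qed.

Lemma enormN v : enorm (- v) = enorm v.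
Proof. by rewrite -scaleN1r enormZ normrN1 mul1r. Qed.

Lemma enorm_eq0 v : enorm v = 0 -> v = 0.
Proof.
move=> /(congr1 (fun t => t ^+ 2)); rewrite sqr_enorm expr0n /= => /eqP.
rewrite psumr_eq0 => [/allP h|i _]; last by rewrite -expr2 sqr_ge0.
apply/colP => i; rewrite mxE; have := h i (mem_index_enum _).
by rewrite /= -expr2 sqrf_eq0 => /eqP.
Qed.

(** The absolute values stand inside the sum because the rounding error of a computed dot product is
    proportional to this sum, not to the dot product itself. *)
Lemma dotp_abs_le u v :
  \sum_i `|u i ord0 * v i ord0| <= enorm u * enorm v.
Proof.
have [/enorm_eq0->|u0] := eqVneq (enorm u) 0.
  rewrite enorm0 mul0r big1 // => i _; by rewrite mxE mul0r normr0.
have [/enorm_eq0->|v0] := eqVneq (enorm v) 0.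
  rewrite enorm0 mulr0 big1 // => i _; by rewrite mxE mulr0 normr0.
have a0 : 0 < enorm u by rewrite lt_def u0 enorm_ge0.
have b0 : 0 < enorm v by rewrite lt_def v0 enorm_ge0.
set a := enorm u in a0 *; set b := enorm v in b0 *.
(* AM-GM termwise: [2 a b |u_i v_i| <= b^2 u_i^2 + a^2 v_i^2] *)
rewrite -(ler_pM2l (x := 2 * a * b)) ?mulr_gt0 // mulr_sumr.
have -> : 2 * a * b * (a * b) =
    \sum_i (b ^+ 2 * (u i ord0 * u i ord0) + a ^+ 2 * (v i ord0 * v i ord0)).
  rewrite big_split /= -!mulr_sumr -/(dotp u u) -/(dotp v v) -!sqr_enorm -/a -/b.
  by ring.
apply: ler_sum => i _; rewrite normrM.
rewrite -(expr2 (u i ord0)) -(expr2 (v i ord0)) -(real_normK (num_real (u i ord0))).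
rewrite -(real_normK (num_real (v i ord0))).
set s := `|u i ord0|; set t := `|v i ord0|.
rewrite -subr_ge0; have -> : b ^+ 2 * s ^+ 2 + a ^+ 2 * t ^+ 2 - 2 * a * b * (s * t) =
  (b * s - a * t) ^+ 2 by ring.
exact: sqr_ge0.
Qed.

Lemma CauchySchwarz u v : `|dotp u v| <= enorm u * enorm v.
Proof. exact: le_trans (ler_norm_sum _ _ _) (dotp_abs_le u v). Qed.

Lemma enormD u v : enorm (u + v) <= enorm u + enorm v.
Proof.
apply: enorm_le; first by rewrite addr_ge0 ?enorm_ge0.
rewrite dotpDl !dotpDr (dotpC v u) sqrrD -!sqr_enorm.
have := le_trans (ler_norm _) (CauchySchwarz u v); lra.
Qed.

Lemma enormB u v : enorm (u - v) <= enorm u + enorm v.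
Proof. by rewrite -(enormN v) enormD. Qed.

Lemma enorm_sum (I : Type) (r : seq I) (P : pred I) (F : I -> 'cV[R]_n) :
  enorm (\sum_(i <- r | P i) F i) <= \sum_(i <- r | P i) enorm (F i).
Proof.
elim/big_rec2: _ => [|i y x _ h]; first by rewrite enorm0.
by apply: le_trans (enormD _ _) _; rewrite lerD2l.
Qed.

Lemma enorm_coord_le v i : `|v i ord0| <= enorm v.
Proof.
rewrite enormE -sqrtr_sqr ler_sqrt ?dotpvv_ge0 //.
rewrite /dotp (bigD1 i) //= -expr2 lerDl; apply: sumr_ge0 => j _.
by rewrite -expr2 sqr_ge0.
Qed.

Lemma enorm_le_sum v : enorm v <= \sum_i `|v i ord0|.
Proof.
apply: enorm_le; first exact: sumr_ge0.
rewrite expr2 mulr_suml; apply: ler_sum => i _.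
apply: le_trans (ler_norm _) _; rewrite normrM ler_wpM2l //.
by rewrite (bigD1 i) //= lerDl; apply: sumr_ge0.
Qed.

Lemma enorm_coordle u v (c : R) : 0 <= c ->
  (forall i, `|u i ord0| <= c * `|v i ord0|) -> enorm u <= c * enorm v.
Proof.
move=> c0 h; apply: enorm_le; first by rewrite mulr_ge0 ?enorm_ge0.
rewrite exprMn sqr_enorm /dotp mulr_sumr; apply: ler_sum => i _.
rewrite -!expr2 -exprMn -(real_normK (num_real (u i ord0))).
rewrite -[leRHS](real_normK (num_real _)) ler_sqr ?nnegrE // normrM (ger0_norm c0).
exact: h.
Qed.

Lemma dotpBB u v :
  dotp (u - v) (u - v) = dotp u u - 2 * dotp u v + dotp v v.
Proof. by rewrite dotpBl !dotpBr (dotpC v u); ring. Qed.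

Lemma dotp_le v w a b :
  enorm v <= a -> enorm w <= b -> `|dotp v w| <= a * b.
Proof.
by move=> va wb; apply: le_trans (CauchySchwarz v w) _; rewrite ler_pM ?enorm_ge0.
Qed.

Lemma enorm_split (x y : 'cV[R]_n) (r s : R) :
  enorm (x - y) <= r -> enorm y <= s -> enorm x <= s + r.
Proof.
move=> h1 h2; have -> : x = y + (x - y) by rewrite addrC subrK.
by apply: le_trans (enormD _ _) _; apply: lerD.
Qed.

End Dotp.

Lemma dotp_mulmx m n (A : 'M[R]_(m, n)) u v :
  dotp (A *m u) v = dotp u (A^T *m v).
Proof.
rewrite /dotp.
under eq_bigr do rewrite mxE mulr_suml.
rewrite exchange_big; apply: eq_bigr => j _ /=.
rewrite mxE mulr_sumr; apply: eq_bigr => i _; rewrite mxE; ring.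
Qed.

Lemma enorm_delta n (i : 'I_n) : enorm (delta_mx i ord0 : 'cV[R]_n) = 1.
Proof.
rewrite /enorm (bigD1 i) //= mxE !eqxx big1 ?addr0 ?expr1n ?sqrtr1 // => j ji.
by rewrite mxE (negbTE ji) expr0n.
Qed.

(** A relational form of the operator norm: bounds compose by sums and products without handling the
    supremum in [spnorm], which is entered and left only through [spnorm_mxbound] and
    [spnorm_le]. *)
Definition mxbound m n (M : 'M[R]_(m, n)) (c : R) : Prop :=
  forall v, enorm (M *m v) <= c * enorm v.

Section Mxbound.
Local Open Scope classical_set_scope.
Variables m n p : nat.
Implicit Types (M N : 'M[R]_(m, n)) (P : 'M[R]_(n, p)) (a c d : R).

Lemma mxbound0 : mxbound (0 : 'M[R]_(m, n)) 0.
Proof. by move=> v; rewrite mul0mx enorm0 mul0r. Qed.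

Lemma mxboundW M c d : c <= d -> mxbound M c -> mxbound M d.
Proof. by move=> cd h v; apply: le_trans (h v) _; rewrite ler_wpM2r ?enorm_ge0. Qed.

Lemma mxboundD M N c d : mxbound M c -> mxbound N d -> mxbound (M + N) (c + d).
Proof.
move=> hM hN v; rewrite mulmxDl mulrDl; apply: le_trans (enormD _ _) _.
exact: lerD.
Qed.

Lemma mxboundZ a M c : mxbound M c -> mxbound (a *: M) (`|a| * c).
Proof. by move=> h v; rewrite -scalemxAl enormZ -mulrA ler_wpM2l. Qed.

Lemma mxboundN M c : mxbound M c -> mxbound (- M) c.
Proof. by move=> h v; rewrite mulNmx enormN. Qed.

Lemma mxboundB M N c d : mxbound M c -> mxbound N d -> mxbound (M - N) (c + d).
Proof. by move=> hM hN; apply: mxboundD => //; apply: mxboundN. Qed.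

Lemma mxboundM M P c d : 0 <= c -> mxbound M c -> mxbound P d -> mxbound (M *m P) (c * d).
Proof.
move=> c0 hM hP v; rewrite -mulmxA; apply: le_trans (hM _) _.
by rewrite -mulrA ler_wpM2l.
Qed.

(** The square of |M^T v| is <M M^T v, v>, at most c |M^T v| |v|; one factor |M^T v| cancels, so the
    case where it vanishes is split off. *)
Lemma mxbound_tr M c : 0 <= c -> mxbound M c -> mxbound M^T c.
Proof.
move=> c0 h v; have [->|nz] := eqVneq (enorm (M^T *m v)) 0.
  by rewrite mulr_ge0 ?enorm_ge0.
have pos : 0 < enorm (M^T *m v) by rewrite lt_def nz enorm_ge0.
rewrite -(ler_pM2l pos) -expr2 sqr_enorm dotp_mulmx trmxK dotpC.
apply: le_trans (ler_norm _) _; apply: le_trans (CauchySchwarz _ _) _.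
apply: le_trans (ler_wpM2r (enorm_ge0 _) (h _)) _.
by rewrite -mulrA mulrCA mulrA mulrAC.
Qed.

Lemma mxbound_entry M c i j : mxbound M c -> `|M i j| <= c.
Proof.
move=> h; have := h (delta_mx j ord0); rewrite enorm_delta mulr1.
apply: le_trans; rewrite -colE; apply: le_trans (enorm_coord_le _ i).
by rewrite mxE.
Qed.

Lemma mxbound_entries M : mxbound M (\sum_i \sum_j `|M i j|).
Proof.
move=> v; apply: le_trans (enorm_le_sum _) _.
rewrite mulr_suml; apply: ler_sum => i _; rewrite mxE mulr_suml.
apply: le_trans (ler_norm_sum _ _ _) _; apply: ler_sum => j _.
by rewrite normrM ler_wpM2l // enorm_coord_le.
Qed.

Lemma has_sup_spnorm M :
  has_sup [set enorm (M *m v) | v in [set v : 'cV[R]_n | enorm v <= 1]].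
Proof.
split; first by exists (enorm (M *m 0)), 0 => //=; rewrite enorm0.
exists (\sum_i \sum_j `|M i j|) => _ [v /= v1 <-].
apply: le_trans (mxbound_entries _ _) _.
by rewrite ler_piMr //; apply: sumr_ge0 => i _; apply: sumr_ge0.
Qed.

Lemma spnorm_mxbound M : mxbound M (spnorm M).
Proof.
move=> v; have [/enorm_eq0->|nz] := eqVneq (enorm v) 0.
  by rewrite mulmx0 !enorm0 mulr0.
have pos : 0 < enorm v by rewrite lt_def nz enorm_ge0.
rewrite -ler_pdivrMr // mulrC.
have -> : (enorm v)^-1 * enorm (M *m v) = enorm (M *m ((enorm v)^-1 *: v)).
  by rewrite -scalemxAr enormZ ger0_norm // invr_ge0 ltW.
apply: (sup_upper_bound (has_sup_spnorm M)).
exists ((enorm v)^-1 *: v) => //=.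
by rewrite enormZ ger0_norm ?invr_ge0 ?enorm_ge0 // mulVf ?lexx.
Qed.

Lemma spnorm_le M c : 0 <= c -> mxbound M c -> spnorm M <= c.
Proof.
move=> c0 h; apply: ge_sup; first by exists (enorm (M *m 0)), 0 => //=; rewrite enorm0.
move=> _ [v /= v1 <-]; apply: le_trans (h v) _.
by rewrite ler_piMr.
Qed.

Lemma spnorm_ge0 M : 0 <= spnorm M.
Proof.
apply: (sup_upper_bound (has_sup_spnorm M)).
by exists 0 => /=; rewrite ?mulmx0 enorm0.
Qed.

End Mxbound.

Lemma mxbound1 n : mxbound (1%:M : 'M[R]_n) 1.
Proof. by move=> v; rewrite mul1mx mul1r. Qed.

Lemma mxbound_diag n (d : 'rV[R]_n) c : 0 <= c ->
  (forall i, `|d ord0 i| <= c) -> mxbound (diag_mx d) c.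
Proof.
move=> c0 h v; apply: enorm_coordle => // i.
by rewrite mul_diag_mx mxE normrM ler_wpM2r.
Qed.

End Euclidean.

(** * Spectral theorem for real symmetric matrices *)

Section Spectral.
Context {R : realType}.

Lemma symmetric_eigenvector n (A : 'M[R]_n.+1) : A^T = A ->
  exists (l : R) (v : 'cV[R]_n.+1), v != 0 /\ A *m v = l *: v.
Proof.
move=> symA.
have [a /eigenvalueP[v]] :=
  @eigenvalue_closed (complex R) _ (map_mx (complex.real_complex R) A) isT.
move=> eva v0.
pose x : 'cV[R]_n.+1 := \col_j complex.Re (v ord0 j).
pose y : 'cV[R]_n.+1 := \col_j complex.Im (v ord0 j).
case: a eva => s t eva.
have sumE (I : Type) (r : seq I) (f : I -> (complex R)) (g : I -> R) :
    complex.Re (\sum_(i <- r) f i * complex.real_complex R (g i)) =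
      \sum_(i <- r) g i * complex.Re (f i) /\
    complex.Im (\sum_(i <- r) f i * complex.real_complex R (g i)) =
      \sum_(i <- r) g i * complex.Im (f i).
  elim: r => [|i r [IHr IHi]]; first by rewrite !big_nil.
  rewrite !big_cons -IHr -IHi; case: (f i) => p q /=.
  case: (\sum_(j <- r) _) => p' q' /=; split; ring.
have Ax : A *m x = s *: x - t *: y.
  apply/colP => j; have := congr1 (fun M : 'rV_n.+1 => complex.Re (M ord0 j)) eva.
  rewrite !mxE; under [in X in complex.Re X = _ -> _]eq_bigr do rewrite mxE.
  rewrite (sumE _ _ _ _).1; case: (v ord0 j) => p q /= <-.
  by apply: eq_bigr => i _; rewrite !mxE -{1}symA mxE.
have Ay : A *m y = t *: x + s *: y.
  apply/colP => j; have := congr1 (fun M : 'rV_n.+1 => complex.Im (M ord0 j)) eva.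
  rewrite !mxE; under [in X in complex.Im X = _ -> _]eq_bigr do rewrite mxE.
  rewrite (sumE _ _ _ _).2; case: (v ord0 j) => p q /= h.
  rewrite addrC -h.
  by apply: eq_bigr => i _; rewrite !mxE -{1}symA mxE.
have xy0 : (x != 0) || (y != 0).
  apply: contraNT v0; rewrite negb_or !negbK => /andP[/eqP x0 /eqP y0].
  apply/eqP/rowP => j; rewrite mxE.
  move: (congr1 (fun M : 'cV_n.+1 => M j ord0) x0) (congr1 (fun M : 'cV_n.+1 => M j ord0) y0).
  by rewrite !mxE; case: (v ord0 j) => p q /= -> ->.
(* Symmetry equates <A x, y> and <x, A y>, which leaves t (|x|^2 + |y|^2) = 0. So the complex
   eigenvalue s + i t is real, and a nonzero part of v is a real eigenvector. *)
have t0 : t = 0.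
  have := dotp_mulmx A x y; rewrite symA Ax Ay.
  rewrite dotpBl dotpDr !dotpZl !dotpZr => /eqP.
  rewrite -subr_eq0.
  have -> : s * dotp x y - t * dotp y y - (t * dotp x x + s * dotp x y) =
    - (t * (dotp x x + dotp y y)) by ring.
  rewrite oppr_eq0 mulf_eq0 => /orP[/eqP//|/eqP h].
  have zero z : dotp z z = 0 -> z = 0 :> 'cV[R]_n.+1.
    by move=> z0; apply: enorm_eq0; rewrite enormE z0 sqrtr0.
  move: h; have := dotpvv_ge0 x; have := dotpvv_ge0 y => hy hx h.
  by case/orP: xy0 => /eqP[]; apply: zero; lra.
case/orP: xy0 => nz; exists s; [exists x|exists y]; split => //.
  by rewrite Ax t0 scale0r subr0.
by rewrite Ay t0 scale0r add0r.
Qed.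

(** The reflection along w = v - e exchanges the unit vectors e and v. It is undefined for v = e,
    where the identity serves instead. *)
Lemma householder n (v : 'cV[R]_n.+1) : dotp v v = 1 ->
  exists H : 'M[R]_n.+1, [/\ H^T = H, H *m H = 1%:M & H *m delta_mx ord0 ord0 = v].
Proof.
move=> v1; pose e : 'cV[R]_n.+1 := delta_mx ord0 ord0; have [w wE] : exists w, w = v - e by exists (v - e).
have [w0|w0] := eqVneq w 0.
  exists 1%:M; split; rewrite ?trmx1 ?mulmx1 ?mul1mx //.
  by move/eqP: w0; rewrite wE subr_eq0 => /eqP ->.
have scal (z : 'cV[R]_n.+1) : w^T *m z = (dotp w z)%:M .
  apply/matrixP => i j; rewrite !mxE !ord1 eqxx mulr1n.
  by apply: eq_bigr => k _; rewrite !mxE.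
have ww0 : dotp w w != 0.
  by apply: contraNneq w0 => h; apply/eqP/enorm_eq0; rewrite enormE h sqrtr0.
pose H : 'M[R]_n.+1 := 1%:M - (2 / dotp w w) *: (w *m w^T).
have Hact z : H *m z = z - (2 * dotp w z / dotp w w) *: w.
  rewrite mulmxBl mul1mx -scalemxAl -mulmxA scal mul_mx_scalar scalerA.
  by congr (_ - _ *: _); ring.
have ee : dotp e e = 1 by rewrite -sqr_enorm enorm_delta expr1n.
exists H; split.
- by rewrite /H linearB /= linearZ /= trmx_mul trmxK trmx1.
- have HHz (z : 'cV[R]_n.+1) : H *m (H *m z) = z.
    rewrite Hact (Hact z) dotpBr dotpZr.
    rewrite -addrA -opprD -scalerDl.
    suff -> : 2 * dotp w z / dotp w w +
        2 * (dotp w z - 2 * dotp w z / dotp w w * dotp w w) / dotp w w = 0.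
      by rewrite scale0r subr0.
    by field.
  apply/matrixP => i j; have /colP/(_ i) := HHz (delta_mx j ord0).
  by rewrite mulmxA -colE !mxE eqxx andbT.
- rewrite -/e Hact.
  have -> : 2 * dotp w e / dotp w w = -1.
    apply: (mulIf ww0); rewrite divfK // wE !(dotpBl, dotpBr) v1 ee (dotpC e v); ring.
  by rewrite scaleN1r opprK wE addrC subrK.
Qed.

(** Deflation: conjugating by a reflection whose first column is a unit eigenvector makes A block
    diagonal, and the induction hypothesis applies to the lower block. *)
Lemma spectral_decomposition n (A : 'M[R]_n) : A^T = A ->
  exists V (d : 'rV[R]_n), V^T *m V = 1%:M /\ A = V *m diag_mx d *m V^T.
Proof.
elim: n A => [|n IH] A symA; first by exists 1%:M, 0; split; apply/matrixP => -[].
have [l [v [v0 Av]]] := symmetric_eigenvector symA.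
have nv : enorm v != 0 by apply: contraNneq v0 => /enorm_eq0 ->.
pose z := (enorm v)^-1 *: v.
have z1 : dotp z z = 1.
  by rewrite dotpZl dotpZr -sqr_enorm; field.
have Az : A *m z = l *: z by rewrite -scalemxAr Av !scalerA mulrC.
have [H [Hs HH He]] := householder z1.
pose e : 'cV[R]_n.+1 := delta_mx ord0 ord0.
have HAe : H *m A *m H *m e = l *: e.
  by rewrite -!mulmxA He Az -scalemxAr -[in LHS]He mulmxA HH mul1mx.
have HA0 i : (H *m A *m H) i ord0 = l *+ (i == ord0).
  have /colP/(_ i) := HAe; rewrite -colE mxE => ->.
  by rewrite !mxE andbT mulr_natr.
have [A' A'E] : exists A' : 'M[R]_(1 + n), A' = H *m A *m H by exists (H *m A *m H).
have A'0 (i : 'I_(1 + n)) : A' i ord0 = l *+ (i == ord0) by rewrite A'E; exact: HA0.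
have A'l i (j : 'I_1) : A' i (lshift n j) = l *+ (i == ord0).
  by rewrite -A'0; congr (A' _ _); apply: val_inj; rewrite ord1.
have sA' : A'^T = A' by rewrite A'E !trmx_mul Hs symA mulmxA.
have [V1 [d1 [oV1 eV1]]] : exists V (d : 'rV[R]_n), V^T *m V = 1%:M /\
    drsubmx A' = V *m diag_mx d *m V^T.
  by apply: IH; rewrite -[in RHS]sA' trmx_drsub.
have bA' : A' = block_mx l%:M 0 0 (drsubmx A').
  rewrite -[LHS]submxK; congr block_mx.
  - by apply/matrixP => i j; rewrite !mxE A'l !ord1.
  - rewrite -[in LHS]sA' -trmx_dlsub; apply/matrixP => i j.
    by rewrite !mxE A'l.
  - by apply/matrixP => i j; rewrite !mxE A'l.
pose V : 'M[R]_(1 + n) := block_mx 1%:M 0 0 V1.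
pose d : 'rV[R]_(1 + n) := row_mx (const_mx l) d1.
have oV : V^T *m V = 1%:M.
  rewrite /V tr_block_mx mulmx_block !trmx0 !trmx1 !(mulmx0, mul0mx, mul1mx, addr0, add0r).
  by rewrite oV1 -scalar_mx_block.
have eV : A' = V *m diag_mx d *m V^T.
  rewrite bA' eV1 /V diag_mx_row tr_block_mx !mulmx_block !trmx0 !trmx1.
  rewrite !(mulmx0, mul0mx, mul1mx, mulmx1, addr0, add0r).
  by congr block_mx; apply/matrixP => i j; rewrite !mxE !ord1.
exists (H *m V), d; split.
  by rewrite trmx_mul Hs mulmxA -(mulmxA V^T) HH mulmx1.
have -> : A = H *m A' *m H.
  by rewrite A'E !mulmxA HH mul1mx -mulmxA HH mulmx1.
by rewrite eV trmx_mul Hs !mulmxA.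
Qed.

(** Whichever eigendecomposition [xget] selects, V^T is the inverse of V, so polynomial evaluation
    commutes with the conjugation. The spectral theorem only ensures that there is one to select. *)
Lemma mxfun_horner n (M : 'M[R]_n.+1) (p : {poly R}) : M^T = M ->
  mxfun (horner p) M = horner_mx M p.
Proof.
move=> symM; rewrite /mxfun.
have := xgetPex (1%:M, 0) (P := eigendecomposition M).
set VL := xget _ _; case: VL => V d /= [|/= oV eV].
  by have [V' [d' [? ?]]] := spectral_decomposition symM; exists (V', d').
have uV : V \is a GRing.unit.
  by apply/unitrP; exists V^T; split => //; apply: mulmx1C.
have iV : invmx V = V^T.
  by rewrite -[LHS]mul1mx -oV mulmxK.
by rewrite eV -iV horner_mx_uconj // horner_mx_diag.
Qed.

End Spectral.

(** * The step polynomial *)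

Section StepPoly.
Context {R : realType}.

(** This is the central binomial coefficient of 2 i over i, divided by 4^i: the coefficient of y^i
    in (1 - y)^(-1/2). *)
Definition binom_half (i : nat) : R :=
  \prod_(1 <= j < i.+1) ((2 * j%:R - 1) / (2 * j%:R)).

Lemma binom_half0 : binom_half 0 = 1.
Proof. by rewrite /binom_half big_geq. Qed.

Lemma binom_halfS i :
  (i.+1)%:R * binom_half i.+1 = (i%:R + 1 / 2) * binom_half i.
Proof.
rewrite /binom_half big_nat_recr //= -/(binom_half i) -(natr1 i).
have : (i%:R + 1 : R) != 0 by rewrite natr1 pnatr_eq0.
by move: (i%:R : R) => t h; field.
Qed.

Lemma binom_half_ge0 i : 0 <= binom_half i.
Proof.
rewrite /binom_half big_seq; apply: prodr_ge0 => j.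
rewrite mem_index_iota => /andP[j0 _].
have : 1 <= j%:R :> R by rewrite ler1n.
by move=> h; apply: divr_ge0; lra.
Qed.

Lemma binom_half_le1 i : binom_half i <= 1.
Proof.
rewrite /binom_half big_seq; apply: prodr_ile1 => j.
rewrite mem_index_iota => /andP[j0 _].
have : 1 <= j%:R :> R by rewrite ler1n.
move=> h; rewrite divr_ge0 ?ler_pdivrMr; lra.
Qed.

(* The square of [\sum_i binom_half i * y ^ i = (1 - y)^(-1/2)] is the geometric
   series. *)
Lemma binom_half_conv m :
  \sum_(i < m.+1) binom_half i * binom_half (m - i) = 1.
Proof.
elim: m => [|m IH]; first by rewrite big_ord1 binom_half0 mulr1.
have m0 : (m.+1%:R : R) != 0 by rewrite pnatr_eq0.
apply: (mulfI m0); rewrite mulr1.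
(* Reflecting i to k - i replaces the factor k by 2 i, on which [binom_halfS] can act; a shift of
   the index then leads back to the sum for m. *)
have symE k (f : nat -> R) :
    k%:R * \sum_(i < k.+1) f i * f (k - i)%N = 2 * \sum_(i < k.+1) i%:R * (f i * f (k - i)%N).
  have rE : \sum_(i < k.+1) i%:R * (f i * f (k - i)%N) =
      \sum_(i < k.+1) (k%:R - i%:R) * (f i * f (k - i)%N).
    rewrite (reindex_inj rev_ord_inj) /=; apply: eq_bigr => i _.
    rewrite subSS subKn -1?ltnS // natrB -1?ltnS //; ring.
  rewrite [2]mulr2n mulrDl mul1r [in X in _ = X + _]rE -big_split mulr_sumr.
  by apply: eq_bigr => i _ /=; ring.
rewrite symE big_ord_recl mul0r add0r.
under eq_bigr => i _.
  rewrite lift0 subSS mulrA binom_halfS -mulrA mulrDl mul1r.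
  over.
rewrite big_split /= mulrDr -symE IH -mulr_sumr IH -(natr1 m); lra.
Qed.

Definition half_sum q : {poly R} := \poly_(i < q.+1) binom_half i.

Lemma step_polyE q (x : R) : step_poly q x = x * (half_sum q).[1 - x ^+ 2].
Proof.
rewrite horner_poly mulr_sumr /step_poly big_mkord; apply: eq_bigr => i _.
by rewrite -/(binom_half i) mulrAC -mulrA.
Qed.

Lemma half_sum_ge0 q (y : R) : 0 <= y -> 0 <= (half_sum q).[y].
Proof.
move=> y0; rewrite horner_poly; apply: sumr_ge0 => i _.
by rewrite mulr_ge0 ?binom_half_ge0 ?exprn_ge0.
Qed.

(** Up to degree q the square of the truncation has the full convolution coefficients, all equal to
    1; beyond q some terms are missing and the coefficients lie in [0, 1]. Both sides follow by
    comparison with geometric sums. *)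
Lemma half_sum_sqr q (y : R) : 0 <= y <= 1 ->
  1 - y ^+ q.+1 <= (1 - y) * (half_sum q).[y] ^+ 2 <= 1.
Proof.
move=> /andP[y0 y1].
have geom N : (1 - y) * \sum_(m < N) y ^+ m = 1 - y ^+ N.
  by rewrite -[RHS]opprB subrX1 -mulNr opprB.
set S := half_sum q.
have cS m : S`_m = if (m < q.+1)%N then binom_half m else 0 by rewrite coef_poly.
have cS0 m : 0 <= S`_m <= binom_half m.
  by rewrite cS; case: ifP => _; rewrite ?lexx ?binom_half_ge0.
have cSS m : 0 <= (S * S)`_m <= 1.
  rewrite coefM; apply/andP; split.
    by apply: sumr_ge0 => i _; apply: mulr_ge0; case/andP: (cS0 (nat_of_ord i)) => //;
       case/andP: (cS0 (m - i)%N).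
  rewrite -(binom_half_conv m); apply: ler_sum => i _.
  by apply: ler_pM; case/andP: (cS0 (nat_of_ord i)) => //; case/andP: (cS0 (m - i)%N).
have cSS1 m : (m <= q)%N -> (S * S)`_m = 1.
  move=> mq; rewrite coefM -(binom_half_conv m); apply: eq_bigr => i _.
  have iq : (i < q.+1)%N by apply: leq_trans (ltn_ord i) _.
  have miq : (m - i < q.+1)%N by rewrite ltnS; apply: leq_trans mq; exact: leq_subr.
  by rewrite !cS iq miq.
have sSS : (size (S * S)%R <= q.+1 + q.+1)%N.
  apply: leq_trans (size_polyMleq _ _) _; apply: leq_trans (leq_pred _) _.
  by apply: leq_add; apply: size_poly.
have -> : S.[y] ^+ 2 = \sum_(m < q.+1 + q.+1) (S * S)`_m * y ^+ m.
  by rewrite expr2 -hornerM (horner_coef_wide _ sSS).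
have y1' : 0 <= 1 - y by rewrite subr_ge0.
apply/andP; split.
  rewrite -geom ler_wpM2l // big_split_ord /= ler_wpDr //.
    apply: sumr_ge0 => i _; rewrite mulr_ge0 ?exprn_ge0 //.
    by case/andP: (cSS (q.+1 + i)%N).
  by apply: ler_sum => i _; rewrite cSS1 ?mul1r // -ltnS.
apply: (@le_trans _ _ (1 - y ^+ (q.+1 + q.+1))); last first.
  by rewrite lerBlDr lerDl exprn_ge0.
rewrite -geom ler_wpM2l //; apply: ler_sum => i _.
by rewrite ler_piMl ?exprn_ge0 //; case/andP: (cSS (nat_of_ord i)).
Qed.

Lemma step_poly_sqr q (x : R) : -1 <= x <= 1 ->
  1 - (1 - x ^+ 2) ^+ q.+1 <= step_poly q x ^+ 2 <= 1.
Proof.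
move=> /andP[x1 x2]; have y01 : 0 <= 1 - x ^+ 2 <= 1.
  by apply/andP; split; nra.
have := half_sum_sqr q y01.
by rewrite step_polyE exprMn subKr.
Qed.

Lemma step_poly_odd q (x : R) : step_poly q (- x) = - step_poly q x.
Proof. by rewrite !step_polyE sqrrN mulNr. Qed.

Lemma step_poly_norm_le1 q (x : R) : -1 <= x <= 1 -> `|step_poly q x| <= 1.
Proof.
move=> /(step_poly_sqr q) /andP[_ h]; rewrite -[1]normr1 -ler_sqr ?nnegrE //.
by rewrite !real_normK ?num_real // expr1n.
Qed.

Lemma step_poly_ge q (gamma eps x : R) : 0 <= gamma -> gamma <= x <= 1 ->
  (1 - gamma ^+ 2) ^+ q.+1 <= eps -> 1 - eps <= step_poly q x <= 1.
Proof.
move=> g0 /andP[gx x1] he.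
have x11 : -1 <= x <= 1 by apply/andP; split; lra.
have x0 : 0 <= x by lra.
have y0 : 0 <= 1 - x ^+ 2 by nra.
have := step_poly_sqr q x11; move=> /andP[h1 _].
have := step_poly_norm_le1 q x11; have p0 : 0 <= step_poly q x.
  by rewrite step_polyE mulr_ge0 // half_sum_ge0.
rewrite ger0_norm // => p1; rewrite p1 andbT.
have : (1 - x ^+ 2) ^+ q.+1 <= (1 - gamma ^+ 2) ^+ q.+1.
  apply: lerXn2r; rewrite ?nnegrE //; nra.
(* As p lies in [0, 1], the lower bound on p^2 passes to p without a square root. *)
have : step_poly q x ^+ 2 <= step_poly q x by nra.
lra.
Qed.

Lemma step_poly_approx_sign q (gamma eps : R) : 0 < gamma -> 0 <= eps ->
  (1 - gamma ^+ 2) ^+ q.+1 <= eps -> approx_sign gamma eps (step_poly q).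
Proof.
move=> g0 e0 he x x11; split.
- move=> xg; have xg' : gamma <= - x <= 1 by apply/andP; split; lra.
  have := step_poly_ge (ltW g0) xg' he; rewrite step_poly_odd => /andP[h1 h2].
  by apply/andP; split; lra.
- by move=> _; have := step_poly_norm_le1 q x11; rewrite ler_norml.
- move=> gx; apply: (step_poly_ge (ltW g0) _ he); rewrite gx; by case/andP: x11.
Qed.

Lemma approx_sign_step (gamma eps : R) (p : R -> R) : 0 <= eps ->
  approx_sign gamma eps p -> approx_step gamma eps (fun t => (1 + p t) / 2).
Proof.
move=> e0 h x x11; have [h1 h2 h3] := h x x11; split.
- by move=> /h1 /andP[? ?]; apply/andP; split; lra.
- by move=> /h2 /andP[? ?]; apply/andP; split; lra.
- by move=> /h3 /andP[? ?]; apply/andP; split; lra.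
Qed.

End StepPoly.

(** * Chebyshev polynomials *)

Section Chebyshev.
Context {R : realType}.

(** These are the addition formulas for the pair cos (l t), sin (l t) / sin t at X = cos t. Carrying
    both components makes Pell's identity a one-step induction; the three-term recurrences are
    derived from it. *)
Fixpoint chebyshev (l : nat) : {poly R} * {poly R} :=
  if l is l'.+1 then
    let: (t, u) := chebyshev l' in ('X * t - (1 - 'X ^+ 2) * u, 'X * u + t)
  else (1, 0).

(* [chebU l] is the Chebyshev polynomial of the second kind of degree l - 1. *)
Definition chebT l := (chebyshev l).1.
Definition chebU l := (chebyshev l).2.

Lemma chebTS l : chebT l.+1 = 'X * chebT l - (1 - 'X ^+ 2) * chebU l.
Proof. by rewrite /chebT /chebU /=; case: (chebyshev l). Qed.

Lemma chebUS l : chebU l.+1 = 'X * chebU l + chebT l.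
Proof. by rewrite /chebT /chebU /=; case: (chebyshev l). Qed.

Lemma chebTSS l : chebT l.+2 = 2 *: ('X * chebT l.+1) - chebT l.
Proof. by rewrite scaler_nat; rewrite !(chebTS, chebUS); ring. Qed.

Lemma chebUSS l : chebU l.+2 = 2 *: ('X * chebU l.+1) - chebU l.
Proof. by rewrite scaler_nat; rewrite !(chebTS, chebUS); ring. Qed.

Lemma cheb_pell l : chebT l ^+ 2 + (1 - 'X ^+ 2) * chebU l ^+ 2 = 1.
Proof.
elim: l => [|l IH]; first by rewrite /chebT /chebU /=; ring.
(* The last factor equals 1. One step multiplies T + U s by X + s, where s^2 = X^2 - 1, and the norm
   T^2 - s^2 U^2 is multiplicative. *)
transitivity ((chebT l ^+ 2 + (1 - 'X ^+ 2) * chebU l ^+ 2) * ('X ^+ 2 + (1 - 'X ^+ 2))).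
  by rewrite chebTS chebUS; ring.
by rewrite IH; ring.
Qed.

Lemma horner_chebT1 l : (chebT l).[1] = 1.
Proof.
suff: (chebT l).[1] = 1 /\ (chebT l.+1).[1] = 1 by case.
elim: l => [|l [IH1 IH2]]; first by rewrite chebTS /chebT /chebU /= !hornerE; split; ring.
by split=> //; rewrite chebTSS hornerD hornerN hornerZ hornerM hornerX IH1 IH2; ring.
Qed.

Lemma horner_chebT l (z : R) : z != 0 ->
  (chebT l).[(z + z^-1) / 2] = (z ^+ l + z ^- l) / 2.
Proof.
move=> z0.
suff: (chebT l).[(z + z^-1) / 2] = (z ^+ l + z ^- l) / 2 /\
      (chebT l.+1).[(z + z^-1) / 2] = (z ^+ l.+1 + z ^- l.+1) / 2 by case.
elim: l => [|l [IH1 IH2]].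
  rewrite chebTS /chebT /chebU /= !hornerE expr0 invr1 expr1; split; lra.
split=> //; rewrite chebTSS hornerD hornerN hornerZ hornerM hornerX IH1 IH2 !exprS.
have : z ^+ l != 0 by rewrite expf_neq0.
by move: (z ^+ l) => t t0; field; rewrite z0 t0.
Qed.

(** Nonnegativity propagates because 2 X T_(l+1) = T_(l+2) + T_l. That the weights sum to 1 is not
    recorded, since evaluation at 1 recovers it. *)
Lemma exprX_chebT i : exists2 w : nat -> R, (forall l, 0 <= w l) &
  'X ^+ i = \sum_(l < i.+1) w l *: chebT l.
Proof.
pose cone N (p : {poly R}) :=
  exists2 w : nat -> R, (forall l, 0 <= w l) & p = \sum_(l < N) w l *: chebT l.
have coneD N p q : cone N p -> cone N q -> cone N (p + q).
  move=> [v v0 ->] [w w0 ->]; exists (fun l => v l + w l).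
    by move=> l; rewrite addr_ge0.
  by rewrite -big_split; apply: eq_bigr => l _; rewrite scalerDl.
have coneZ N a p : 0 <= a -> cone N p -> cone N (a *: p).
  move=> a0 [v v0 ->]; exists (fun l => a * v l) => [l|]; first by rewrite mulr_ge0.
  by rewrite scaler_sumr; apply: eq_bigr => l _; rewrite scalerA.
have cone0 N : cone N 0.
  by exists (fun=> 0) => // ; rewrite big1 // => l _; rewrite scale0r.
have coneT N l : (l < N)%N -> cone N (chebT l).
  move=> lN; exists (fun j => (j == l)%:R) => [j|]; first by rewrite ler0n.
  rewrite (bigD1 (Ordinal lN)) //= eqxx scale1r big1 ?addr0 // => j jl.
  by rewrite (_ : (j == l :> nat) = false) ?scale0r //; apply/negbTE.
suff: cone i.+1 ('X ^+ i) by [].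
elim: i => [|i IH]; first by rewrite expr0; apply: (coneT 1%N 0%N).
rewrite exprS; case: IH => w w0 ->; rewrite mulr_sumr.
elim/big_ind: _ => [//|//|l _]; first exact: coneD.
rewrite -scalerAr; apply: (coneZ) => //.
case: l => -[|l] /= li.
  have -> : 'X * chebT 0 = chebT 1 by rewrite chebTS /chebU /=; ring.
  exact: coneT.
have -> : 'X * chebT l.+1 = 2^-1 *: (chebT l.+2 + chebT l).
  rewrite chebTSS subrK scalerA.
  have -> : 2^-1 * 2 = 1 :> R by lra.
  by rewrite scale1r.
by apply: coneZ; rewrite ?invr_ge0 //; apply: coneD; apply: coneT; rewrite // ltnW // ltnW.
Qed.

(* Evaluating [exprX_chebT] at (z + 1/z)/2 bounds the weight of the Chebyshev
   polynomials of degree at least d by 2 ((z + 1/z)/2)^i / z^d. *)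
Lemma chebT_tail n (Phi : {poly R} -> 'cV[R]_n) (d i : nat) (z rho K : R) :
  linear Phi -> 1 <= z -> 0 <= rho -> 0 <= K ->
  (forall l, (l < d)%N -> enorm (Phi (chebT l)) <= rho) ->
  (forall l, enorm (Phi (chebT l)) <= K) ->
  enorm (Phi ('X ^+ i)) <= rho + 2 * K * ((z + z^-1) / 2) ^+ i / z ^+ d.
Proof.
move=> linPhi z1 rho0 K0 hd hK; have [w w0 Xw] := exprX_chebT i.
have z0 : 0 < z by apply: lt_le_trans z1.
have zn0 : z != 0 by rewrite gt_eqF.
have sumw : \sum_(l < i.+1) w l = 1.
  have := congr1 (horner^~ 1) Xw; rewrite hornerXn expr1n horner_sum => ->.
  by apply: eq_bigr => l _; rewrite hornerZ horner_chebT1 mulr1.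
have sumz : \sum_(l < i.+1) w l * ((z ^+ l + z ^- l) / 2) = ((z + z^-1) / 2) ^+ i.
  have := congr1 (horner^~ ((z + z^-1) / 2)) Xw; rewrite hornerXn horner_sum => ->.
  by apply: eq_bigr => l _; rewrite hornerZ horner_chebT.
have Phi0 : Phi 0 = 0.
  by have := linPhi (-1) 0 0; rewrite scaler0 addr0 scaleN1r addNr.
have PhiE : Phi ('X ^+ i) = \sum_(l < i.+1) w l *: Phi (chebT l).
  rewrite Xw; elim/big_rec2: _ => [//|l y1 y2 _ <-].
  exact: linPhi.
rewrite PhiE; apply: le_trans (enorm_sum _ _ _) _.
have zd0 : 0 < z ^+ d by rewrite exprn_gt0.
(* For l >= d the second summand dominates K w_l because z^l / z^d >= 1; for l < d it is merely
   nonnegative. The sum can then run over all l, where both weighted sums are known. *)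
apply: (@le_trans _ _ (\sum_(l < i.+1) (w l * rho +
    2 * K / z ^+ d * (w l * ((z ^+ l + z ^- l) / 2))))).
  apply: ler_sum => l _; rewrite enormZ ger0_norm //.
  have zl0 : 0 < z ^+ l by rewrite exprn_gt0.
  have t0 : 0 <= 2 * K / z ^+ d * (w l * ((z ^+ l + z ^- l) / 2)).
    by rewrite !mulr_ge0 ?invr_ge0 ?addr_ge0 ?exprn_ge0 ?invr_ge0 ?exprn_ge0 // ltW.
  have [ld|dl] := ltnP l d.
    by apply: le_trans (ler_wpM2l (w0 l) (hd _ ld)) _; rewrite lerDl.
  apply: le_trans (ler_wpM2l (w0 l) (hK _)) _.
  rewrite ler_wpDl ?mulr_ge0 //.
  have -> : 2 * K / z ^+ d * (w l * ((z ^+ l + z ^- l) / 2)) =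
      w l * (K * ((z ^+ l + z ^- l) / z ^+ d)).
    by move: (z ^+ l + z ^- l) => s; field; rewrite gt_eqF.
  rewrite ler_wpM2l // ler_peMr // ler_pdivlMr // mul1r.
  apply: (@le_trans _ _ (z ^+ l)); first by rewrite ler_weXn2l.
  by rewrite lerDl invr_ge0 ltW.
rewrite big_split -mulr_suml sumw mul1r -mulr_sumr sumz lerD2l.
by rewrite -!mulrA (mulrC (z ^+ d)^-1).
Qed.

End Chebyshev.

(** * Chebyshev polynomials of symmetric contractions *)

Section MatrixChebyshev.
Context {R : realType}.

Lemma horner_mx_tr n (Y : 'M[R]_n.+1) p : Y^T = Y -> (horner_mx Y p)^T = horner_mx Y p.
Proof.
move=> sY; elim/poly_ind: p => [|p c IH]; first by rewrite !rmorph0 trmx0.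
rewrite rmorphD rmorphM /= horner_mx_X horner_mx_C linearD /= tr_scalar_mx.
rewrite -[in RHS]mulmxE trmx_mul IH sY; congr (_ + _).
by rewrite mulmxE -{1 4}(horner_mx_X Y) -!rmorphM mulrC.
Qed.

(** With w = T v the square of the image norm is |v|^2 - 2 |w|^2 + |T w|^2, and |T w| <= |w|. *)
Lemma sqr_contraction n (T : 'M[R]_n) : T^T = T -> mxbound T 1 ->
  mxbound (1%:M - T *m T) 1.
Proof.
move=> sT T1 v; rewrite mul1r; apply: enorm_le; rewrite ?enorm_ge0 // sqr_enorm.
rewrite mulmxBl mul1mx -mulmxA; set w := T *m v.
have -> : dotp (v - T *m w) (v - T *m w) =
    dotp v v - 2 * dotp w w + dotp (T *m w) (T *m w).
  have Twv : dotp (T *m w) v = dotp w w by rewrite dotp_mulmx sT.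
  by rewrite dotpBl !dotpBr (dotpC v) Twv; ring.
have := T1 w; rewrite mul1r -ler_sqr ?nnegrE ?enorm_ge0 // !sqr_enorm.
have := dotpvv_ge0 w; lra.
Qed.

Section Bounds.
Variables (n : nat) (Y : 'M[R]_n.+1).
Hypotheses (sY : Y^T = Y) (Y1 : mxbound Y 1).

(** Pell's identity splits |v|^2 into |T_l(Y) v|^2 and <(1 - Y^2) w, w> with w = U_l(Y) v. The
    second part is |w|^2 - |Y w|^2, nonnegative for a contraction. *)
Lemma mxbound_chebT l : mxbound (horner_mx Y (chebT l)) 1.
Proof.
move=> v; rewrite mul1r; apply: enorm_le; rewrite ?enorm_ge0 // sqr_enorm.
set t := horner_mx Y _; set u := horner_mx Y (chebU l).
have := congr1 (horner_mx Y) (cheb_pell l).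
rewrite rmorphD rmorphXn [X in _ + X]rmorphM rmorphB !rmorphXn !rmorph1 /= horner_mx_X -/t -/u.
move=> /(congr1 (fun M => dotp (M *m v) v)); rewrite mul1mx => <-.
have tt : dotp (t *m v) (t *m v) = dotp ((t ^+ 2) *m v) v.
  by rewrite dotpC dotp_mulmx horner_mx_tr // mulmxA dotpC mulmxE.
rewrite mulmxDl dotpDl -tt lerDl.
have -> : (1 - Y ^+ 2) * u ^+ 2 = u *m (1 - Y ^+ 2) *m u.
  have cu : u * (1 - Y ^+ 2) = (1 - Y ^+ 2) * u.
    by rewrite -{1 2}(horner_mx_X Y) -rmorphXn -(rmorph1 (horner_mx Y)) -rmorphB -!rmorphM mulrC.
  by rewrite !mulmxE cu expr2 mulrA.
rewrite -!mulmxA dotp_mulmx horner_mx_tr //; set w := u *m v.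
rewrite mulmxBl mul1mx expr2 -mulmxE -mulmxA dotpBl (dotp_mulmx Y) sY -!sqr_enorm subr_ge0.
by rewrite ler_sqr ?nnegrE ?enorm_ge0 //; have := Y1 w; rewrite mul1r.
Qed.

Lemma mxbound_chebU l : mxbound (horner_mx Y (chebU l)) l%:R.
Proof.
elim: l => [|l IH].
  by rewrite /chebU /= rmorph0; exact: mxbound0.
rewrite chebUS rmorphD rmorphM /= horner_mx_X -natr1.
apply: mxboundD; last exact: mxbound_chebT.
by rewrite -[l%:R]mul1r -mulmxE; apply: mxboundM.
Qed.

(** Duhamel's principle with zero start: a unit forcing at step j responds with [chebU (l - j)], the
    solution of the homogeneous recurrence with initial values 0 and 1. *)
Lemma chebyshev_recurrence (D r : nat -> 'cV[R]_n.+1) :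
  D 0%N = 0 -> D 1%N = r 0%N ->
  (forall l, D l.+2 = 2 *: (Y *m D l.+1) - D l + r l.+1) ->
  forall l, D l = \sum_(j < l) horner_mx Y (chebU (l - j)) *m r j.
Proof.
move=> D0 D1 DSS.
have U0 : horner_mx Y (chebU 0) = 0 by rewrite /chebU /= rmorph0.
have U1 : horner_mx Y (chebU 1) = 1 by rewrite chebUS /chebU /chebT /= mulr0 add0r rmorph1.
pose S l := \sum_(j < l.+1) horner_mx Y (chebU (l - j)) *m r j.
have SE l : S l = \sum_(j < l) horner_mx Y (chebU (l - j)) *m r j.
  by rewrite /S big_ord_recr /= subnn U0 mul0mx addr0.
suff DS l : D l = S l /\ D l.+1 = S l.+1 by move=> l; rewrite -SE; case: (DS l).
elim: l => [|l [IH1 IH2]].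
  by rewrite D0 D1 !SE big_ord0 big_ord1 subn0 U1 mul1mx.
split=> //; rewrite DSS IH1 IH2 (SE l.+2) big_ord_recr /= subSnn U1 mul1mx; congr (_ + _).
rewrite (SE l.+1) mulmx_sumr scaler_sumr /S -sumrB; apply: eq_bigr => j _.
have jl : (j <= l)%N by rewrite -ltnS.
rewrite (subSn (leqW jl)) (subSn jl) chebUSS rmorphB /= horner_mxZ rmorphM /= horner_mx_X.
by rewrite mulmxBl -scalemxAl -mulmxA.
Qed.

End Bounds.
End MatrixChebyshev.

(** * Krylov approximation of the step polynomial *)

Section StepPolyMatrix.
Context {R : realType}.

Definition stepP q : {poly R} :=
  'X * \sum_(i < q.+1) binom_half i *: (1 - 'X ^+ 2) ^+ i.

Lemma horner_stepP q x : (stepP q).[x] = step_poly q x.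
Proof.
rewrite step_polyE /stepP hornerM hornerX horner_sum horner_poly; congr (_ * _).
by apply: eq_bigr => i _; rewrite hornerZ !hornerE.
Qed.

Lemma horner_mx_stepP q n (M : 'M[R]_n.+1) : horner_mx M (stepP q) =
  \sum_(i < q.+1) binom_half i *: (M *m (1 - M *m M) ^+ i).
Proof.
rewrite rmorphM /= horner_mx_X rmorph_sum mulr_sumr; apply: eq_bigr => i _ /=.
by rewrite horner_mxZ rmorphXn rmorphB rmorphXn rmorph1 /= horner_mx_X -scalerAr expr2.
Qed.

Lemma mxbound_exp n (M : 'M[R]_n.+1) i : mxbound M 1 -> mxbound (M ^+ i) 1.
Proof.
move=> M1; elim: i => [|i IH]; first by rewrite expr0; exact: mxbound1.
by rewrite exprS -[1]mulr1 -mulmxE; apply: mxboundM.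
Qed.

Lemma mxbound_sum m n N (F : 'I_N -> 'M[R]_(m, n)) (c : 'I_N -> R) :
  (forall i, mxbound (F i) (c i)) -> mxbound (\sum_i F i) (\sum_i c i).
Proof.
move=> h v; rewrite mulmx_suml mulr_suml; apply: le_trans (enorm_sum _ _ _) _.
by apply: ler_sum => i _; apply: h.
Qed.

Lemma mxbound_stepP q n (M : 'M[R]_n.+1) : M^T = M -> mxbound M 1 ->
  mxbound (horner_mx M (stepP q)) q.+1%:R.
Proof.
move=> sM M1; rewrite horner_mx_stepP.
apply: (@mxboundW _ _ _ _ (\sum_(i < q.+1) 1)).
  by rewrite sumr_const card_ord.
apply: mxbound_sum => i.
apply: (@mxboundW _ _ _ _ (`|binom_half i| * (1 * 1))).
  by rewrite mulr1 mulr1 ger0_norm ?binom_half_ge0 ?binom_half_le1.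
by apply/mxboundZ/mxboundM => //; apply/mxbound_exp/sqr_contraction.
Qed.

(** The defect X A' - A X grows only linearly along powers, by telescoping through contractions. The
    intended X is the computed eigenvector matrix, with A the tridiagonal and A' the diagonal
    matrix. *)
Lemma stepP_intertwine q m n (X : 'M[R]_(n.+1, m.+1)) (A : 'M[R]_n.+1)
    (A' : 'M[R]_m.+1) (delta : R) :
  0 <= delta -> A^T = A -> A'^T = A' -> mxbound A 1 -> mxbound A' 1 ->
  mxbound (X *m A' - A *m X) delta ->
  mxbound (X *m horner_mx A' (stepP q) - horner_mx A (stepP q) *m X)
    (2 * q.+1%:R ^+ 2 * delta).
Proof.
move=> d0 sA sA' A1 A'1 hX.
have hY := sqr_contraction sA A1; have hY' := sqr_contraction sA' A'1.
have [Y YE] : exists Y, Y = 1%:M - A *m A by exists (1%:M - A *m A).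
have [Y' YE'] : exists Y', Y' = 1%:M - A' *m A' by exists (1%:M - A' *m A').
rewrite -YE in hY; rewrite -YE' in hY'.
have XY : mxbound (X *m Y' - Y *m X) (2 * delta).
  have -> : X *m Y' - Y *m X =
      - ((X *m A' - A *m X) *m A') - A *m (X *m A' - A *m X).
    rewrite YE YE' mulmxBr !mulmxBl mulmxBr mulmx1 mul1mx !mulmxA !opprB.
    by rewrite addrC addrA subrK [RHS]addrC addrA subrK.
  rewrite mulr2n mulrDl mul1r; apply: mxboundB.
    by apply: mxboundN; rewrite -[delta]mulr1; apply: mxboundM.
  by rewrite -[delta]mul1r; apply: mxboundM.
have XYi i : mxbound (X *m Y' ^+ i - Y ^+ i *m X) (i%:R * (2 * delta)).
  elim: i => [|i IH].
    by rewrite !expr0 mulmx1 mul1mx subrr mul0r; exact: mxbound0.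
  have -> : X *m Y' ^+ i.+1 - Y ^+ i.+1 *m X =
      (X *m Y' ^+ i - Y ^+ i *m X) *m Y' + Y ^+ i *m (X *m Y' - Y *m X).
    by rewrite !exprSr -!mulmxE mulmxBl mulmxBr !mulmxA addrA subrK.
  rewrite -natr1 mulrDl mul1r; apply: mxboundD.
    by rewrite -[i%:R * _]mulr1; apply: mxboundM => //; rewrite !mulr_ge0.
  by rewrite -[2 * _]mul1r; apply: mxboundM => //; apply: mxbound_exp.
rewrite !horner_mx_stepP -YE -YE' mulmx_sumr mulmx_suml -sumrB.
apply: (@mxboundW _ _ _ _ (\sum_(i < q.+1) (2 * q.+1%:R * delta))).
  rewrite sumr_const card_ord -mulr_natl; lra.
apply: mxbound_sum => i; rewrite -scalemxAr -scalemxAl -scalerBr.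
have iq : i.+1%:R <= q.+1%:R :> R by rewrite ler_nat.
apply: (@mxboundW _ _ _ _ (`|binom_half i| * (delta + i%:R * (2 * delta)))).
  rewrite ger0_norm ?binom_half_ge0 //.
  apply: le_trans (ler_piMl _ (binom_half_le1 _)) _.
    by rewrite addr_ge0 ?mulr_ge0.
  move: iq; rewrite -natr1; nra.
apply: mxboundZ.
have -> : X *m (A' *m Y' ^+ i) - A *m Y ^+ i *m X =
    (X *m A' - A *m X) *m Y' ^+ i + A *m (X *m Y' ^+ i - Y ^+ i *m X).
  by rewrite mulmxBl mulmxBr !mulmxA addrA subrK.
apply: mxboundD.
  by rewrite -[delta]mulr1; apply: mxboundM => //; apply: mxbound_exp.
by rewrite -[i%:R * _]mul1r; apply: mxboundM.
Qed.

End StepPolyMatrix.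

Section KrylovApproximation.
Context {R : realType}.

Lemma tridiag_support m (T : 'M[R]_m) (v : 'cV[R]_m) a :
  (forall i j : 'I_m, (j.+1 < i)%N -> T i j = 0) ->
  (forall i : 'I_m, (a < i)%N -> v i ord0 = 0) ->
  forall i : 'I_m, (a.+1 < i)%N -> (T *m v) i ord0 = 0.
Proof.
move=> hT hv i ai; rewrite mxE big1 // => j _.
have [ja|aj] := leqP j a; last by rewrite hv ?mulr0.
by rewrite hT ?mul0r //; apply: leq_trans ai; rewrite !ltnS.
Qed.

(* [W = B Q - Q T] is only controlled on vectors whose coordinates from k0 on
   vanish: the last column of W is not small when the Lanczos loop runs to its
   end. *)
Lemma krylov_stepP (n m k0 q d : nat) (B : 'M[R]_n.+1) (T : 'M[R]_m.+1)
    (Q : 'M[R]_(n.+1, m.+1)) (omega kappa z : R) :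
  B^T = B -> mxbound B 1 -> T^T = T -> mxbound T 1 ->
  (forall i j : 'I_m.+1, (j.+1 < i)%N -> T i j = 0) ->
  0 <= omega -> 0 <= kappa -> mxbound Q kappa -> (2 * d <= k0)%N -> 1 <= z ->
  (forall v : 'cV[R]_m.+1, (forall i : 'I_m.+1, (k0 <= i)%N -> v i ord0 = 0) ->
     enorm ((B *m Q - Q *m T) *m v) <= omega * enorm v) ->
  let e : 'cV[R]_m.+1 := delta_mx ord0 ord0 in
  enorm (horner_mx B (stepP q) *m (Q *m e) - Q *m (horner_mx T (stepP q) *m e)) <=
  q.+1%:R * ((4 * d%:R ^+ 2 + 1) * omega + 4 * kappa * ((z + z^-1) / 2) ^+ q / z ^+ d).
Proof.
move=> sB B1 sT T1 triT w0 k0' hQ dk z1 hW.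
set e : 'cV[R]_m.+1 := delta_mx ord0 ord0 => /=.
have [W WE] : exists W, W = B *m Q - Q *m T by exists (B *m Q - Q *m T).
rewrite -WE in hW.
have hYB := sqr_contraction sB B1; have hYT := sqr_contraction sT T1.
have [YB YBE] : exists YB : 'M[R]_n.+1, YB = 1%:M - B *m B by exists (1%:M - B *m B).
have [YT YTE] : exists YT : 'M[R]_m.+1, YT = 1%:M - T *m T by exists (1%:M - T *m T).
rewrite -YBE in hYB; rewrite -YTE in hYT.
have sYB : YB^T = YB by rewrite YBE linearB /= trmx1 trmx_mul sB.
have sYT : YT^T = YT by rewrite YTE linearB /= trmx1 trmx_mul sT.
pose C l := horner_mx YT (chebT l) *m e.
have e1 : enorm e = 1 by exact: enorm_delta.
have C1 l : enorm (C l) <= 1.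
  by have := mxbound_chebT sYT hYT l e; rewrite e1 mulr1.
have YTsupp (v : 'cV[R]_m.+1) a : (forall i : 'I_m.+1, (a < i)%N -> v i ord0 = 0) ->
    forall i : 'I_m.+1, (a.+2 < i)%N -> (YT *m v) i ord0 = 0.
  move=> hv i ai; rewrite YTE mulmxBl mul1mx -mulmxA mxE mxE hv; last first.
    by apply: leq_trans ai; rewrite !ltnS leqW.
  by rewrite (tridiag_support triT (tridiag_support triT hv)) ?subr0.
have Csupp l : forall i : 'I_m.+1, (2 * l < i)%N -> C l i ord0 = 0.
  suff: (forall i : 'I_m.+1, (2 * l < i)%N -> C l i ord0 = 0) /\
    (forall i : 'I_m.+1, (2 * l.+1 < i)%N -> C l.+1 i ord0 = 0) by case.
  have C0 : forall i : 'I_m.+1, (0 < i)%N -> C 0%N i ord0 = 0.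
    move=> i i0; rewrite /C /chebT /= rmorph1 mul1mx mxE andbT.
    by rewrite -val_eqE /= gtn_eqF.
  elim: l => [|l [IH1 IH2]].
    rewrite muln0; split=> // i; rewrite muln1 => i2.
    have -> : C 1%N = YT *m C 0%N.
      rewrite /C chebTS /chebU /= mulr0 subr0 rmorphM /= horner_mx_X.
      by rewrite -mulmxE mulmxA.
    exact: (YTsupp _ 0%N C0).
  split=> // i il.
  have -> : C l.+2 = 2 *: (YT *m C l.+1) - C l.
    rewrite /C chebTSS rmorphB /= horner_mxZ rmorphM /= horner_mx_X.
    by rewrite mulmxBl -scalemxAl -!mulmxA.
  rewrite mxE [X in X + _]mxE [X in _ + X]mxE (YTsupp _ _ IH2) ?mulr0 ?sub0r.
    by rewrite IH1 ?oppr0 //; apply: leq_trans il; rewrite ltnS leq_mul2l ltnW.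
  by apply: leq_trans il; rewrite !mulnS.
have hWC l : (l < d)%N -> enorm (W *m C l) <= omega.
  move=> ld; apply: le_trans (hW _ _) _; last by rewrite ler_piMr.
  move=> i ki; apply: Csupp; apply: leq_trans ki; apply: leq_trans dk.
  by rewrite ltn_mul2l.
(* [T *m C l] may reach coordinate 2 l + 1, one further than [C l]; this is still below k0 because 2
   l + 2 <= 2 d. *)
have hWTC l : (l < d)%N -> enorm (W *m (T *m C l)) <= omega.
  move=> ld; apply: le_trans (hW _ _) _; last first.
    rewrite ler_piMr //; apply: le_trans (T1 _) _; rewrite mul1r; exact: C1.
  move=> i ki; apply: (tridiag_support triT (Csupp l)).
  apply: leq_trans ki; apply: leq_trans dk.
  by apply: leq_trans (leq_mul (leqnn 2) ld); rewrite mulnS.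
pose b := Q *m e.
pose D l := horner_mx YB (chebT l) *m b - Q *m C l.
(* The forcing of the recurrence for D has weight 1 at l = 0, where T_1 = X T_0, and weight 2
   afterwards, from T_(l+2) = 2 X T_(l+1) - T_l. *)
pose r l := (if l is 0 then 1 else 2 : R) *: ((YB *m Q - Q *m YT) *m C l).
have YQ (v : 'cV[R]_m.+1) : (YB *m Q - Q *m YT) *m v = - (B *m (W *m v) + W *m (T *m v)).
  have -> : YB *m Q - Q *m YT = Q *m T *m T - B *m B *m Q.
    rewrite YBE YTE mulmxBl mulmxBr mul1mx mulmx1 opprB addrC addrA subrK.
    by rewrite !mulmxA.
  have BW : B *m W + W *m T = B *m B *m Q - Q *m T *m T.
    by rewrite WE mulmxBr mulmxBl !mulmxA addrA subrK.
  by rewrite !mulmxA -mulmxDl BW !mulmxBl opprB.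
have hr l : (l < d)%N -> enorm (r l) <= 4 * omega.
  move=> ld; rewrite /r enormZ YQ enormN.
  apply: (@le_trans _ _ (2 * (omega + omega))); last by lra.
  apply: ler_pM; rewrite ?normr_ge0 ?enorm_ge0 //.
    by case: (l); rewrite ?normr1 ?normr_nat //; lra.
  apply: le_trans (enormD _ _) _; apply: lerD; last exact: hWTC.
  by apply: le_trans (B1 _) _; rewrite mul1r hWC.
have DE := @chebyshev_recurrence _ _ YB D r.
have hD l : (l < d)%N -> enorm (D l) <= 4 * d%:R ^+ 2 * omega.
  move=> ld; rewrite DE.
  - apply: le_trans (enorm_sum _ _ _) _.
    apply: (@le_trans _ _ (\sum_(j < l) (d%:R * (4 * omega)))).
      apply: ler_sum => j _; apply: le_trans (mxbound_chebU sYB hYB _ _) _.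
      apply: ler_pM; rewrite ?ler0n ?enorm_ge0 //.
        by rewrite ler_nat; apply: leq_trans (leq_subr _ _) (ltnW ld).
      by apply: hr; apply: ltn_trans ld.
    rewrite sumr_const card_ord -[_ *+ l]mulr_natl.
    have ld' : l%:R <= d%:R :> R by rewrite ler_nat ltnW.
    rewrite (_ : 4 * d%:R ^+ 2 * omega = d%:R * (d%:R * (4 * omega))); last by ring.
    by rewrite ler_wpM2r // !mulr_ge0.
  - by rewrite /D /C /chebT /= !rmorph1 !mul1mx subrr.
  - rewrite /D /r scale1r /C chebTS /chebU /chebT /= mulr0 subr0 mulr1 !horner_mx_X.
    by rewrite rmorph1 mul1mx mulmxBl !mulmxA.
  move=> j; rewrite /D /r /C !chebTSS !rmorphB /= !horner_mxZ !rmorphM /= !horner_mx_X.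
  rewrite !mulmxBl -!scalemxAl !mulmxBr -!scalemxAr !scalerBr -!mulmxE !mulmxA !opprB.
  have zid (V : zmodType) (x y c f a : V) : x - y + (c - f) = x - a + (c - y) + (a - f).
    rewrite [RHS]addrAC (_ : x - a + (a - f) = x - f); last by rewrite addrA subrK.
    by rewrite addrACA [RHS]addrACA (addrC (- y)).
  exact: zid.
(* [Phi p] is the error for the polynomial X p(1 - X^2). For T_l with l < d it is expressed by [D l]
   and [W *m C l]; for the others only the triangle inequality is used, and [chebT_tail] combines
   the two bounds. *)
pose Phi (p : {poly R}) := B *m (horner_mx YB p *m b) - Q *m (T *m (horner_mx YT p *m e)).
have linPhi : linear Phi.
  move=> a p p'; rewrite /Phi !rmorphD /= !horner_mxZ !mulmxDl !mulmxDr.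
  rewrite -!(scalemxAl, scalemxAr) scalerBr opprD addrACA.
  by congr (_ + _ + _).
have hPhi l : (l < d)%N -> enorm (Phi (chebT l)) <= (4 * d%:R ^+ 2 + 1) * omega.
  move=> ld; have -> : Phi (chebT l) = B *m D l + W *m C l.
    rewrite /Phi /D WE -/(C l) mulmxBr mulmxBl !mulmxA addrA subrK; done.
  rewrite mulrDl mul1r; apply: le_trans (enormD _ _) _; apply: lerD; last exact: hWC.
  by apply: le_trans (B1 _) _; rewrite mul1r hD.
have hPhi' l : enorm (Phi (chebT l)) <= 2 * kappa.
  rewrite mulr2n mulrDl mul1r; apply: le_trans (enormB _ _) _; apply: lerD.
    apply: le_trans (B1 _) _; rewrite mul1r.
    apply: le_trans (mxbound_chebT sYB hYB _ _) _; rewrite mul1r.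
    by apply: le_trans (hQ _) _; rewrite e1 mulr1.
  apply: le_trans (hQ _) _; rewrite ler_piMr //.
  by apply: le_trans (T1 _) _; rewrite mul1r C1.
have y1 : 1 <= (z + z^-1) / 2.
  have z0 : 0 < z by lra.
  rewrite ler_pdivlMr // mul1r -subr_ge0.
  have -> : z + z^-1 - 2 = (z - 1) ^+ 2 / z by field; rewrite gt_eqF.
  by rewrite divr_ge0 ?sqr_ge0 ?ltW.
have om0 : 0 <= (4 * d%:R ^+ 2 + 1) * omega.
  by rewrite mulr_ge0 // addr_ge0 // mulr_ge0 // exprn_ge0.
have kap0 : 0 <= 2 * kappa by rewrite mulr_ge0.
have -> : horner_mx B (stepP q) *m b - Q *m (horner_mx T (stepP q) *m e) =
    \sum_(i < q.+1) binom_half i *: Phi ('X ^+ i).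
  rewrite !horner_mx_stepP -YBE -YTE !mulmx_suml mulmx_sumr -sumrB; apply: eq_bigr => i _.
  rewrite /Phi !rmorphXn /= !horner_mx_X -!scalemxAl -scalemxAr -scalerBr.
  by rewrite !mulmxA.
apply: le_trans (enorm_sum _ _ _) _.
set bd := (X in q.+1%:R * X).
apply: (@le_trans _ _ (\sum_(i < q.+1) bd)); last first.
  by rewrite sumr_const card_ord mulr_natl.
apply: ler_sum => i _; rewrite enormZ ger0_norm ?binom_half_ge0 //.
apply: le_trans (ler_piMl (enorm_ge0 _) (binom_half_le1 _)) _.
apply: le_trans (chebT_tail i linPhi z1 om0 kap0 hPhi hPhi') _.
rewrite /bd lerD2l mulrA (_ : 2 * 2 = 4); last by ring.
rewrite ler_wpM2r ?invr_ge0 ?exprn_ge0 //; first by lra.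
by rewrite ler_wpM2l ?mulr_ge0 // ler_weXn2l // -ltnS.
Qed.

End KrylovApproximation.

(** * Floating-point vector operations *)

Section FloatingPointVectors.
Context {R : realType}.
Variables (F : arith R) (u : R).
Hypotheses (u0 : 0 <= u) (F1 : requirement1 F u).

Lemma rel_approxP y z : rel_approx u y z -> `|z - y| <= u * `|y|.
Proof.
move=> [d du ->]; have -> : (1 + d) * y - y = d * y by ring.
by rewrite normrM ler_wpM2r.
Qed.

Lemma sum_seq_rcons (s : seq R) x :
  (sum_seq F (rcons s x)).1 = fl_add F (sum_seq F s).1 x.
Proof. by rewrite /sum_seq foldl_rcons. Qed.

Lemma sum_seq_time (s : seq R) : (sum_seq F s).2 = size s.
Proof.
elim/last_ind: s => [//|s x IH].
by rewrite /sum_seq foldl_rcons /= -/(sum_seq F s) IH addn1 size_rcons.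
Qed.

(** The fold starts with an addition to 0 that is rounded as well, hence the exponent [size s] and
    not one less. *)
Lemma sum_seq_err (s : seq R) :
  `|(sum_seq F s).1 - \sum_(x <- s) x| <= ((1 + u) ^+ size s - 1) * \sum_(x <- s) `|x|.
Proof.
have u0' := u0; have [Fadd _ _ _ _] := F1.
elim/last_ind: s => [|s x IH]; first by rewrite !big_nil mulr0 subr0 normr0.
rewrite sum_seq_rcons !big_rcons /= size_rcons exprSr.
have /rel_approxP := Fadd (sum_seq F s).1 x.
move: IH; set a := (sum_seq F s).1; set S := \sum_(y <- s) y; set A := \sum_(y <- s) `|y|.
set g := (1 + u) ^+ size s => IH h.
have SA : `|S| <= A by exact: ler_norm_sum.
have g1 : 1 <= g by rewrite exprn_ege1 // lerDl.
have e1 : `|a + x| <= g * A + `|x|.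
  have := ler_normD (a - S) (S + x); have := ler_normD S x.
  have -> : a - S + (S + x) = a + x by ring.
  by lra.
have := ler_normD (fl_add F a x - (a + x)) (a - S).
have -> : fl_add F a x - (a + x) + (a - S) = fl_add F a x - (S + x) by ring.
have x0 := normr_ge0 x.
have : u * `|a + x| <= u * (g * A + `|x|) by rewrite ler_wpM2l.
have : (g - 1) * `|x| >= 0 by rewrite mulr_ge0 // subr_ge0.
have : u * ((g - 1) * `|x|) >= 0 by rewrite !mulr_ge0 // subr_ge0.
lra.
Qed.

Lemma dot_val n (v w : 'cV[R]_n) : (dot F v w).1 =
  (sum_seq F [seq fl_mul F (v i ord0) (w i ord0) | i <- enum 'I_n]).1.
Proof. by rewrite /dot /=; congr (sum_seq _ _).1; apply: eq_map => i; rewrite mxE. Qed.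

Lemma dot_time n (v w : 'cV[R]_n) : (dot F v w).2 = (2 * n)%N.
Proof.
rewrite /dot /= sum_seq_time size_map size_enum_ord sum1_card card_ord.
by rewrite mul2n addnn.
Qed.

Lemma dot_err n (v w : 'cV[R]_n) :
  `|(dot F v w).1 - dotp v w| <= ((1 + u) ^+ n.+1 - 1) * (enorm v * enorm w).
Proof.
have u0' := u0; have [_ _ Fmul _ _] := F1.
rewrite dot_val; set s := map _ _.
have := sum_seq_err s; rewrite !big_map. rewrite -!enumT !big_enum /= size_map size_enum_ord.
set a := (sum_seq F s).1; set P := \sum_i fl_mul _ _ _; set AP := \sum_i `|fl_mul _ _ _|.
have := dotp_abs_le v w; set A := \sum_i _ => hA.
have hP : `|P - dotp v w| <= u * A.
  rewrite -sumrB mulr_sumr; apply: le_trans (ler_norm_sum _ _ _) _.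
  by apply: ler_sum => i _; apply/rel_approxP/Fmul.
have hAP : AP <= (1 + u) * A.
  rewrite mulr_sumr; apply: ler_sum => i _.
  have [d du ->] := Fmul (v i ord0) (w i ord0).
  rewrite normrM ler_wpM2r //; apply: le_trans (ler_normD _ _) _.
  by rewrite normr1 lerD2l.
have g1 : 1 <= (1 + u) ^+ n by rewrite exprn_ege1 // lerDl.
have A0 : 0 <= A by apply: sumr_ge0.
move=> h; apply: (@le_trans _ _ (((1 + u) ^+ n.+1 - 1) * A)); last first.
  by rewrite ler_wpM2l // subr_ge0 exprn_ege1 // lerDl.
have := ler_normD (a - P) (P - dotp v w).
have -> : a - P + (P - dotp v w) = a - dotp v w by ring.
have : ((1 + u) ^+ n - 1) * AP <= ((1 + u) ^+ n - 1) * ((1 + u) * A).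
  by rewrite ler_wpM2l // subr_ge0.
rewrite exprSr; nra.
Qed.

Lemma exprD1_le N : 2 * N%:R * u <= 1 -> (1 + u) ^+ N - 1 <= 2 * N%:R * u.
Proof.
move=> hN; have u0' := u0; suff h j : (j <= N)%N -> (1 + u) ^+ j - 1 <= 2 * j%:R * u by exact: h.
elim: j => [|j IH] jN; first by rewrite expr0 subrr mulr0 mul0r.
have {}IH := IH (ltnW jN).
have jN' : j%:R <= N%:R :> R by rewrite ler_nat ltnW.
have j0 : 0 <= j%:R :> R by [].
have : 2 * j%:R * u <= 1 by apply: le_trans hN; rewrite ler_wpM2r // ler_wpM2l.
rewrite exprSr -(natr1 j); set g := (1 + u) ^+ j in IH *; nra.
Qed.

(** A single eta for all vector operations decouples the analysis of the iteration from the scalar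
    rounding model and from the order of summation. *)
Record fl_bounds n (eta : R) : Prop := FlBounds {
  flb_scale : forall a (v : 'cV[R]_n),
    enorm ((vscale F a v).1 - a *: v) <= eta * enorm (a *: v);
  flb_sub : forall v w : 'cV[R]_n, enorm ((vsub F v w).1 - (v - w)) <= eta * enorm (v - w);
  flb_dot : forall v w : 'cV[R]_n, `|(dot F v w).1 - dotp v w| <= eta * (enorm v * enorm w);
  flb_norm : forall v : 'cV[R]_n, `|(norm F v).1 - enorm v| <= eta * enorm v;
  flb_div : forall a (v : 'cV[R]_n), a != 0 ->
    enorm ((vdiv F v a).1 - a^-1 *: v) <= eta * enorm (a^-1 *: v) }.

Lemma fl_boundsP n : 2 * n.+1%:R * u <= 1 -> fl_bounds n (6 * n.+1%:R * u).
Proof.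
move=> hu; have u0' := u0; have [Fadd Fsub Fmul Fdiv Fsqrt] := F1.
have hdot := exprD1_le hu; set e := 2 * n.+1%:R * u in hu hdot.
have ue : u <= e.
  have : 1 <= n.+1%:R :> R by rewrite ler1n.
  by rewrite /e; nra.
(* The norm dictates the factor 3: e N comes from the dot product and u r <= 2 e N from rounding the
   square root. *)
have -> : 6 * n.+1%:R * u = 3 * e by rewrite /e; ring.
have e0 : 0 <= e by lra.
have ue3 : u <= 3 * e by lra.
have e30 : 0 <= 3 * e by lra.
have dot_e (v w : 'cV[R]_n) : `|(dot F v w).1 - dotp v w| <= e * (enorm v * enorm w).
  by apply: le_trans (dot_err v w) _; rewrite ler_wpM2r // mulr_ge0 ?enorm_ge0.
have coord (v w : 'cV[R]_n) : (forall i, rel_approx u (v i ord0) (w i ord0)) ->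
    enorm (w - v) <= 3 * e * enorm v.
  move=> h; apply: enorm_coordle => // i; rewrite [(w - v) _ _]mxE [(- v) _ _]mxE.
  by apply: le_trans (rel_approxP (h i)) _; rewrite ler_wpM2r.
split.
- by move=> a v; apply: coord => i; rewrite !mxE.
- by move=> v w; apply: coord => i; rewrite !mxE.
- move=> v w; apply: le_trans (dot_e v w) _.
  by rewrite ler_wpM2r ?mulr_ge0 ?enorm_ge0 //; lra.
- move=> v; rewrite /norm /=; set s := (dot F v v).1.
  have := dot_e v v; rewrite -/s -expr2 -sqr_enorm.
  have := enorm_ge0 v; set N := enorm v => N0; rewrite ler_norml => /andP[h1 h2].
  have N20 := sqr_ge0 N.
  have s0 : 0 <= s by nra.
  have /rel_approxP := Fsqrt s s0; rewrite (ger0_norm (sqrtr_ge0 s)).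
  have := sqr_sqrtr s0; have := sqrtr_ge0 s; set r := Num.sqrt s => r0 rE h.
  (* Multiplying by r + N >= N turns the bound on r^2 - N^2 into a relative bound on r - N with the
     same constant. *)
  have hr : `|r - N| <= e * N.
    have [N00|Npos] := eqVneq N 0.
      suff -> : r = 0 by rewrite N00 mulr0 subr0 normr0.
      by apply/eqP; rewrite -sqrf_eq0 rE; apply/eqP; rewrite N00 in h1 h2; lra.
    have {}Npos : 0 < N by rewrite lt_def Npos.
    rewrite -(ler_pM2r Npos); apply: (@le_trans _ _ (`|r - N| * (r + N))).
      by rewrite ler_wpM2l // lerDr.
    rewrite -[r + N]ger0_norm ?addr_ge0 // -normrM.
    have -> : (r - N) * (r + N) = s - N ^+ 2 by rewrite -rE; ring.
    by rewrite -mulrA -expr2 ler_norml h1 h2.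
  have rb : r <= 2 * N by move: hr; rewrite ler_norml => /andP[]; nra.
  have := ler_normD (fl_sqrt F s - r) (r - N).
  have -> : fl_sqrt F s - r + (r - N) = fl_sqrt F s - N by ring.
  have : u * r <= e * (2 * N) by apply: ler_pM.
  by lra.
- move=> a v a0; apply: coord => i; rewrite !mxE mulrC; exact: Fdiv.
Qed.

End FloatingPointVectors.

(** * One Lanczos iteration *)

Section LanczosStep.
Context {R : realType}.

(** All errors are relative to the norm of w, so a tiny b does no harm: q stays nearly a unit vector
    and b q stays close to w. *)
Lemma normalize_err n (w q : 'cV[R]_n) (b eta : R) : 0 <= eta <= 1 / 1000 ->
  b != 0 -> `|b - enorm w| <= eta * enorm w ->
  enorm (q - b^-1 *: w) <= eta * enorm (b^-1 *: w) ->
  [/\ 0 < b, enorm (b *: q - w) <= eta * enorm w, enorm w <= 2 * b &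
      `|dotp q q - 1| <= 10 * eta].
Proof.
move=> /andP[e0 e1] b0; have N0 := enorm_ge0 w; set N := enorm w in N0 *.
rewrite ler_norml => /andP[h1 h2].
have bpos : 0 < b by rewrite lt_def b0 /=; nra.
have hN : N <= 2 * b by nra.
rewrite enormZ ger0_norm ?invr_ge0 ?(ltW bpos) // -/N => hq.
split=> //.
  have -> : b *: q - w = b *: (q - b^-1 *: w).
    by rewrite scalerBr scalerA divff // scale1r.
  rewrite enormZ (gtr0_norm bpos).
  apply: le_trans (ler_wpM2l (ltW bpos) hq) _.
  by rewrite (_ : b * _ = eta * N) //; field.
set c := b^-1 * N in hq.
have cb : c * b = N by rewrite /c; field.
have c1 : `|c - 1| <= 2 * eta.
  rewrite -(ler_pM2r bpos) -{1}(gtr0_norm bpos) -normrM mulrBl cb mul1r.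
  by rewrite ler_norml; apply/andP; split; nra.
have qc : `|enorm q - c| <= eta * c.
  have cE : enorm (b^-1 *: w) = c by rewrite enormZ ger0_norm // invr_ge0 ltW.
  have := enormD (b^-1 *: w) (q - b^-1 *: w); rewrite addrC subrK cE.
  have := enormB q (q - b^-1 *: w); rewrite opprB addrC subrK cE.
  by rewrite ler_norml => ? ?; apply/andP; split; lra.
rewrite -sqr_enorm; have := enorm_ge0 q; set Q := enorm q in qc * => Q0.
move: c1 qc; rewrite !ler_norml => /andP[? ?] /andP[? ?].
have ec : eta * c <= (11 / 10) * eta by nra.
have ? : Q <= 1 + (31 / 10) * eta by lra.
have ? : 1 - (31 / 10) * eta <= Q by lra.
by apply/andP; split; nra.
Qed.

Section Step.
Variables (n : nat) (B : 'M[R]_n) (eta beta alpha t : R).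
Variables (q qp a b v d w : 'cV[R]_n).
Hypotheses (sB : B^T = B) (B2 : mxbound B (1 / 2)) (heta : 0 <= eta <= 1 / 1000).
Hypotheses (hbeta : 0 <= beta <= 1) (hq : `|dotp q q - 1| <= 10 * eta).
(** The factor [beta ^+ 2] admits the first iteration, where beta and qp are 0 and qp is not a unit
    vector. *)
Hypothesis hqp : beta ^+ 2 * `|dotp qp qp - 1| <= 10 * eta.
Hypothesis ht : `|beta * (dotp (B *m qp) q - beta)| <= t.
Hypothesis ha : enorm (a - B *m q) <= eta * enorm q.
Hypothesis hb : enorm (b - beta *: qp) <= eta * enorm (beta *: qp).
Hypothesis hv : enorm (v - (a - b)) <= eta * enorm (a - b).
Hypothesis halpha : `|alpha - dotp v q| <= eta * (enorm v * enorm q).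
Hypothesis hd : enorm (d - alpha *: q) <= eta * enorm (alpha *: q).
Hypothesis hw : enorm (w - (v - d)) <= eta * enorm (v - d).

Let z := B *m q - beta *: qp.

Lemma iter_q : enorm q <= (101 / 100).
Proof.
have /andP[e0 e1] := heta; move: hq; rewrite ler_norml => /andP[_ h].
by apply: enorm_le; lra.
Qed.

Lemma iter_qp : enorm (beta *: qp) <= (101 / 100).
Proof.
have /andP[e0 e1] := heta; have /andP[b0 b1] := hbeta.
apply: enorm_le; first lra.
rewrite dotpZl dotpZr; have := ler_norm (dotp qp qp - 1).
have := hqp; have := normr_ge0 (dotp qp qp - 1).
set m := dotp qp qp; set l := `|_|; move=> l0 h1 h2.
have : beta ^+ 2 * (m - 1) <= beta ^+ 2 * l by rewrite ler_wpM2l ?sqr_ge0.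
have : beta ^+ 2 <= 1 by rewrite expr_le1.
by rewrite mulrA -expr2; lra.
Qed.

Lemma iter_v : enorm (v - z) <= 4 * eta.
Proof.
have /andP[e0 e1] := heta; have q1 := iter_q; have qp1 := iter_qp.
have ea : enorm (a - B *m q) <= (101 / 100) * eta.
  by apply: le_trans ha _; rewrite mulrC ler_wpM2r.
have eb : enorm (b - beta *: qp) <= (101 / 100) * eta.
  by apply: le_trans hb _; rewrite mulrC ler_wpM2r.
have Bq : enorm (B *m q) <= (505 / 1000) by apply: le_trans (B2 q) _; lra.
have na := enorm_split ea Bq; have nb := enorm_split eb qp1.
have ev : enorm (v - (a - b)) <= (153 / 100) * eta.
  apply: le_trans hv _; rewrite mulrC ler_wpM2r //.
  by apply: le_trans (enormB _ _) _; lra.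
have -> : v - z = (v - (a - b)) + ((a - B *m q) - (b - beta *: qp)).
  rewrite /z; apply/colP => i; rewrite !mxE; ring.
apply: le_trans (enormD _ _) _.
have := enormB (a - B *m q) (b - beta *: qp); lra.
Qed.

Lemma iter_z : enorm z <= (1515 / 1000).
Proof.
apply: le_trans (enormB _ _) _; have := iter_qp; have := B2 q; have := iter_q; lra.
Qed.

Lemma iter_vnorm : enorm v <= (152 / 100).
Proof.
have /andP[e0 e1] := heta; have := enorm_split iter_v iter_z; lra.
Qed.

Lemma iter_alpha_v : `|alpha - dotp v q| <= (16 / 10) * eta.
Proof.
have /andP[e0 e1] := heta; apply: le_trans halpha _; rewrite mulrC ler_wpM2r //.
have := ler_pM (enorm_ge0 _) (enorm_ge0 _) iter_vnorm iter_q; lra.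
Qed.

Lemma iter_alpha : `|alpha| <= (154 / 100).
Proof.
have /andP[e0 e1] := heta.
have h1 := iter_alpha_v; have h2 := dotp_le iter_vnorm iter_q.
have := ler_normD (alpha - dotp v q) (dotp v q); rewrite subrK; lra.
Qed.

Lemma iter_aq : enorm (alpha *: q) <= (1556 / 1000).
Proof.
rewrite enormZ; have := ler_pM (normr_ge0 _) (enorm_ge0 _) iter_alpha iter_q; lra.
Qed.

Lemma iter_d : enorm (d - alpha *: q) <= (16 / 10) * eta.
Proof.
have /andP[e0 e1] := heta; apply: le_trans hd _; rewrite mulrC ler_wpM2r //.
have := iter_aq; lra.
Qed.

Lemma iter_wvd : enorm (w - (v - d)) <= (31 / 10) * eta.
Proof.
have /andP[e0 e1] := heta; apply: le_trans hw _; rewrite mulrC ler_wpM2r //.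
apply: le_trans (enormB _ _) _.
have := iter_vnorm; have := enorm_split iter_d iter_aq; lra.
Qed.

Lemma iter_w : enorm (w - (z - alpha *: q)) <= 9 * eta.
Proof.
have /andP[e0 e1] := heta.
have -> : w - (z - alpha *: q) = (w - (v - d)) + ((v - z) - (d - alpha *: q)).
  apply/colP => i; rewrite !mxE; ring.
apply: le_trans (enormD _ _) _; have := enormB (v - z) (d - alpha *: q).
have := iter_wvd; have := iter_v; have := iter_d; lra.
Qed.

(** The bound is absolute, not relative to the norm of w. When beta' is small, q and q' may be far
    from orthogonal, so orthogonality is propagated only in the form beta' <q, q'>. *)
Lemma iter_wq : `|dotp w q| <= 25 * eta.
Proof.
have /andP[e0 e1] := heta.
have -> : dotp w q = (dotp v q - alpha) - alpha * (dotp q q - 1)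
    + (dotp (w - (v - d)) q - dotp (d - alpha *: q) q).
  by rewrite !dotpBl !dotpZl; ring.
have h1 := iter_alpha_v; rewrite distrC in h1.
have h2 := normrM_le iter_alpha hq.
have h3 := dotp_le iter_wvd iter_q; have h4 := dotp_le iter_d iter_q.
apply: le_trans (ler_normD _ _) _.
have := ler_normB (dotp v q - alpha) (alpha * (dotp q q - 1)).
have := ler_normB (dotp (w - (v - d)) q) (dotp (d - alpha *: q) q).
lra.
Qed.

Lemma iter_zaq : enorm (z - alpha *: q) <= (308 / 100).
Proof. by apply: le_trans (enormB _ _) _; have := iter_z; have := iter_aq; lra. Qed.

(** Pythagoras up to errors: <B qp, q> is close to beta and <z, q> to alpha, so beta^2 and alpha^2
    are subtracted from |B q|^2, which is about 1/4 at most. The drift enters twice through the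
    cross term. *)
Lemma iter_zaq_sqr : dotp (z - alpha *: q) (z - alpha *: q) <=
  1 / 4 - beta ^+ 2 - alpha ^+ 2 + 2 * t + 60 * eta.
Proof.
have /andP[e0 e1] := heta.
have zq : `|dotp z q - alpha| <= 6 * eta.
  have -> : dotp z q - alpha = (dotp v q - alpha) - dotp (v - z) q.
    by move: z => x; rewrite !dotpBl; ring.
  have := iter_alpha_v; rewrite distrC; have := dotp_le iter_v iter_q.
  have := ler_normB (dotp v q - alpha) (dotp (v - z) q); lra.
have -> : dotp (z - alpha *: q) (z - alpha *: q) =
    dotp z z - alpha ^+ 2 - 2 * (alpha * (dotp z q - alpha)) +
    alpha * (alpha * (dotp q q - 1)).
  by move: z => x; rewrite !(dotpBl, dotpBr, dotpZl, dotpZr) (dotpC q x); ring.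
have h1 := normrM_le iter_alpha zq.
have h2 := normrM_le iter_alpha (normrM_le iter_alpha hq).
have h3 : dotp z z <= 1 / 4 - beta ^+ 2 + 2 * t + 13 * eta.
  have -> : dotp z z = dotp (B *m q) (B *m q) - 2 * (beta * (dotp (B *m qp) q - beta))
      - beta ^+ 2 + beta ^+ 2 * (dotp qp qp - 1).
    rewrite /z !(dotpBl, dotpBr, dotpZl, dotpZr) [dotp (B *m qp) q]dotp_mulmx sB.
    by rewrite (dotpC (B *m q) qp); ring.
  have g1 : dotp (B *m q) (B *m q) <= 1 / 4 * dotp q q.
    rewrite -!sqr_enorm; have := B2 q; have := enorm_ge0 q; have := enorm_ge0 (B *m q).
    nra.
  have g2 : beta ^+ 2 * (dotp qp qp - 1) <= 10 * eta.
    by apply: le_trans hqp; rewrite ler_wpM2l ?sqr_ge0 // ler_norm.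
  move: ht hq; rewrite !ler_norml => /andP[? ?] /andP[? ?]; lra.
move: h1 h2; rewrite !ler_norml => /andP[? ?] /andP[? ?]; lra.
Qed.

Lemma iter_residual0 : w = 0 -> enorm (B *m q - beta *: qp - alpha *: q) <= 13 * eta.
Proof.
have /andP[e0 e1] := heta.
by move=> w0; have := iter_w; rewrite w0 sub0r enormN /z; lra.
Qed.

Section Next.
Variables (beta' : R) (q' : 'cV[R]_n).
Hypotheses (b'0 : beta' != 0) (hb' : `|beta' - enorm w| <= eta * enorm w).
Hypothesis hq' : enorm (q' - beta'^-1 *: w) <= eta * enorm (beta'^-1 *: w).
Hypothesis hqpq : `|beta * dotp qp q| <= 30 * eta.
(** This is the gap between 1/4 and 27/100. The 250 covers 60 from [iter_zaq_sqr], 82 from the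
    residual E and 102.4 from the normalisation of q'. *)
Hypothesis small : 2 * t + 250 * eta <= 2 / 100.

Lemma iter_next :
  [/\ beta' ^+ 2 + alpha ^+ 2 + beta ^+ 2 <= 27 / 100, 0 < beta',
      enorm (B *m q - beta *: qp - alpha *: q - beta' *: q') <= 13 * eta &
      [/\ `|dotp q' q' - 1| <= 10 * eta, `|beta' * dotp q q'| <= 30 * eta &
      `|beta' * (dotp (B *m q) q' - beta')| <= t + 110 * eta]].
Proof.
have /andP[e0 e1] := heta; have /andP[be0 be1] := hbeta.
have small1 := small; have [b'pos h1 h2 h3] := normalize_err heta b'0 hb' hq'.
have wle : enorm w <= (309 / 100) by have := enorm_split iter_w iter_zaq; lra.
have h4 : enorm (beta' *: q' - w) <= (31 / 10) * eta.
  by apply: le_trans h1 _; rewrite mulrC ler_wpM2r //; lra.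
have hE : enorm (B *m q - beta *: qp - alpha *: q - beta' *: q') <= 13 * eta.
  have -> : B *m q - beta *: qp - alpha *: q - beta' *: q' =
     - ((w - (z - alpha *: q)) + (beta' *: q' - w)).
    by rewrite /z; apply/colP => i; rewrite !mxE; ring.
  rewrite enormN; apply: le_trans (enormD _ _) _; have := iter_w; lra.
set E := _ - beta' *: q' in hE.
(* A crude bound, needed to control the normalisation error of q' before [b2] improves it to beta'
   <= 1. *)
have b'le : beta' <= (32 / 10).
  by move: hb'; rewrite ler_norml => /andP[_]; nra.
have b2 : beta' ^+ 2 + alpha ^+ 2 + beta ^+ 2 <= 27 / 100.
  have g1 : beta' ^+ 2 * dotp q' q' <= dotp (z - alpha *: q) (z - alpha *: q) + 82 * eta.
    have -> : beta' ^+ 2 * dotp q' q' = dotp (z - alpha *: q - E) (z - alpha *: q - E).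
      have -> : z - alpha *: q - E = beta' *: q'.
        by rewrite /E /z; apply/colP => i; rewrite !mxE; ring.
      by rewrite dotpZl dotpZr; ring.
    rewrite (dotpBB _ E).
    have := dotp_le iter_zaq hE; have := dotp_le hE hE; rewrite !ler_norml.
    by move=> /andP[? ?] /andP[? ?]; nra.
  have g2 := iter_zaq_sqr.
  have g3 : - (beta' ^+ 2 * (dotp q' q' - 1)) <= (32 / 10) ^+ 2 * (10 * eta).
    apply: le_trans (ler_norm _) _; rewrite normrN; apply: normrM_le => //.
    by rewrite ger0_norm ?sqr_ge0 // ler_sqr ?nnegrE //; lra.
  lra.
have al1 : `|alpha| <= 1.
  rewrite -(expr_le1 (n := 2)) // real_normK ?num_real //.
  by have := sqr_ge0 beta; have := sqr_ge0 beta'; lra.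
have be'1 : `|beta'| <= 1.
  rewrite -(expr_le1 (n := 2)) // real_normK ?num_real //.
  by have := sqr_ge0 beta; have := sqr_ge0 alpha; lra.
have h5 : `|beta' * dotp q q'| <= 30 * eta.
  have -> : beta' * dotp q q' = dotp w q + dotp (beta' *: q' - w) q.
    by rewrite dotpBl dotpZl (dotpC q q'); ring.
  apply: le_trans (ler_normD _ _) _.
  by have := iter_wq; have := dotp_le h4 iter_q; lra.
split=> //; split=> //.
(* Expanding <B q, q'> leaves beta beta' <qp, q'>, which the same relation paired with qp expresses
   by <B qp, q>, using the symmetry of B. The previous drift thus enters with coefficient exactly 1,
   whence linear and not exponential growth; the other terms add up to less than 110 eta. *)
have -> : beta' * (dotp (B *m q) q' - beta') =
    beta * (dotp (B *m qp) q - beta) - beta ^+ 2 * (dotp qp qp - 1)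
    - alpha * (beta * dotp qp q) - dotp (beta *: qp) E
    + alpha * (beta' * dotp q q') + beta' * beta' * (dotp q' q' - 1) + beta' * dotp E q'.
  have -> : dotp (B *m q) q' = beta * dotp qp q' + alpha * dotp q q'
      + beta' * dotp q' q' + dotp E q'.
    by rewrite /E !dotpBl !dotpZl; ring.
  have -> : dotp (beta *: qp) E = beta * (dotp (B *m qp) q - beta * dotp qp qp
      - alpha * dotp qp q - beta' * dotp qp q').
    by rewrite /E dotpZl !dotpBr !dotpZr dotp_mulmx sB.
  by ring.
clearbody E.
have k1 := normrM_le al1 hqpq; have k2 := dotp_le iter_qp hE.
have k3 := normrM_le al1 h5.
have k4 : `|beta' * beta' * (dotp q' q' - 1)| <= 1 * 1 * (10 * eta).
  by apply: normrM_le => //; apply: normrM_le.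
have q'1 : enorm q' <= (101 / 100).
  by move: h3; rewrite ler_norml => /andP[_ h]; apply: enorm_le; lra.
have k5 := normrM_le be'1 (dotp_le hE q'1).
have k6 : `|beta ^+ 2 * (dotp qp qp - 1)| <= 10 * eta.
  by rewrite normrM ger0_norm ?sqr_ge0.
move: ht k1 k2 k3 k4 k5 k6; rewrite !ler_norml.
move=> /andP[? ?] /andP[? ?] /andP[? ?] /andP[? ?] /andP[? ?] /andP[? ?] /andP[? ?].
by apply/andP; split; lra.
Qed.

End Next.

End Step.
End LanczosStep.

(** * The Lanczos loop *)

Section LanczosLoop.
Context {R : realType}.
Variables (F : arith R) (n : nat) (B : 'M[R]_n) (mulB : 'cV[R]_n -> timed 'cV[R]_n).
Variable eta : R.
Hypotheses (sB : B^T = B) (B2 : mxbound B (1 / 2)) (heta : 0 <= eta <= 1 / 50 / 50 / 20).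
Hypothesis flb : fl_bounds F n eta.
Hypothesis hmul : forall w, enorm ((mulB w).1 - B *m w) <= eta * enorm w.

(* t bounds the drift of <B q_(i-1), q_i> from beta_i; local orthogonality makes
   it grow only linearly with i. *)
Definition lanczos_inv (beta : R) (qp q : 'cV[R]_n) (t : R) : Prop :=
  [/\ 0 <= beta <= 1, `|dotp q q - 1| <= 10 * eta,
      beta ^+ 2 * `|dotp qp qp - 1| <= 10 * eta, `|beta * dotp qp q| <= 30 * eta &
      `|beta * (dotp (B *m qp) q - beta)| <= t].

(* Past the end of s, [coef_beta] and the basis vector are 0 by the default of [nth]. *)
Definition lanczos_spec (k : nat) (beta : R) (qp q : 'cV[R]_n)
    (s : seq (R * R * 'cV[R]_n)) : Prop :=
  [/\ (size s <= k)%N,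
      (0 < k)%N -> exists alpha s', s = (alpha, beta, q) :: s',
      forall i, (i < size s)%N -> enorm (nth (0, 0, 0) s i).2 <= 2,
      forall i, (i < size s)%N ->
        coef_beta s i.+1 ^+ 2 + coef_alpha s i ^+ 2 + coef_beta s i ^+ 2 <= 27 / 100 &
      forall i, (i < size s)%N -> (i.+1 < size s)%N || (size s < k)%N ->
        enorm (B *m (nth (0, 0, 0) s i).2
          - coef_beta s i *: nth 0 (qp :: [seq x.2 | x <- s]) i
          - coef_alpha s i *: (nth (0, 0, 0) s i).2
          - coef_beta s i.+1 *: (nth (0, 0, 0) s i.+1).2) <= 13 * eta].

Lemma lanczos_loopS k beta qp q :
  let a := (mulB q).1 in
  let b := (vscale F beta qp).1 in
  let v := (vsub F a b).1 in
  let alpha := (dot F v q).1 in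
  let d := (vscale F alpha q).1 in
  let w := (vsub F v d).1 in
  let beta' := (norm F w).1 in
  let q' := (vdiv F w beta').1 in
  (lanczos_loop F mulB k.+1 beta qp q).1 =
  (alpha, beta, q) :: if beta' == 0 then [::] else (lanczos_loop F mulB k beta' q q').1.
Proof.
move=> a b v alpha d w beta' q'.
rewrite [LHS](_ : _ = (if beta' == 0 then ret [:: (alpha, beta, q)] else
  let! q' := vdiv F w beta' in
  let! rest := lanczos_loop F mulB k beta' q q' in
  ret ((alpha, beta, q) :: rest)).1); last by [].
by case: ifP.
Qed.

Lemma lanczos_loopP k beta qp q t :
  lanczos_inv beta qp q t -> 2 * (t + k%:R * (110 * eta)) + 250 * eta <= 2 / 100 ->
  lanczos_spec k beta qp q (lanczos_loop F mulB k beta qp q).1.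
Proof.
have /andP[e0 e1] := heta; have heta' : 0 <= eta <= 1 / 1000 by rewrite e0; lra.
elim: k beta qp q t => [|k IH] beta qp q t.
  by move=> _ _; split.
move=> [hbeta hq hqp hqpq ht] hk; rewrite lanczos_loopS; cbv zeta.
have ha := hmul q; set a := (mulB q).1 in ha *.
have hb := flb_scale flb beta qp; set b := (vscale F beta qp).1 in hb *.
have hv := flb_sub flb a b; set v := (vsub F a b).1 in hv *.
have hal := flb_dot flb v q; set alpha := (dot F v q).1 in hal *.
have hd := flb_scale flb alpha q; set d := (vscale F alpha q).1 in hd *.
have hw := flb_sub flb v d; set w := (vsub F v d).1 in hw *.
have hb' := flb_norm flb w; set beta' := (norm F w).1 in hb' *.
clearbody beta' w d alpha v b a.
have k0 : 0 <= k%:R * (110 * eta) by rewrite !mulr_ge0.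
have hk1 : 2 * t + 250 * eta <= 2 / 100 by rewrite -natr1 in hk; lra.
have t0 : 0 <= t by apply: le_trans ht.
have q2 : enorm q <= 2 by have := iter_q heta' hq; lra.
(* A computed norm equal to 0 forces w = 0, since its relative error is below 1. An early exit
   therefore leaves a last residual of rounding size. *)
have [b'0|b'0] := boolP (beta' == 0).
  have w0 : w = 0.
    apply: enorm_eq0; move: hb'; rewrite (eqP b'0) sub0r normrN ger0_norm ?enorm_ge0 //.
    by have := enorm_ge0 w; nra.
  have hres := iter_residual0 B2 heta' hbeta hq hqp ha hb hv hal hd hw w0.
  have hsq := iter_zaq_sqr sB B2 heta' hbeta hq hqp ht ha hb hv hal.
  (* With no beta' to bound, nonnegativity of this square still yields alpha^2 + beta^2 <=
     27/100. *)
  have hzz := dotpvv_ge0 (B *m q - beta *: qp - alpha *: q).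
  split=> //.
  - by move=> _; exists alpha, [::].
  - by case.
  - case=> // _; rewrite /coef_beta /coef_alpha /= expr0n /=; lra.
  - by case=> // _ _; rewrite /coef_beta /coef_alpha /= scale0r subr0.
have hq' := flb_div flb w b'0; set q' := (vdiv F w beta').1 in hq' *.
have [hsq b'pos hE [h1 h2 h3]] :=
  iter_next sB B2 heta' hbeta hq hqp ht ha hb hv hal hd hw b'0 hb' hq' hqpq hk1.
have b'1 : beta' <= 1.
  rewrite -(expr_le1 (n := 2)) ?(ltW b'pos) //.
  by have := sqr_ge0 beta; have := sqr_ge0 alpha; lra.
have inv' : lanczos_inv beta' q q' (t + 110 * eta).
  split=> //; first by rewrite (ltW b'pos).
  apply: le_trans hq; rewrite ler_piMl // expr_le1 // ltW //.
have hk' : 2 * (t + 110 * eta + k%:R * (110 * eta)) + 250 * eta <= 2 / 100.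
  by rewrite -natr1 in hk; lra.
have := IH _ _ _ _ inv' hk'; set s := (lanczos_loop F mulB k beta' q q').1.
case=> [ss s0 sq ssq sres].
have hs : k = 0%N /\ s = [::] \/ exists al s', s = (al, beta', q') :: s'.
  case: (posnP k) => [k00|/s0]; last by right.
  by left; move: ss; rewrite k00 leqn0 => /nilP.
split=> //.
- by move=> _; exists alpha, s.
- by case=> [|i] //= si; apply: sq.
- case=> [_|i si]; last exact: ssq.
  case: hs => [[_ ->]|[al [s' ->]]]; rewrite /coef_beta /coef_alpha //=.
  by rewrite expr0n /= add0r; have := sqr_ge0 beta'; lra.
- case=> [_|i si]; last exact: sres.
  by case: hs => [[-> ->]|[al [s' ->]]].
Qed.

End LanczosLoop.

(** * The tridiagonal matrix *)

Section TridiagonalMatrix.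
Context {R : realType}.

(** Schur's test: w_i v_j is at most w_i^2 / (2 c) + c v_j^2 / 2 in absolute value; row sums bound
    the first part and column sums, equal by symmetry, the second. *)
Lemma mxbound_rowsum m (T : 'M[R]_m) (c : R) : 0 < c -> T^T = T ->
  (forall i, \sum_j `|T i j| <= c) -> mxbound T c.
Proof.
move=> c0 sT hT v; set w := T *m v.
have hT' j : \sum_i `|T i j| <= c.
  apply: le_trans (hT j); apply: ler_sum => i _.
  by rewrite -[in leLHS]sT mxE.
have h : dotp w w <= dotp w w / 2 + c ^+ 2 * dotp v v / 2.
  have dE : dotp w w = \sum_i \sum_j T i j * (w i ord0 * v j ord0).
    apply: eq_bigr => i _; rewrite {2}/w mxE mulr_sumr; apply: eq_bigr => j _; ring.
  rewrite {1}dE.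
  apply: (@le_trans _ _ (\sum_i \sum_j (`|T i j| * (w i ord0 ^+ 2 / (2 * c)) +
      `|T i j| * (c * v j ord0 ^+ 2 / 2)))).
    apply: ler_sum => i _; apply: ler_sum => j _.
    set x := w i ord0; set y := v j ord0; set a := T i j.
    rewrite -mulrDr; apply: le_trans (ler_norm _) _; rewrite normrM ler_wpM2l //.
    rewrite -subr_ge0; have [xy|xy] := ger0P (x * y).
      have -> : x ^+ 2 / (2 * c) + c * y ^+ 2 / 2 - x * y = (x - c * y) ^+ 2 / (2 * c).
        by field; rewrite gt_eqF.
      by rewrite divr_ge0 ?sqr_ge0 // mulr_ge0 // ltW.
    have -> : x ^+ 2 / (2 * c) + c * y ^+ 2 / 2 - - (x * y) = (x + c * y) ^+ 2 / (2 * c).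
      by field; rewrite gt_eqF.
    by rewrite divr_ge0 ?sqr_ge0 // mulr_ge0 // ltW.
  under eq_bigr do rewrite big_split -mulr_suml.
  rewrite big_split /=; apply: lerD.
    rewrite /dotp mulr_suml; apply: ler_sum => i _.
    rewrite (_ : w i ord0 * _ / 2 = c * (w i ord0 ^+ 2 / (2 * c))); last first.
      by field; rewrite gt_eqF.
    by rewrite ler_wpM2r // divr_ge0 ?sqr_ge0 // mulr_ge0 // ltW.
  rewrite exchange_big /= /dotp mulr_sumr mulr_suml; apply: ler_sum => j _.
  rewrite -mulr_suml (_ : c ^+ 2 * _ / 2 = c * (c * v j ord0 ^+ 2 / 2)); last by ring.
  by rewrite ler_wpM2r // divr_ge0 // mulr_ge0 ?sqr_ge0 // ltW.
apply: enorm_le; first by rewrite mulr_ge0 ?enorm_ge0 // ltW.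
rewrite exprMn sqr_enorm; lra.
Qed.

Lemma sum_nat_ind m (f : nat -> R) c : (forall i, (m <= i)%N -> f i = 0) ->
  \sum_(i < m) f i * (i == c :> nat)%:R = f c.
Proof.
move=> f0; have [cm|mc] := ltnP c m.
  rewrite (bigD1 (Ordinal cm)) //= eqxx mulr1 big1 ?addr0 // => i ic.
  by rewrite (_ : (i == c :> nat) = false) ?mulr0 //; apply/negbTE.
rewrite (f0 c) // big1 // => i _.
by rewrite ltn_eqF ?mulr0 //; apply: leq_trans mc.
Qed.

Section Spec.
Variables (n : nat) (s : seq (R * R * 'cV[R]_n)).

(** All coefficients are indexed by the column j, so that a product with column j, or a sum over it,
    splits into three indicator sums. *)
Lemma tridiagE i j : tridiag s i j =
  coef_alpha s j * (i == j :> nat)%:R + coef_beta s j * (i.+1 == j :> nat)%:R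
  + coef_beta s j.+1 * (i == j.+1 :> nat)%:R.
Proof.
rewrite mxE -val_eqE /= (eq_sym (nat_of_ord j)).
case: (eqVneq (i : nat) j) => [->|ij].
  by rewrite (gtn_eqF (ltnSn j)) (ltn_eqF (ltnSn j)) !mulr0 !addr0 mulr1.
case: (eqVneq i.+1 (j : nat)) => [ij1|ij1].
  by rewrite -ij1 (ltn_eqF (leqnSn i.+1)) !mulr0 add0r addr0 mulr1.
case: (eqVneq (i : nat) j.+1) => [->|_]; first by rewrite !mulr0 !add0r mulr1.
by rewrite !mulr0 !addr0.
Qed.

Lemma tridiag_sym : (tridiag s)^T = tridiag s.
Proof.
apply/matrixP => i j; rewrite !mxE.
case: (eqVneq i j) => [->|ij]; first by rewrite ?eqxx.
case: (eqVneq (i : nat) j.+1) => [ij1|_]; case: (eqVneq (j : nat) i.+1) => [ji|_] //.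
by exfalso; lia.
Qed.

Lemma tridiag_upper (i j : 'I_(size s)) : (i.+1 < j)%N -> tridiag s i j = 0.
Proof.
move=> ij; rewrite tridiagE.
rewrite (_ : (i == j :> nat) = false); last by apply/eqP; lia.
rewrite (_ : (i.+1 == j :> nat) = false); last by apply/eqP; lia.
rewrite (_ : (i == j.+1 :> nat) = false); last by apply/eqP; lia.
by rewrite !mulr0 !addr0.
Qed.

Lemma tridiag_lower (i j : 'I_(size s)) : (j.+1 < i)%N -> tridiag s i j = 0.
Proof. by move=> ij; rewrite -tridiag_sym mxE tridiag_upper. Qed.

Lemma tridiag_symtridiag : symtridiag (tridiag s).
Proof. by split; [exact: tridiag_sym | move=> i j; exact: tridiag_upper]. Qed.

Lemma ind_sum_le1 m (P : pred 'I_m) : (forall i j, P i -> P j -> i = j) ->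
  \sum_i (P i)%:R <= 1 :> R.
Proof.
move=> hP; case: (pickP P) => [i Pi|P0]; last by rewrite big1 // => i _; rewrite P0.
rewrite (bigD1 i) //= Pi big1 ?addr0 // => j ji.
by case: (boolP (P j)) => // Pj; rewrite (hP j i) ?eqxx in ji.
Qed.

Lemma mxbound_tridiag :
  (forall i, (i < size s)%N ->
     coef_beta s i.+1 ^+ 2 + coef_alpha s i ^+ 2 + coef_beta s i ^+ 2 <= 27 / 100) ->
  mxbound (tridiag s) (9 / 10).
Proof.
move=> h; apply: mxbound_rowsum; [lra|exact: tridiag_sym|] => j.
have := h j (ltn_ord j); set a := coef_alpha s j; set b := coef_beta s j.
set c := coef_beta s j.+1 => habc.
(* By Cauchy-Schwarz the square of this sum is at most 3 * 27/100 = (9/10)^2. *)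
apply: (@le_trans _ _ (`|a| + `|b| + `|c|)); last first.
  have := real_normK (num_real a); have := real_normK (num_real b).
  have := real_normK (num_real c); have := normr_ge0 a; have := normr_ge0 b.
  have := normr_ge0 c; set x := `|a|; set y := `|b|; set w := `|c|.
  have := sqr_ge0 (x - y); have := sqr_ge0 (y - w); have := sqr_ge0 (x - w).
  move=> ? ? ? ? ? ? xE yE wE.
  rewrite -(ler_pXn2r (n := 2)) ?nnegrE //; last by rewrite !addr_ge0.
  nra.
apply: (@le_trans _ _ (\sum_(i < size s) (`|a| * (i == j :> nat)%:R + `|b| * (i.+1 == j :> nat)%:R
   + `|c| * (i == j.+1 :> nat)%:R))).
  apply: ler_sum => i _; rewrite -[in leLHS]tridiag_sym mxE tridiagE -/a -/b -/c.
  rewrite (le_trans (ler_normD _ _)) // !normrM normr_nat lerD2r.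
  by rewrite (le_trans (ler_normD _ _)) // !normrM !normr_nat.
rewrite !big_split /= -!mulr_sumr.
have le1 x (P : pred 'I_(size s)) : (forall i j, P i -> P j -> i = j) ->
    `|x| * \sum_i (P i)%:R <= `|x| :> R.
  by move=> hP; rewrite ler_piMr // ind_sum_le1.
by apply: lerD; [apply: lerD|]; apply: le1 => i i' /eqP hi /eqP hi';
  apply: val_inj => /=; lia.
Qed.

Lemma basis_mx_entry : (forall i, (i < size s)%N -> enorm (nth (0, 0, 0) s i).2 <= 2) ->
  forall i j, `|basis_mx s i j| <= 2.
Proof.
move=> h i j; rewrite mxE; apply: le_trans (h j (ltn_ord j)); exact: enorm_coord_le.
Qed.

(** Without orthogonality of the columns each one is bounded separately; the resulting factor m is
    only polynomial. *)
Lemma mxbound_cols m (M : 'M[R]_(n, m)) (c : R) : (forall j, enorm (col j M) <= c) ->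
  mxbound M (m%:R * c).
Proof.
move=> h v.
have -> : M *m v = \sum_j v j ord0 *: col j M.
  apply/colP => i; rewrite mxE summxE; apply: eq_bigr => j _.
  by rewrite !mxE mulrC.
apply: le_trans (enorm_sum _ _ _) _.
apply: (@le_trans _ _ (\sum_(j < m) (enorm v * c))).
  by apply: ler_sum => j _; rewrite enormZ ler_pM ?enorm_ge0 // enorm_coord_le.
by rewrite sumr_const card_ord -[_ *+ m]mulr_natl (mulrC (enorm v)) mulrA.
Qed.

Lemma col_basis_mx j : col j (basis_mx s) = (nth (0, 0, 0) s j).2.
Proof. by apply/colP => i; rewrite !mxE. Qed.

Lemma col_residual (B : 'M[R]_n) (j : 'I_(size s)) :
  col j (B *m basis_mx s - basis_mx s *m tridiag s) =
  B *m (nth (0, 0, 0) s j).2 - coef_beta s j *: nth 0 (0 :: [seq x.2 | x <- s]) j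
    - coef_alpha s j *: (nth (0, 0, 0) s j).2
    - coef_beta s j.+1 *: (nth (0, 0, 0) s j.+1).2.
Proof.
rewrite linearB /= !(colE j (_ *m _)) -!mulmxA -!colE col_basis_mx -!addrA; congr (_ + _).
rewrite -!opprD; congr (- _); apply/colP => r.
pose f i := (nth (0, 0, 0) s i).2 r ord0.
have f0 i : (size s <= i)%N -> f i = 0 by move=> si; rewrite /f nth_default // mxE.
have -> : (basis_mx s *m col j (tridiag s)) r ord0 =
    \sum_(i < size s) (coef_alpha s j * (f i * (i == j :> nat)%:R) +
      coef_beta s j * (f i * (i.+1 == j :> nat)%:R) +
      coef_beta s j.+1 * (f i * (i == j.+1 :> nat)%:R)).
  rewrite mxE; apply: eq_bigr => i _; rewrite [_ i ord0]mxE tridiagE mxE -/(f i); ring.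
rewrite !big_split -!mulr_sumr /= !sum_nat_ind // !mxE -/(f j) -/(f j.+1).
rewrite [RHS]addrCA -!addrA; congr (_ + (_ + _)).
(* In column 0 the preceding vector is the 0 put at the head of the list, and no row index satisfies
   i + 1 = 0. *)
case: j => -[|j] js /=; first by rewrite mxE mulr0 big1 ?mulr0 // => i _; rewrite mulr0.
under eq_bigr do rewrite eqSS.
by rewrite sum_nat_ind // (nth_map (0, 0, 0)) // ltnW.
Qed.

Lemma residual_support (B : 'M[R]_n) k (c : R) : 0 <= c -> (size s <= k)%N ->
  (forall i, (i < size s)%N -> (i.+1 < size s)%N || (size s < k)%N ->
    enorm (B *m (nth (0, 0, 0) s i).2
      - coef_beta s i *: nth 0 (0 :: [seq x.2 | x <- s]) i
      - coef_alpha s i *: (nth (0, 0, 0) s i).2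
      - coef_beta s i.+1 *: (nth (0, 0, 0) s i.+1).2) <= c) ->
  forall v : 'cV[R]_(size s), (forall i : 'I_(size s), (k.-1 <= i)%N -> v i ord0 = 0) ->
  enorm ((B *m basis_mx s - basis_mx s *m tridiag s) *m v) <=
    (size s)%:R * c * enorm v.
Proof.
move=> c0 sk h v hv; set W := _ - _.
have -> : W *m v = \sum_j v j ord0 *: col j W.
  apply/colP => i; rewrite mxE summxE; apply: eq_bigr => j _.
  by rewrite [X in _ = X]mxE [col _ _ _ _]mxE mulrC.
apply: le_trans (enorm_sum _ _ _) _.
apply: (@le_trans _ _ (\sum_(j < size s) (enorm v * c))); last first.
  by rewrite sumr_const card_ord -[_ *+ size s]mulr_natl (mulrC (enorm v)) mulrA.
apply: ler_sum => j _; rewrite enormZ; have [kj|jk] := leqP k.-1 j.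
  by rewrite hv // normr0 mul0r mulr_ge0 ?enorm_ge0.
rewrite ler_pM ?enorm_ge0 ?enorm_coord_le // col_residual h //.
by have := ltn_ord j; lia.
Qed.

End Spec.
End TridiagonalMatrix.

(** * Applying the function to the computed eigendecomposition *)

Section ApproximateEigendecomposition.
Context {R : realType}.
Variables (m : nat) (T V : 'M[R]_m.+1) (L : 'rV[R]_m.+1) (e1 : R).
Hypotheses (sT : T^T = T) (T9 : mxbound T (9 / 10)) (he1 : 0 <= e1 <= 1 / 100).
Hypothesis hVT : mxbound (V *m diag_mx L *m V^T - T) e1.
Hypothesis hVV : mxbound (V^T *m V - 1%:M) e1.

Lemma eig_sqr v : `|dotp (V *m v) (V *m v) - dotp v v| <= e1 * dotp v v.
Proof.
have -> : dotp (V *m v) (V *m v) - dotp v v = dotp ((V^T *m V - 1%:M) *m v) v.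
  by rewrite mulmxBl dotpBl mul1mx dotp_mulmx dotpC mulmxA.
apply: le_trans (dotp_le (hVV v) (lexx _)) _.
by rewrite -mulrA -expr2 sqr_enorm.
Qed.

Lemma eig_bound : mxbound V (101 / 100).
Proof.
have /andP[e0 e1'] := he1; move=> v; apply: enorm_le.
  by rewrite mulr_ge0 ?enorm_ge0 //; lra.
have := eig_sqr v; rewrite ler_norml => /andP[_ h].
have v0 := dotpvv_ge0 v; rewrite exprMn sqr_enorm; nra.
Qed.

Lemma eig_lower v : 99 / 100 * enorm v <= enorm (V *m v).
Proof.
have /andP[e0 e1'] := he1.
have := eig_sqr v; rewrite ler_norml => /andP[h _].
have v0 := dotpvv_ge0 v.
rewrite -(ler_pXn2r (n := 2)) ?nnegrE ?enorm_ge0 //; last first.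
  by rewrite mulr_ge0 ?enorm_ge0.
rewrite exprMn !sqr_enorm; nra.
Qed.

Lemma eig_unit : V \in unitmx.
Proof.
rewrite -unitmx_tr -row_free_unit; apply: inj_row_free => r rV.
have Vr : V *m r^T = 0 by rewrite -[V]trmxK -trmx_mul rV trmx0.
have := eig_lower r^T; rewrite Vr enorm0 => h.
have r0 : enorm r^T = 0 by have := enorm_ge0 r^T; lra.
by rewrite -[r]trmxK (enorm_eq0 r0) trmx0.
Qed.

(** Since V is invertible, every z is V w, and (V V^T - 1) V w = V (V^T V - 1) w. *)
Lemma eig_right : mxbound (V *m V^T - 1%:M) (2 * e1).
Proof.
have /andP[e0 e1'] := he1; move=> z.
have [w zE] : exists w, z = V *m w.
  by exists (invmx V *m z); rewrite mulmxA mulmxV ?mul1mx // eig_unit.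
have -> : (V *m V^T - 1%:M) *m z = V *m ((V^T *m V - 1%:M) *m w).
  by rewrite zE !mulmxBl !mul1mx mulmxBr !mulmxA.
have hw := eig_lower w; rewrite -zE in hw.
apply: le_trans (eig_bound _) _.
have := hVV w; have := enorm_ge0 w; nra.
Qed.

(** The column V e_j is an approximate eigenvector of T, but its error contains the diagonal matrix
    itself; choosing the entry of largest modulus lets that part be moved to the left side. The gap
    between 9/10 and 1 absorbs the errors in e1. *)
Lemma eig_values i : `|L ord0 i| <= 1.
Proof.
have /andP[e0 e1'] := he1.
case: (@Order.TotalTheory.arg_maxP _ _ _ ord0 predT (fun j => `|L ord0 j|)) => // j _ hj.
apply: le_trans (hj i isT) _; set l := `|L ord0 j|.
pose e : 'cV[R]_m.+1 := delta_mx j ord0.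
have en : enorm e = 1 by exact: enorm_delta.
have l0 : 0 <= l by exact: normr_ge0.
have hL : mxbound (diag_mx L) l by apply: mxbound_diag => // i'; apply: hj.
have Le : diag_mx L *m e = L ord0 j *: e.
  apply/colP => i'; rewrite mul_diag_mx !mxE andbT.
  by case: eqP => [->//|_]; rewrite !mulr0.
pose x := V *m e.
have x1 : 99 / 100 <= enorm x by have := eig_lower e; rewrite en mulr1.
have x2 : enorm x <= 101 / 100 by have := eig_bound e; rewrite en mulr1.
have Tx : L ord0 j *: x = T *m x + (V *m diag_mx L *m V^T - T) *m x
    - V *m (diag_mx L *m ((V^T *m V - 1%:M) *m e)).
  rewrite mulmxBl addrCA subrr addr0 mulmxBl mul1mx !mulmxBr Le /x -scalemxAr opprB !mulmxA.
  by rewrite addrCA subrr addr0.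
have h1 : l * enorm x <= 9 / 10 * (101 / 100) + e1 * (101 / 100) + 101 / 100 * (l * e1).
  rewrite -enormZ Tx; apply: le_trans (enormB _ _) _; apply: lerD.
    apply: le_trans (enormD _ _) _; apply: lerD.
      by apply: le_trans (T9 _) _; lra.
    by apply: le_trans (hVT _) _; rewrite ler_wpM2l.
  apply: le_trans (eig_bound _) _; rewrite ler_wpM2l //.
  apply: le_trans (hL _) _; rewrite ler_wpM2l //.
  by apply: le_trans (hVV _) _; rewrite en mulr1.
have : l * (99 / 100) <= l * enorm x by rewrite ler_wpM2l.
have : l * e1 <= l * (1 / 100) by rewrite ler_wpM2l.
lra.
Qed.

Lemma eig_stepP q : mxbound
  (V *m diag_mx (map_mx (step_poly q) L) *m V^T - horner_mx T (stepP q))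
  (15 * q.+1%:R ^+ 2 * e1).
Proof.
have /andP[e0 e1'] := he1.
have L1 : mxbound (diag_mx L) 1 by apply: mxbound_diag => // i; apply: eig_values.
have sL : (diag_mx L)^T = diag_mx L by exact: tr_diag_mx.
have T1 : mxbound T 1 by apply: mxboundW T9; lra.
have hX : mxbound (V *m diag_mx L - T *m V) (3 * e1).
  have -> : V *m diag_mx L - T *m V = (V *m diag_mx L *m V^T - T) *m V
      - V *m (diag_mx L *m (V^T *m V - 1%:M)).
    rewrite mulmxBl !mulmxBr !mulmxA mulmx1 opprB.
    by rewrite [RHS]addrC addrA subrK.
  apply: (@mxboundW _ _ _ _ (e1 * (101 / 100) + 101 / 100 * (1 * e1))); first lra.
  apply: mxboundB; first exact: mxboundM eig_bound.
  apply: mxboundM eig_bound _ => //.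
  exact: mxboundM.
have e30 : 0 <= 3 * e1 by lra.
have := stepP_intertwine q e30 sT sL T1 L1 hX.
rewrite horner_mx_diag (_ : map_mx (horner (stepP q)) L = map_mx (step_poly q) L); last first.
  by apply/rowP => j; rewrite !mxE horner_stepP.
set P := diag_mx _; set H := horner_mx T _ => hPH.
have -> : V *m P *m V^T - H = (V *m P - H *m V) *m V^T + H *m (V *m V^T - 1%:M).
  by rewrite mulmxBl mulmxBr !mulmxA mulmx1 addrA subrK.
have q1 : 1 <= q.+1%:R :> R by rewrite ler1n.
apply: (@mxboundW _ _ _ _ (2 * q.+1%:R ^+ 2 * (3 * e1) * (101 / 100) + q.+1%:R * (2 * e1))).
  have : q.+1%:R * e1 <= q.+1%:R ^+ 2 * e1 by rewrite ler_wpM2r // expr2 ler_peMl //; lra.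
  have : 0 <= q.+1%:R ^+ 2 * e1 by rewrite mulr_ge0 ?exprn_ge0.
  lra.
apply: mxboundD.
  apply: mxboundM hPH _; first by rewrite !mulr_ge0 ?exprn_ge0.
  by apply: mxbound_tr; [lra|exact: eig_bound].
apply: mxboundM eig_right => //; exact: mxbound_stepP.
Qed.

End ApproximateEigendecomposition.

(* The part of [lanczos] that follows the eigendecomposition of T, up to the final
   scaling. *)
Definition apply_fun (R : realType) (F : arith R) (fc : R -> timed R) n m
    (V : 'M[R]_m) (L : 'rV[R]_m) (Q : 'M[R]_(n, m)) : timed 'cV[R]_n :=
  let! g := mulmxv F V^T (\col_i (i == 0%N :> nat)%:R) in
  let! fL := tabulate (fun i => fc (L ord0 i)) in
  let! h := tabulate (fun i => Defs.mul F (fL i ord0) (g i ord0)) in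
  let! z := mulmxv F V h in
  mulmxv F Q z.

(** * Rounding errors of the products following the eigensolver *)

Section FloatingPointTail.
Context {R : realType}.
Variables (F : arith R) (u eta : R).
Hypotheses (u0 : 0 <= u) (F1 : requirement1 F u).

Lemma mulmxv_err m (flb : fl_bounds F m eta) r (M : 'M[R]_(r, m)) (b : R) v :
  0 <= eta -> (forall i j, `|M i j| <= b) ->
  enorm ((mulmxv F M v).1 - M *m v) <= r%:R * (eta * (m%:R * b * enorm v)).
Proof.
move=> eta0 hM; apply: le_trans (enorm_le_sum _) _.
apply: (@le_trans _ _ (\sum_(i < r) eta * (m%:R * b * enorm v))); last first.
  by rewrite sumr_const card_ord -[_ *+ r]mulr_natl.
apply: ler_sum => i _.
have -> : ((mulmxv F M v).1 - M *m v) i ord0 =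
    (dot F (row i M)^T v).1 - dotp (row i M)^T v.
  rewrite mxE [X in X + _]mxE [X in _ + X]mxE; congr (_ - _).
  by rewrite mxE; apply: eq_bigr => j _; rewrite !mxE.
apply: le_trans (flb_dot flb _ _) _; rewrite ler_wpM2l // ler_wpM2r ?enorm_ge0 //.
apply: le_trans (enorm_le_sum _) _.
apply: (@le_trans _ _ (\sum_(j < m) b)); last by rewrite sumr_const card_ord -[_ *+ m]mulr_natl.
by apply: ler_sum => j _; rewrite !mxE.
Qed.

Lemma apply_fun_err n m (flb : fl_bounds F m.+1 eta) (V : 'M[R]_m.+1) (L : 'rV[R]_m.+1)
    (Q : 'M[R]_(n.+1, m.+1)) (f : R -> R) (fc : R -> timed R) :
  u <= eta -> m.+1%:R ^+ 2 * eta <= 1 / 9 ->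
  mxbound V 2 -> (forall i, `|f (L ord0 i)| <= 1) ->
  (forall i, rel_approx u (f (L ord0 i)) (fc (L ord0 i)).1) ->
  (forall i j, `|Q i j| <= 2) -> mxbound Q (m.+1%:R * 2) ->
  enorm ((apply_fun F fc V L Q).1 -
      Q *m (V *m diag_mx (map_mx f L) *m V^T *m delta_mx ord0 ord0)) <=
    84 * n.+1%:R * m.+1%:R ^+ 3 * eta.
Proof.
move=> ue small V2 f1 hfc Q2 hQ.
pose e : 'cV[R]_m.+1 := \col_i (i == 0%N :> nat)%:R.
have eE : e = delta_mx ord0 ord0 by apply/colP => i; rewrite !mxE -val_eqE andbT.
rewrite -eE.
pose g := (mulmxv F V^T e).1.
pose fL := (tabulate (fun i => fc (L ord0 i))).1.
pose h := (tabulate (fun i => Defs.mul F (fL i ord0) (g i ord0))).1.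
pose z := (mulmxv F V h).1.
have -> : (apply_fun F fc V L Q).1 = (mulmxv F Q z).1 by [].
set y := (mulmxv F Q z).1.
have m1 : 1 <= m.+1%:R :> R by rewrite ler1n.
have n1 : 1 <= n.+1%:R :> R by rewrite ler1n.
have u0' := u0; have eta0 : 0 <= eta by apply: le_trans ue.
set M := m.+1%:R in m1 small hQ *; set N := n.+1%:R in n1 *.
have M0 : 0 <= M by lra.
have d0 : 0 <= M ^+ 2 * eta by rewrite mulr_ge0 ?exprn_ge0.
have eM : eta <= M ^+ 2 * eta by rewrite ler_peMl // expr2; nra.
(* The unit of error below: g, h and z deviate by 2, 11 and 30 of it. The bound 2 M on Q makes 60
   M^3 eta of the last, and the final product adds 24 N M eta, together 84. *)
set del := M ^+ 2 * eta in small d0 eM.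
have en : enorm e = 1.
  by rewrite eE enorm_delta.
have Vt2 : mxbound V^T 2 by apply: mxbound_tr.
have Ve : forall i j, `|V i j| <= 2 by move=> i j; apply: mxbound_entry.
have Vte : forall i j, `|V^T i j| <= 2 by move=> i j; rewrite mxE.
pose g0 := V^T *m e.
have g02 : enorm g0 <= 2 by have := Vt2 e; rewrite en mulr1.
have hg : enorm (g - g0) <= 2 * del.
  apply: le_trans (mulmxv_err flb _ eta0 Vte) _; rewrite en -/M /del.
  by lra.
pose D := diag_mx (map_mx f L).
have D1 : mxbound D 1 by apply: mxbound_diag => // i; rewrite mxE.
have hh : enorm (h - D *m g) <= 3 * u * enorm g.
  apply: enorm_coordle => [|i]; first by rewrite mulr_ge0.
  have -> : (h - D *m g) i ord0 =
      fl_mul F (fc (L ord0 i)).1 (g i ord0) - f (L ord0 i) * g i ord0.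
    rewrite mxE [X in _ + X]mxE mul_diag_mx; congr (_ - _); first by rewrite mxE /= mxE.
    by rewrite mxE [X in X * _]mxE.
  have [d1 hd1 E1] := hfc i; have [_ _ Fmul _ _] := F1.
  rewrite E1; have [d2 hd2 ->] := Fmul ((1 + d1) * f (L ord0 i)) (g i ord0).
  have -> : (1 + d2) * ((1 + d1) * f (L ord0 i) * g i ord0) - f (L ord0 i) * g i ord0 =
    (d1 + d2 + d1 * d2) * f (L ord0 i) * g i ord0 by ring.
  rewrite 2!normrM ler_wpM2r //.
  have := normrM_le hd1 hd2; have := ler_normD (d1 + d2) (d1 * d2).
  have := ler_normD d1 d2 => ? ? ?.
  have u1 : u * u <= u by rewrite ler_piMl //; lra.
  apply: (@le_trans _ _ (3 * u * 1)); last by rewrite mulr1.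
  by apply: ler_pM => //; lra.
have g3 : enorm g <= 3 by have := enorm_split hg g02; lra.
have hh' : enorm (h - D *m g0) <= 11 * del.
  have -> : h - D *m g0 = (h - D *m g) + D *m (g - g0) by rewrite mulmxBr addrA subrK.
  apply: le_trans (enormD _ _) _; have := D1 (g - g0).
  have : 3 * u * enorm g <= 3 * eta * 3 by apply: ler_pM; rewrite ?enorm_ge0 ?mulr_ge0 //; lra.
  lra.
have h4 : enorm h <= 4.
  have Dg : enorm (D *m g0) <= 2 by apply: le_trans (D1 _) _; rewrite mul1r.
  by have := enorm_split hh' Dg; lra.
have hz : enorm (z - V *m h) <= 8 * del.
  apply: le_trans (mulmxv_err flb _ eta0 Ve) _; rewrite -/M /del.
  have -> : M * (eta * (M * 2 * enorm h)) = 2 * (M ^+ 2 * eta) * enorm h by ring.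
  by apply: le_trans (ler_wpM2l _ h4) _; [rewrite mulr_ge0|lra].
have z12 : enorm z <= 12.
  have Vh : enorm (V *m h) <= 8 by apply: le_trans (V2 _) _; lra.
  by have := enorm_split hz Vh; lra.
have hz' : enorm (z - V *m (D *m g0)) <= 30 * del.
  have -> : z - V *m (D *m g0) = (z - V *m h) + V *m (h - D *m g0).
    by rewrite mulmxBr addrA subrK.
  by apply: le_trans (enormD _ _) _; have := V2 (h - D *m g0); lra.
have hy : enorm (y - Q *m z) <= 24 * N * M * eta.
  apply: le_trans (mulmxv_err flb _ eta0 Q2) _; rewrite -/M -/N.
  have -> : N * (eta * (M * 2 * enorm z)) = 2 * N * M * eta * enorm z by ring.
  by apply: le_trans (ler_wpM2l _ z12) _; [rewrite !mulr_ge0|lra].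
have -> : y - Q *m (V *m diag_mx (map_mx f L) *m V^T *m e) =
    (y - Q *m z) + Q *m (z - V *m (D *m g0)).
  by rewrite mulmxBr addrA subrK -!mulmxA.
apply: le_trans (enormD _ _) _; have := hQ (z - V *m (D *m g0)).
have : M * 2 * enorm (z - V *m (D *m g0)) <= M * 2 * (30 * del).
  by rewrite ler_wpM2l // mulr_ge0.
have -> : M * 2 * (30 * del) = 60 * (M ^+ 3 * eta) by rewrite /del; ring.
have M3 : 0 <= M ^+ 3 * eta by rewrite mulr_ge0 ?exprn_ge0.
have : M * eta <= M ^+ 3 * eta by rewrite ler_wpM2r // -{1}[M]expr1 ler_weXn2l.
have : M ^+ 3 * eta <= N * (M ^+ 3 * eta) by rewrite ler_peMl.
have : N * (M * eta) <= N * (M ^+ 3 * eta).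
  by rewrite ler_wpM2l ?(le_trans _ n1) // ler_wpM2r // -{1}[M]expr1 ler_weXn2l.
lra.
Qed.
End FloatingPointTail.

(** * Accuracy *)

Section Accuracy.
Context {R : realType}.

Lemma fl_boundsW (F : arith R) n (e e' : R) : e <= e' -> fl_bounds F n e -> fl_bounds F n e'.
Proof.
move=> ee [h1 h2 h3 h4 h5]; split=> [a v|v w|v w|v|a v a0].
- by apply: le_trans (h1 a v) _; rewrite ler_wpM2r ?enorm_ge0.
- by apply: le_trans (h2 v w) _; rewrite ler_wpM2r ?enorm_ge0.
- by apply: le_trans (h3 v w) _; rewrite ler_wpM2r ?mulr_ge0 ?enorm_ge0.
- by apply: le_trans (h4 v) _; rewrite ler_wpM2r ?enorm_ge0.
- by apply: le_trans (h5 a v a0) _; rewrite ler_wpM2r ?enorm_ge0.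
Qed.

(* In order: the final products, the eigensolver, the rounding errors of the Lanczos
   recurrence, and the discarded Chebyshev degrees. *)
Definition krylov_err (N K : R) (q d : nat) (eta e1 z : R) : R :=
  84 * N * K ^+ 3 * eta + 30 * K * q.+1%:R ^+ 2 * e1 +
  q.+1%:R * ((4 * d%:R ^+ 2 + 1) * (13 * K * eta) + 8 * K * ((z + z^-1) / 2) ^+ q / z ^+ d).

(** The dimension p is a variable because [horner_mx] wants a successor, which [size s] is not
    syntactically; T, V, L and Q can then be destructed along with it. *)
Lemma krylov_tail_err n p (B : 'M[R]_n.+1) (T V : 'M[R]_p) (L : 'rV[R]_p)
    (Q : 'M[R]_(n.+1, p)) (k q d : nat) (F : arith R) (u eta e1 z : R)
    (fc : R -> timed R) :
  B^T = B -> mxbound B 1 -> (0 < p)%N -> (p <= k)%N -> (2 * d <= k.-1)%N -> 1 <= z ->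
  0 <= u -> u <= eta -> requirement1 F u -> fl_bounds F p eta ->
  k%:R ^+ 2 * eta <= 1 / 9 -> 0 <= e1 <= 1 / 100 ->
  (forall t, rel_approx u (step_poly q t) (fc t).1) ->
  T^T = T -> (forall i j : 'I_p, (j.+1 < i)%N -> T i j = 0) -> mxbound T (9 / 10) ->
  (forall i j, `|Q i j| <= 2) -> mxbound Q (p%:R * 2) ->
  (forall v : 'cV[R]_p, (forall i : 'I_p, (k.-1 <= i)%N -> v i ord0 = 0) ->
    enorm ((B *m Q - Q *m T) *m v) <= p%:R * (13 * eta) * enorm v) ->
  spnorm (V *m diag_mx L *m V^T - T) <= e1 * spnorm T ->
  spnorm (V^T *m V - 1%:M) <= e1 ->
  enorm ((apply_fun F fc V L Q).1 -
    horner_mx B (stepP q) *m (Q *m \col_i (i == 0%N :> nat)%:R)) <=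
  krylov_err n.+1%:R k%:R q d eta e1 z.
Proof.
move=> sB B1; case: p T V L Q => [//|m] T V L Q _ mk dk z1 u0 ue F1 flb small he1 hfc.
move=> sT lowT T9 Q2 hQ hW hVT hVV.
have -> : \col_i (i == 0%N :> nat)%:R = delta_mx ord0 ord0 :> 'cV[R]_m.+1.
  by apply/colP => i; rewrite !mxE -val_eqE andbT.
set e := delta_mx _ _; set y := (apply_fun _ _ _ _ _).1.
rewrite /krylov_err; set N := n.+1%:R; set K := k%:R; set P := q.+1%:R.
have /andP[e0 e1'] := he1; have eta0 : 0 <= eta by apply: le_trans ue.
have T1 : mxbound T 1 by apply: mxboundW T9; lra.
have MK : m.+1%:R <= K by rewrite ler_nat.
set M := m.+1%:R in MK hQ hW.
have M1 : 1 <= M by rewrite ler1n.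
have M0 : 0 <= M by []. have K0 : 0 <= K by [].
have N0 : 0 <= N by []. have P0 : 0 <= P by [].
have hVT' : mxbound (V *m diag_mx L *m V^T - T) e1.
  apply: mxboundW (spnorm_mxbound _); apply: le_trans hVT _.
  by rewrite ler_piMr //; apply: spnorm_le.
have hVV' : mxbound (V^T *m V - 1%:M) e1 by apply: mxboundW (spnorm_mxbound _).
have V2 : mxbound V 2.
  by apply: mxboundW (eig_bound he1 hVV'); lra.
have hL := eig_values T9 he1 hVT' hVV'.
have f1 i : `|step_poly q (L ord0 i)| <= 1.
  by apply: step_poly_norm_le1; rewrite -ler_norml.
have smallM : M ^+ 2 * eta <= 1 / 9.
  by apply: le_trans small; rewrite ler_wpM2r // lerXn2r.
have E1 := apply_fun_err u0 F1 flb ue smallM V2 f1 (fun i => hfc _) Q2 hQ.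
rewrite -/e -/y -/M -/N in E1.
set VfV := V *m _ *m _ in E1.
have en : enorm e = 1 by exact: enorm_delta.
have E2 : enorm (Q *m ((VfV - horner_mx T (stepP q)) *m e)) <= M * 2 * (15 * P ^+ 2 * e1).
  apply: le_trans (hQ _) _; rewrite ler_wpM2l ?mulr_ge0 //.
  by apply: le_trans (eig_stepP sT T9 he1 hVT' hVV' q _) _; rewrite en mulr1.
have om0 : 0 <= M * (13 * eta) by rewrite !mulr_ge0 //; lra.
have ka0 : 0 <= M * 2 by lra.
have E3 := krylov_stepP q sB B1 sT T1 lowT om0 ka0 hQ dk z1 hW.
rewrite /= -/e in E3.
have -> : y - horner_mx B (stepP q) *m (Q *m e) =
    (y - Q *m (VfV *m e)) + Q *m ((VfV - horner_mx T (stepP q)) *m e)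
    - (horner_mx B (stepP q) *m (Q *m e) - Q *m (horner_mx T (stepP q) *m e)).
  by rewrite mulmxBl mulmxBr addrA subrK opprB addrA subrK.
apply: le_trans (enormB _ _) _; apply: lerD.
  apply: le_trans (enormD _ _) _; apply: lerD.
    apply: le_trans E1 _; rewrite ler_wpM2r // ler_wpM2l ?mulr_ge0 //.
    by rewrite lerXn2r.
  apply: le_trans E2 _.
  have -> : M * 2 * (15 * P ^+ 2 * e1) = 30 * M * P ^+ 2 * e1 by ring.
  by rewrite ler_wpM2r // ler_wpM2r ?exprn_ge0 // ler_wpM2l.
apply: le_trans E3 _; rewrite ler_wpM2l //.
have zd : 0 <= z ^+ d by rewrite exprn_ge0 //; lra.
have y0 : 0 <= ((z + z^-1) / 2) ^+ q.
  by rewrite exprn_ge0 // divr_ge0 // addr_ge0 ?invr_ge0 //; lra.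
apply: lerD.
  rewrite ler_wpM2l ?addr_ge0 ?mulr_ge0 ?exprn_ge0 //.
  have : M * eta <= K * eta by rewrite ler_wpM2r.
  by lra.
rewrite ler_wpM2r ?invr_ge0 // ler_wpM2r //; lra.
Qed.

Lemma lanczos_tail_err n (B : 'M[R]_n.+1) (s : seq (R * R * 'cV[R]_n.+1)) (k q d : nat)
    (F : arith R) (u eta e1 z : R) (q1 : 'cV[R]_n.+1) (fc : R -> timed R)
    (V : 'M[R]_(size s)) (L : 'rV[R]_(size s)) :
  B^T = B -> mxbound B (1 / 2) -> (0 < k)%N -> (2 * d <= k.-1)%N -> 1 <= z ->
  0 <= u -> u <= eta -> requirement1 F u -> fl_bounds F (size s) eta ->
  k%:R ^+ 2 * eta <= 1 / 9 -> 0 <= e1 <= 1 / 100 ->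
  (forall t, rel_approx u (step_poly q t) (fc t).1) ->
  lanczos_spec B eta k 0 0 q1 s ->
  spnorm (V *m diag_mx L *m V^T - tridiag s) <= e1 * spnorm (tridiag s) ->
  spnorm (V^T *m V - 1%:M) <= e1 ->
  enorm ((apply_fun F fc V L (basis_mx s)).1 - horner_mx B (stepP q) *m q1) <=
  krylov_err n.+1%:R k%:R q d eta e1 z.
Proof.
move=> sB B2 k0 dk z1 u0 ue F1 flb small he1 hfc [sk s0 sq ssq sres] hVT hVV.
have eta0 : 0 <= eta by apply: le_trans ue.
have hQ : mxbound (basis_mx s) ((size s)%:R * 2).
  by apply: mxbound_cols => j; rewrite col_basis_mx sq.
have c0 : 0 <= 13 * eta by rewrite mulr_ge0.
have hW := residual_support c0 sk sres.
have B1 : mxbound B 1 by apply: mxboundW B2; lra.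
have [al [s' sE]] := s0 k0.
have sz0 : (0 < size s)%N by rewrite sE.
have := krylov_tail_err sB B1 sz0 sk dk z1 u0 ue F1 flb small he1 hfc
  (tridiag_sym s) (@tridiag_lower _ _ s) (mxbound_tridiag ssq) (basis_mx_entry sq)
  hQ hW hVT hVV.
suff -> : basis_mx s *m \col_i (i == 0%N :> nat)%:R = q1 by [].
apply/colP => i; rewrite mxE (bigD1 (Ordinal sz0)) //= !mxE /= mulr1 big1 ?addr0 => [|j j0].
  by rewrite sE.
by rewrite !mxE (_ : (j == 0%N :> nat) = false) ?mulr0 //; apply/negbTE.
Qed.

End Accuracy.

Section LanczosAccuracy.
Context {R : realType}.

Lemma mxfun_step_poly n (B : 'M[R]_n.+1) q : B^T = B ->
  mxfun (step_poly q) B = horner_mx B (stepP q).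
Proof.
move=> sB; rewrite -mxfun_horner //; congr mxfun.
by apply/funext => t; rewrite horner_stepP.
Qed.

Lemma log1_le (x y : R) : 0 < x -> x <= y -> log1 x <= log1 y.
Proof.
move=> x0 xy; rewrite /log1 ge_max !le_max lexx /=.
by apply/orP; right; rewrite ler_ln // posrE // (lt_le_trans x0).
Qed.

Lemma log1_ge1 (x : R) : 1 <= log1 x.
Proof. by rewrite le_max lexx. Qed.

Lemma ln_le_log1 (x : R) : ln x <= log1 x.
Proof. by rewrite le_max lexx orbT. Qed.

Lemma requirement2_err n (B : 'M[R]_n.+1) (mulB : 'cV[R]_n.+1 -> timed 'cV[R]_n.+1) u :
  0 <= u -> spnorm B <= 1 / 2 -> requirement2 B mulB u ->
  forall w, enorm ((mulB w).1 - B *m w) <= n.+1%:R ^+ 2 * u * enorm w.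
Proof.
move=> u0 B2 h w; apply: le_trans (h w) _.
have p2 : n.+1%:R `^ (3 / 2) <= n.+1%:R ^+ 2 :> R.
  rewrite -powR_mulrn // ler_powR ?ler1n //; lra.
have := spnorm_ge0 B; have := powR_ge0 (n.+1%:R : R) (3 / 2); have := enorm_ge0 w.
set a := _ `^ _ in p2 *; set b := spnorm B in B2 *; set N := _ ^+ 2 in p2 * => w0 a0 b0.
have ab : a * b <= N * (1 / 2) by rewrite ler_pM.
have : a * b * (enorm w * u) <= N * (1 / 2) * (enorm w * u) by rewrite ler_wpM2r ?mulr_ge0.
lra.
Qed.

Lemma unscale_err n (A : 'M[R]_n) (x q y r : 'cV[R]_n) (P Del eta nx : R) :
  0 <= eta <= 1 / 2 -> 0 <= P -> mxbound A P -> 0 < nx ->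
  `|nx - enorm x| <= eta * enorm x -> enorm (nx *: q - x) <= eta * enorm x ->
  enorm q <= 2 -> enorm (y - A *m q) <= Del ->
  enorm (r - nx *: y) <= eta * enorm (nx *: y) ->
  enorm (A *m x - r) <= (5 * P * eta + 3 * Del) * enorm x.
Proof.
move=> /andP[e0 e1] P0 hA nx0 hnx hq q2 hy hr.
have Del0 : 0 <= Del by apply: le_trans hy; apply: enorm_ge0.
have yn : enorm y <= 2 * P + Del.
  by apply: enorm_split hy _; apply: le_trans (hA _) _; rewrite mulrC ler_wpM2r.
have -> : A *m x - r = - (A *m (nx *: q - x)) - nx *: (y - A *m q) - (r - nx *: y).
  rewrite mulmxBr -scalemxAr scalerBr; apply/colP => i; rewrite !mxE; ring.
have X0 := enorm_ge0 x; have y0 := enorm_ge0 y.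
have t1 : enorm (A *m (nx *: q - x)) <= P * (eta * enorm x).
  by apply: le_trans (hA _) _; rewrite ler_wpM2l.
have nxle : nx <= 2 * enorm x.
  by move: hnx; rewrite ler_norml => /andP[_]; nra.
have t2 : enorm (nx *: (y - A *m q)) <= 2 * enorm x * Del.
  by rewrite enormZ gtr0_norm // ler_pM ?enorm_ge0 // ltW.
have t3 : enorm (r - nx *: y) <= eta * (2 * enorm x * (2 * P + Del)).
  apply: le_trans hr _; rewrite ler_wpM2l //.
  by rewrite enormZ gtr0_norm // ler_pM // ltW.
apply: le_trans (enormB _ _) _.
have := enormB (- (A *m (nx *: q - x))) (nx *: (y - A *m q)); rewrite enormN.
have : eta * (2 * enorm x * Del) <= 1 / 2 * (2 * enorm x * Del).
  by rewrite ler_wpM2r ?mulr_ge0.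
lra.
Qed.

(** One eta must serve vectors of length N, vectors of length at most K, and the product by B with
    its factor N^2; all are covered by 6 M u with M <= 2 N^2 K. *)
Lemma rounding_unit_facts (N K u : R) : 1 <= N -> 1 <= K -> 0 <= u ->
  let eta := 12 * N ^+ 2 * K * u in
  K ^+ 2 * eta <= 1 / 50 / 50 / 20 ->
  [/\ 0 <= eta, eta <= 1 / 50 / 50 / 20,
      2 * (0 + K * (110 * eta)) + 250 * eta <= 2 / 100,
      u <= eta & forall M, M <= 2 * (N ^+ 2 * K) -> 6 * M * u <= eta].
Proof.
move=> N1 K1 u0 eta small.
have NK : 1 <= N ^+ 2 * K by apply: mulr_ege1 => //; apply: exprn_ege1.
have etaE : eta = 12 * (N ^+ 2 * K * u) by rewrite /eta; ring.
have eta0 : 0 <= eta by rewrite etaE !mulr_ge0 ?exprn_ge0 //; lra.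
clearbody eta.
have K0 : 0 <= K by lra.
have keta : K * eta <= 1 / 50 / 50 / 20.
  by apply: le_trans small; rewrite ler_wpM2r // expr2 ler_peMl.
have eta1 : eta <= K * eta by rewrite ler_peMl.
have h M : M <= 2 * (N ^+ 2 * K) -> 6 * M * u <= eta.
  move=> hM; rewrite etaE -mulrA.
  have : M * u <= 2 * (N ^+ 2 * K) * u by rewrite ler_wpM2r.
  lra.
split=> //; [lra|lra|].
by have : 6 * 1 * u <= eta; [apply: h; lra|lra].
Qed.

Lemma lanczos_accuracy n (B : 'M[R]_n.+1) (x : 'cV[R]_n.+1) (k q d : nat)
    (F : arith R) (u e1 z c C : R) (mulB : 'cV[R]_n.+1 -> timed 'cV[R]_n.+1)
    (fc : R -> timed R)
    (eig : forall m, 'M[R]_m -> R -> timed ('M[R]_m * 'rV[R]_m)) :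
  let eta := 12 * n.+1%:R ^+ 2 * k%:R * u in
  B^T = B -> spnorm B <= 1 / 2 -> x != 0 -> (0 < k)%N -> (2 * d <= k.-1)%N ->
  1 <= z -> 0 <= u -> requirement1 F u -> requirement2 B mulB u ->
  (forall t, rel_approx u (step_poly q t) (fc t).1) ->
  gu_eisenstat eig u c C -> 0 <= c ->
  k%:R ^+ 2 * eta <= 1 / 50 / 50 / 20 -> 0 < e1 -> e1 <= 1 / 100 ->
  c * k%:R ^+ 3 * log1 k%:R * u <= e1 ->
  enorm (mxfun (step_poly q) B *m x - (lanczos F mulB fc eig e1 k x).1) <=
    (5 * q.+1%:R * eta + 3 * krylov_err n.+1%:R k%:R q d eta e1 z) * enorm x.
Proof.
move=> eta sB spB x0 k0 dk z1 u0 F1 F2 hfc heig c0 small e10 e11 ce1.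
have N1 : 1 <= n.+1%:R :> R by rewrite ler1n.
have K1 : 1 <= k%:R :> R by rewrite ler1n.
have [eta0 eta1 hk ue hu] := rounding_unit_facts N1 K1 u0 small.
rewrite -/eta in eta0 eta1 hk ue hu.
clearbody eta.
have heta : 0 <= eta <= 1 / 50 / 50 / 20 by rewrite eta0.
have NN : n.+1%:R <= n.+1%:R ^+ 2 * k%:R :> R.
  by rewrite -[X in X <= _]mulr1 ler_pM // expr2 ler_peMl.
have KN : k%:R <= n.+1%:R ^+ 2 * k%:R :> R by rewrite ler_peMl // exprn_ege1.
have flb m : m%:R <= n.+1%:R ^+ 2 * k%:R :> R -> fl_bounds F m eta.
  move=> hm; have hM : m.+1%:R <= 2 * (n.+1%:R ^+ 2 * k%:R) :> R by rewrite -natr1; lra.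
  apply: fl_boundsW (hu _ hM) (fl_boundsP u0 F1 _).
  by have := hu _ hM; move: eta1; clear; lra.
have flbn : fl_bounds F n.+1 eta := flb _ NN.
have hmul w : enorm ((mulB w).1 - B *m w) <= eta * enorm w.
  apply: le_trans (requirement2_err u0 spB F2 w) _; rewrite ler_wpM2r ?enorm_ge0 //.
  have : n.+1%:R ^+ 2 <= 2 * (n.+1%:R ^+ 2 * k%:R) :> R.
    have : n.+1%:R ^+ 2 <= n.+1%:R ^+ 2 * k%:R :> R by rewrite ler_peMr // exprn_ge0.
    have : 0 <= n.+1%:R ^+ 2 :> R by rewrite exprn_ge0.
    by clear; lra.
  have : 0 <= n.+1%:R ^+ 2 * u by rewrite mulr_ge0 ?exprn_ge0.
  by move=> ? /hu; lra.
have B2 : mxbound B (1 / 2) by apply: mxboundW spB _; apply: spnorm_mxbound.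
have e12 : e1 <= 1 / 2 by apply: le_trans e11 _; lra.
have small' : k%:R ^+ 2 * eta <= 1 / 9 by apply: le_trans small _; lra.
have B1 : mxbound B 1 by apply: mxboundW B2; lra.
have nx0 : 0 < enorm x.
  by rewrite lt_def enorm_ge0 andbT; apply: contraNneq x0 => /enorm_eq0 ->.
have heta3 : 0 <= eta <= 1 / 1000 by rewrite eta0; apply: le_trans eta1 _; lra.
have heta2 : 0 <= eta <= 1 / 2 by rewrite eta0; apply: le_trans eta1 _; lra.
have hnx := flb_norm flbn x.
have nxn0 : (norm F x).1 != 0.
  move: hnx; rewrite ler_norml => /andP[h _]; apply/negP => /eqP nxE.
  move: h; rewrite nxE sub0r lerN2 -[leLHS]mul1r ler_pM2r // => h.
  suff: (1 : R) < 1 by rewrite ltxx.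
  by move: h eta1; clear; lra.
have hdiv := flb_div flbn x nxn0.
have [nxpos hq1 _ q1n] := normalize_err heta3 nxn0 hnx hdiv.
set nx := (norm F x).1 in nxn0 hnx hdiv nxpos hq1 q1n.
set q1 := (vdiv F x nx).1 in hdiv hq1 q1n.
have q12 : enorm q1 <= 2.
  by apply: le_trans (iter_q heta3 q1n) _; rewrite ler_pdivrMr // -natrM ler_nat.
pose s := (lanczos_loop F mulB k 0 0 q1).1.
pose VL := (eig (size s) (tridiag s) e1).1.
pose y := (apply_fun F fc VL.1 VL.2 (basis_mx s)).1.
have -> : (lanczos F mulB fc eig e1 k x).1 = (vscale F nx y).1 by [].
have inv0 : lanczos_inv B eta 0 0 q1 0.
  split; rewrite ?lexx ?ler01 ?mul0r ?normr0 ?mulr_ge0 //.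
  by rewrite expr0n mul0r mulr_ge0.
have spec := lanczos_loopP sB B2 heta flbn hmul inv0 hk.
have hvs := flb_scale flbn nx y.
rewrite -/s in spec; move: (spec) => [sk s0 _ _ _].
have sz0 : (0 < size s)%N by have [al [s' ->]] := s0 k0.
have S1 : 1 <= (size s)%:R :> R by rewrite ler1n.
have SK : (size s)%:R <= k%:R :> R by rewrite ler_nat.
have ce1' : c * (size s)%:R ^+ 3 * log1 (size s)%:R * u <= e1.
  apply: le_trans ce1; rewrite ler_wpM2r //.
  apply: ler_pM; rewrite ?mulr_ge0 ?exprn_ge0 ?(le_trans ler01 (log1_ge1 _)) //.
    by rewrite ler_wpM2l // lerXn2r ?nnegrE ?ler0n.
  by apply: log1_le => //; apply: lt_le_trans S1.
have [hVT hVV _] := heig _ _ _ sz0 (tridiag_symtridiag s) e10 ce1' e12.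
have flbs : fl_bounds F (size s) eta by apply: flb; apply: le_trans SK KN.
have he1 : 0 <= e1 <= 1 / 100 by rewrite (ltW e10).
have := lanczos_tail_err sB B2 k0 dk z1 u0 ue F1 flbs small' he1 hfc spec hVT hVV.
rewrite -/s -/VL -/y -mxfun_step_poly // => hy.
apply: (unscale_err heta2 _ _ nxpos hnx hq1 q12 hy hvs) => //.
by rewrite mxfun_step_poly //; apply: mxbound_stepP.
Qed.

End LanczosAccuracy.

(** * Running time *)

Section LanczosTime.
Context {R : realType}.

Lemma lanczos_loop_size (F : arith R) n (mulB : 'cV[R]_n -> timed 'cV[R]_n) k beta qp q :
  (size (lanczos_loop F mulB k beta qp q).1 <= k)%N /\
  ((0 < k)%N -> (0 < size (lanczos_loop F mulB k beta qp q).1)%N).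
Proof.
elim: k beta qp q => [//|k IH] beta qp q; rewrite lanczos_loopS; cbv zeta.
by split=> //=; case: ifP => // _; rewrite ltnS; apply: (IH _ _ _).1.
Qed.

(** The 9 n + 2 are two scalings, two subtractions and a division at n each, a dot product at 2 n, a
    norm at 2 n + 1, and the zero test. *)
Lemma lanczos_loop_time (F : arith R) n (mulB : 'cV[R]_n -> timed 'cV[R]_n) mv k beta qp q : (forall w, ((mulB w).2 <= mv)%N) ->
  ((lanczos_loop F mulB k beta qp q).2 <= k * (mv + 9 * n + 2))%N.
Proof.
move=> hmv; elim: k beta qp q => [//|k IH] beta qp q.
have tab (f : 'I_n -> timed R) : (forall i, (f i).2 = 1%N) -> (tabulate f).2 = n.
  by move=> h; rewrite /tabulate /= (eq_bigr (fun=> 1%N)) ?sum1_card ?card_ord.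
set X := lanczos_loop _ _ _ _ _ _.
pose a := (mulB q).1.
pose b := (vscale F beta qp).1.
pose v := (vsub F a b).1.
pose alpha := (dot F v q).1.
pose d := (vscale F alpha q).1.
pose w := (vsub F v d).1.
pose beta' := (norm F w).1.
pose q' := (vdiv F w beta').1.
have -> : X.2 = ((mulB q).2 + ((vscale F beta qp).2 + ((vsub F a b).2 + ((dot F v q).2 +
  ((vscale F alpha q).2 + ((vsub F v d).2 + ((norm F w).2 + (1 +
  (if (beta' == 0)%R then ret [:: (alpha, beta, q)] else
  let! q' := vdiv F w beta' in
  let! rest := lanczos_loop F mulB k beta' q q' in
  ret ((alpha, beta, q) :: rest)).2))))))))%N by [].
have hY : ((if (beta' == 0)%R then ret [:: (alpha, beta, q)] else
  let! q' := vdiv F w beta' in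
  let! rest := lanczos_loop F mulB k beta' q q' in
  ret ((alpha, beta, q) :: rest)).2 <= n + k * (mv + 9 * n + 2))%N.
  case: ifP => // _.
  rewrite [X in (X <= _)%N](_ : _ = ((vdiv F w beta').2 +
    ((lanczos_loop F mulB k beta' q q').2 + 0))%N); last by [].
  by rewrite addn0 tab // leq_add2l IH.
have -> : (norm F w).2 = ((dot F w w).2 + 1)%N by [].
rewrite !dot_time !tab //.
move: hY (hmv q); rewrite mulSn; set Y := (_.2); lia.
Qed.

Lemma mulmxv_time (F : arith R) r m (M : 'M[R]_(r, m)) v :
  (mulmxv F M v).2 = (r * (2 * m))%N.
Proof.
rewrite /mulmxv /tabulate /= (eq_bigr (fun=> (2 * m)%N)) => [|i _]; last exact: dot_time.
by rewrite sum_nat_const card_ord.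
Qed.

(** Of 11 n per iteration 9 belong to the loop and 2 to the product by the basis. Normalising x and
    the final scaling cost 4 n + 1, and the two products by V together 4 k^2. *)
Lemma lanczos_time n (x : 'cV[R]_n) (k mv : nat) (F : arith R) (u e1 c C Cf : R)
    (mulB : 'cV[R]_n -> timed 'cV[R]_n) (fc : R -> timed R)
    (eig : forall m, 'M[R]_m -> R -> timed ('M[R]_m * 'rV[R]_m)) :
  (0 < k)%N -> 0 <= u -> 0 <= c -> 0 <= C -> 0 <= Cf ->
  (forall w, ((mulB w).2 <= mv)%N) -> (forall t, (fc t).2%:R <= Cf) ->
  gu_eisenstat eig u c C -> 0 < e1 -> e1 <= 1 / 2 ->
  c * k%:R ^+ 3 * log1 k%:R * u <= e1 ->
  (lanczos F mulB fc eig e1 k x).2%:R <=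
    k%:R * (mv%:R + 11 * n%:R + 3 + Cf) + 4 * n%:R + 1 + 4 * k%:R ^+ 2 +
    C * (k%:R ^+ 2 * log1 (k%:R / e1) + k%:R * log1 (k%:R / e1) ^+ 2).
Proof.
move=> k0 u0 c0 C0 Cf0 hmv hfc heig e10 e12 ce1.
set K := k%:R; set N := n%:R; set l := log1 (K / e1).
pose nx := (norm F x).1; pose q1 := (vdiv F x nx).1.
pose loop := lanczos_loop F mulB k 0 0 q1; pose s := loop.1.
pose VL := (eig (size s) (tridiag s) e1).1.
pose g := (mulmxv F VL.1^T (\col_i (i == 0%N :> nat)%:R)).1.
pose tf := tabulate (fun i => fc (VL.2 ord0 i)); pose fL := tf.1.
pose th := tabulate (fun i => Defs.mul F (fL i ord0) (g i ord0)); pose h := th.1.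
pose z := (mulmxv F VL.1 h).1; pose y := (mulmxv F (basis_mx s) z).1.
have -> : (lanczos F mulB fc eig e1 k x).2 =
  ((norm F x).2 + ((vdiv F x nx).2 + (loop.2 + ((eig (size s) (tridiag s) e1).2 +
   ((mulmxv F VL.1^T (\col_i (i == 0%N :> nat)%:R)).2 + (tf.2 + (th.2 +
   ((mulmxv F VL.1 h).2 + ((mulmxv F (basis_mx s) z).2 + (vscale F nx y).2)))))))))%N by [].
have [sk s0] := lanczos_loop_size F mulB k 0 0 q1.
rewrite -/loop -/s in sk s0; have {}s0 := s0 k0.
have hloop := lanczos_loop_time F k 0 0 q1 hmv; rewrite -/loop in hloop.
have tab m (f : 'I_m -> timed R) : (forall i, (f i).2 = 1%N) -> (tabulate f).2 = m.
  by move=> h'; rewrite /tabulate /= (eq_bigr (fun=> 1%N)) ?sum1_card ?card_ord.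
have -> : (norm F x).2 = ((dot F x x).2 + 1)%N by [].
have -> : (vscale F nx y).2 = n by apply: tab.
rewrite !mulmxv_time dot_time (tab _ (fun i => div _ _ _)) // (tab _ (fun i => Defs.mul _ _ _)) //.
set p := size s in sk s0 *.
have pk : p%:R <= K :> R by rewrite ler_nat.
have p1 : 1 <= p%:R :> R by rewrite ler1n.
have K0 : 0 <= K by []. have N0 : 0 <= N by [].
have l1 := log1_ge1 (K / e1); rewrite -/l in l1.
have htf : tf.2%:R <= K * Cf.
  rewrite /tf /tabulate /= natr_sum.
  apply: (@le_trans _ _ (\sum_(i < p) Cf)); first exact: ler_sum.
  by rewrite sumr_const card_ord -[_ *+ _]mulr_natl ler_wpM2r.
have heigt : (eig p (tridiag s) e1).2%:R <= C * (K ^+ 2 * l + K * l ^+ 2).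
  have ce1' : c * p%:R ^+ 3 * log1 p%:R * u <= e1.
    apply: le_trans ce1; rewrite ler_wpM2r //.
    apply: ler_pM; rewrite ?mulr_ge0 ?exprn_ge0 ?(le_trans ler01 (log1_ge1 _)) //.
      by rewrite ler_wpM2l // lerXn2r ?nnegrE ?ler0n.
    by apply: log1_le => //; apply: lt_le_trans p1.
  have [_ _ h1] := heig _ _ _ s0 (tridiag_symtridiag s) e10 ce1' e12.
  apply: le_trans h1 _; rewrite ler_wpM2l //.
  have lpl : log1 (p%:R / e1) <= l.
    apply: log1_le; first by rewrite divr_gt0 //; apply: lt_le_trans p1.
    by rewrite ler_wpM2r // invr_ge0 ltW.
  have lp1 := log1_ge1 (p%:R / e1).
  have lp0 : 0 <= log1 (p%:R / e1) by lra.
  apply: lerD; apply: ler_pM; rewrite ?exprn_ge0 //.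
    by rewrite lerXn2r ?nnegrE ?ler0n.
  by rewrite lerXn2r ?nnegrE //; lra.
have [a1 a1E] : exists a, a = (2 * n)%N by exists (2 * n)%N.
have [a2 a2E] : exists a, a = (p * (2 * p))%N by exists (p * (2 * p))%N.
have [a3 a3E] : exists a, a = (n * (2 * p))%N by exists (n * (2 * p))%N.
rewrite -a1E -a2E -a3E !natrD.
have r1 : a1%:R = 2 * N by rewrite a1E natrM.
have r2 : a2%:R = p%:R * (2 * p%:R) :> R by rewrite a2E natrM (natrM _ 2).
have r3 : a3%:R = N * (2 * p%:R) by rewrite a3E natrM (natrM _ 2).
have hloop' : loop.2%:R <= K * (mv%:R + 9 * N + 2).
  by rewrite -(ler_nat R) natrM (natrD _ (mv + _)) (natrD _ mv) (natrM _ 9) in hloop.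
have pp : p%:R * p%:R <= K * K by rewrite ler_pM.
have Np : N * p%:R <= N * K by rewrite ler_wpM2l.
move: htf heigt hloop'; rewrite r1 r2 r3 -/N; lra.
Qed.

End LanczosTime.

(** * Choice of the parameters *)

Section ScalarEstimates.
Context {R : realType}.

Lemma ceiln_bounds (x : R) : 0 <= x -> x <= (ceiln x)%:R <= x + 1.
Proof.
move=> x0; have c0 : 0 <= Num.ceil x by rewrite ceil_ge0 (lt_le_trans _ x0) // ltrN10.
have -> : (ceiln x)%:R = (Num.ceil x)%:~R :> R.
  by rewrite /ceiln -{2}(gez0_abs c0) pmulrn.
have := ceil_itv x; rewrite ceil_ge /= => /andP[h _].
have := ltW h; lra.
Qed.

Lemma log1_le_id (x : R) : 1 <= x -> log1 x <= x.
Proof. by move=> x1; rewrite ge_max x1 ltW // ln_sublinear // (lt_le_trans ltr01). Qed.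

Lemma powR2E (t : R) : 2 `^ t = expR (t * ln 2).
Proof. by rewrite /powR pnatr_eq0. Qed.

Lemma ln2_gt0 : 0 < ln 2 :> R.
Proof. by rewrite ln_gt0 // ltr1n. Qed.

(** As A <= exp (A bits) and X^b <= exp (b bits), the exponent A + b outweighs A X^b. [eig_exponent]
    and [mach_exponent] have this form, with powers 7 and 14 of X. *)
Lemma expR_budget (A bits X : R) b : 0 <= A -> 1 <= bits -> 0 < X -> ln X <= bits ->
  A * X ^+ b * expR (- ((A + b%:R) * bits)) <= 1.
Proof.
move=> A0 b1 X0 hX.
have AE : A <= expR (A * bits).
  have := expR_ge1Dx (A * bits); have : A * 1 <= A * bits by rewrite ler_wpM2l.
  lra.
have XE : X ^+ b <= expR (b%:R * bits).
  rewrite -{1}(lnK X0) -expRM_natl ler_expR ler_wpM2l //.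
apply: (@le_trans _ _ (expR (A * bits) * expR (b%:R * bits) * expR (- ((A + b%:R) * bits)))).
  by rewrite ler_wpM2r ?expR_ge0 // ler_pM // exprn_ge0 // ltW.
by rewrite -!expRD -mulrDl subrr expR0.
Qed.

(* With z = 1 + gamma, (z + 1/z)/2 <= 1 + gamma^2/2 while z >= exp(gamma/2). *)
Lemma cosh_power_decay (g : R) (q d : nat) : 0 < g < 1 ->
  let z := 1 + g in
  ((z + z^-1) / 2) ^+ q / z ^+ d <= expR (g ^+ 2 * q%:R / 2 - g * d%:R / 2) :> R.
Proof.
move=> /andP[g0 g1]; set z := 1 + g => /=.
have z0 : 0 < z by rewrite /z; lra.
have y0 : 0 <= (z + z^-1) / 2.
  by rewrite divr_ge0 // addr_ge0 ?invr_ge0 // ltW.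
have hy : (z + z^-1) / 2 <= expR (g ^+ 2 / 2).
  apply: le_trans (expR_ge1Dx _).
  have : z^-1 <= 1 - g + g ^+ 2.
    rewrite -[leLHS]mul1r ler_pdivrMr //.
    have -> : (1 - g + g ^+ 2) * z = 1 + g ^+ 3 by rewrite /z; ring.
    by rewrite lerDl exprn_ge0 // ltW.
  by rewrite /z; lra.
have hz : expR (g / 2) <= z.
  rewrite -[leLHS]invrK -expRN.
  have h1 : 0 < 1 - g / 2 by lra.
  have h2 := expR_ge1Dx (- (g / 2)).
  apply: (@le_trans _ _ (1 - g / 2)^-1).
    by rewrite lef_pV2 ?posrE ?expR_gt0.
  rewrite -[leLHS]mul1r ler_pdivrMr // /z; nra.
have -> : g ^+ 2 * q%:R / 2 - g * d%:R / 2 = q%:R * (g ^+ 2 / 2) - d%:R * (g / 2) by ring.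
rewrite expRD expRN !expRM_natl.
apply: ler_pM; rewrite ?exprn_ge0 ?invr_ge0 ?exprn_ge0 ?(ltW z0) //.
  by rewrite lerXn2r ?nnegrE ?expR_ge0.
rewrite lef_pV2 ?posrE ?exprn_gt0 ?expR_gt0 //.
by rewrite lerXn2r ?nnegrE ?expR_ge0 ?(ltW z0).
Qed.

End ScalarEstimates.

(** * Bounds on q and k, and decay of the discarded degrees *)

Section Budget.
Context {R : realType}.

(* Chosen so that (Cq + 2) (Ck + 1) exp (- (Ck / 8 - Cq / 2 - 6)) <= 1/48. *)
Definition Ck_min (Cq : R) : R := 16 * (Cq / 2 + 6 + (16 * 48) * (Cq + 2)).

Lemma krylov_decay_real (Cq Ck eps g Z L l q k d P : R) :
  1 <= Cq -> Ck_min Cq <= Ck -> 0 < eps -> 0 < g < 1 -> 1 <= Z -> Z^-1 <= eps ->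
  1 <= l -> ln Z <= l -> L <= l ->
  Cq * (g ^- 2 * L) <= q <= Cq * (g ^- 2 * L) + 1 ->
  Ck * (g^-1 * l) <= k <= Ck * (g^-1 * l) + 1 -> k <= 4 * d + 4 ->
  P <= (Cq + 2) * Z ^+ 2 -> k <= (Ck + 1) * Z ^+ 2 -> 0 <= P -> 0 <= k ->
  24 * (P * (k * expR (g ^+ 2 * q / 2 - g * d / 2))) <= eps / 2.
Proof.
move=> cq1 hck e0 /andP[g0 g1] Z1 invZ l1 lnl Ll /andP[_ qb] /andP[kb _] kd Pq Kk P0 K0.
have g20 : 0 <= g ^+ 2 by rewrite exprn_ge0 // ltW.
pose W : R := 16 * 48 * (Cq + 2).
have WE : Cq + 2 = W / 48 / 16 by rewrite /W; field.
have hckW : 16 * (Cq / 2 + 6 + W) <= Ck by exact: hck.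
clearbody W.
have W1 : 1 <= W by lra.
(* The exponent is at most - M l: g^2 q <= Cq l + 1 and g d >= Ck l / 4 - 1, each halved, with the
   constants absorbed by l >= 1. *)
pose M := Ck / 8 - Cq / 2 - 1.
have hexp : g ^+ 2 * q / 2 - g * d / 2 <= - (M * l).
  have h1 : g ^+ 2 * q <= Cq * l + 1.
    have := ler_wpM2l g20 qb.
    have -> : g ^+ 2 * (Cq * (g ^- 2 * L) + 1) = Cq * L + g ^+ 2 by field; rewrite gt_eqF.
    have : Cq * L <= Cq * l by rewrite ler_wpM2l //; lra.
    have : g ^+ 2 <= 1 by rewrite expr_le1 // ltW.
    lra.
  have h2 : Ck * l / 4 - 1 <= g * d.
    have := ler_wpM2l (ltW g0) (le_trans kb kd).
    have -> : g * (Ck * (g^-1 * l)) = Ck * l by field; rewrite gt_eqF.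
    lra.
  rewrite /M; lra.
have M5 : 5 <= M by rewrite /M; lra.
have Z0 : 0 < Z by lra.
(* Two powers of Z come from P, two from k, and the fifth produces the factor 1 / Z <= eps. The
   remaining M - 5 must beat the constants. *)
have ZE : Z ^+ 5 * expR (- (5 * l)) <= 1.
  rewrite -{1}(lnK (_ : Z \in Num.pos)) ?posrE // -expRM_natl -expRD -expR0 ler_expR.
  by rewrite subr_le0 ler_wpM2l.
have hE2 : expR (g ^+ 2 * q / 2 - g * d / 2) <= expR (- (M - 5)) * expR (- (5 * l)).
  rewrite -expRD ler_expR; apply: le_trans hexp _.
  by have : (M - 5) * 1 <= (M - 5) * l; [rewrite ler_wpM2l //; lra|lra].
(* Ck has no upper bound, so the factor Ck + 1 needs its own share of the decay: half of the Ck / 8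
   in M pays for it, and the other half still leaves exp (- W). *)
have hck1 : Ck + 1 <= 16 * expR (Ck / 16) by have := expR_ge1Dx (Ck / 16); lra.
have hW : W * expR (- W) <= 1.
  by rewrite expRN ler_pdivrMr ?expR_gt0 // mul1r; have := expR_ge1Dx W; lra.
have C1 : (Cq + 2) * (Ck + 1) * expR (- (M - 5)) <= 1 / 48.
  have h : (Ck + 1) * expR (- (M - 5)) <= 16 * expR (- W).
    apply: (@le_trans _ _ (16 * expR (Ck / 16) * expR (- (M - 5)))).
      by rewrite ler_wpM2r // expR_ge0.
    rewrite -mulrA -expRD ler_wpM2l // ler_expR /M; lra.
  have : (Cq + 2) * ((Ck + 1) * expR (- (M - 5))) <= (Cq + 2) * (16 * expR (- W)).
    by rewrite ler_wpM2l //; lra.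
  have -> : (Cq + 2) * (16 * expR (- W)) = W * expR (- W) / 48 by rewrite WE; field.
  by rewrite mulrA; lra.
have c0 : 0 <= (Cq + 2) * (Ck + 1) by rewrite mulr_ge0; lra.
clearbody M.
apply: (@le_trans _ _ (24 * ((Cq + 2) * Z ^+ 2 * ((Ck + 1) * Z ^+ 2 *
   (expR (- (M - 5)) * expR (- (5 * l))))))).
  by rewrite ler_wpM2l // ler_pM ?mulr_ge0 ?expR_ge0 // ler_pM ?expR_ge0.
have -> : (Cq + 2) * Z ^+ 2 * ((Ck + 1) * Z ^+ 2 * (expR (- (M - 5)) * expR (- (5 * l)))) =
  (Cq + 2) * (Ck + 1) * expR (- (M - 5)) * (Z^-1 * (Z ^+ 5 * expR (- (5 * l)))).
  by field; rewrite gt_eqF.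
have iZ0 : 0 <= Z^-1 by rewrite invr_ge0 ltW.
have h3 : Z^-1 * (Z ^+ 5 * expR (- (5 * l))) <= eps.
  by apply: le_trans invZ; rewrite ler_piMr.
have h4 : 0 <= Z^-1 * (Z ^+ 5 * expR (- (5 * l))).
  by rewrite !mulr_ge0 ?expR_ge0 ?exprn_ge0 // ltW.
have : (Cq + 2) * (Ck + 1) * expR (- (M - 5)) * (Z^-1 * (Z ^+ 5 * expR (- (5 * l)))) <=
   1 / 48 * eps.
  by rewrite ler_pM // mulr_ge0 ?expR_ge0.
lra.
Qed.

Section ParameterBounds.
Variables (Cq Ck eps gamma : R) (n : nat).
Hypotheses (hCq : 1 <= Cq) (hCk : Ck_min Cq <= Ck).
Hypotheses (heps : 0 < eps < 1) (hgamma : 0 < gamma < 1) (hn : (0 < n)%N).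

Let Z := 1 / (eps * gamma).
Let X := n%:R / (eps * gamma).
Let bits := log1 (n%:R / (eps * gamma)).
Let q := ceiln (Cq * (gamma ^- 2 * log1 (1 / eps))).
Let k := ceiln (Ck * (gamma^-1 * log1 (1 / (eps * gamma)))).

Lemma Ck_ge : 100 <= Ck.
Proof. by have := hCq; have := hCk; rewrite /Ck_min; lra. Qed.

Lemma eg_gt0 : 0 < eps * gamma.
Proof. by case/andP: heps => ? _; case/andP: hgamma => ? _; rewrite mulr_gt0. Qed.

Lemma Z_ge1 : 1 <= Z.
Proof.
rewrite /Z ler_pdivlMr ?eg_gt0 // mul1r.
by case/andP: heps => ? ?; case/andP: hgamma => ? ?; nra.
Qed.

Lemma Z_le_X : Z <= X.
Proof. by rewrite ler_wpM2r ?ler1n // invr_ge0 ltW // eg_gt0. Qed.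

Lemma n_le_X : n%:R <= X.
Proof.
have -> : X = n%:R * Z by rewrite /Z /X mul1r.
by rewrite ler_peMr // Z_ge1.
Qed.

Lemma X_gt0 : 0 < X.
Proof. by apply: lt_le_trans Z_le_X; apply: lt_le_trans Z_ge1. Qed.

Lemma eps_inv_le : 1 / eps <= Z.
Proof.
have /andP[e0 e1] := heps; have /andP[g0 g1] := hgamma.
rewrite /Z !mul1r lef_pV2 ?posrE ?eg_gt0 //.
by rewrite ler_piMr // ltW.
Qed.

Lemma gamma_inv_le : gamma^-1 <= Z.
Proof.
have /andP[e0 e1] := heps; have /andP[g0 g1] := hgamma.
rewrite /Z mul1r lef_pV2 ?posrE ?eg_gt0 //.
by rewrite ler_piMl // ltW.
Qed.

Lemma eps_ge : X^-1 <= eps.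
Proof.
have /andP[e0 e1] := heps.
rewrite -[eps]invrK lef_pV2 ?posrE ?invr_gt0 ?X_gt0 // -[eps^-1]mul1r.
exact: le_trans eps_inv_le Z_le_X.
Qed.

Lemma log1_eps_le : log1 (1 / eps) <= log1 Z.
Proof.
have /andP[e0 e1] := heps.
by apply: log1_le eps_inv_le; rewrite divr_gt0.
Qed.

Lemma q_bounds : Cq * (gamma ^- 2 * log1 (1 / eps)) <= q%:R <=
  Cq * (gamma ^- 2 * log1 (1 / eps)) + 1.
Proof.
have /andP[g0 _] := hgamma; apply: ceiln_bounds.
by rewrite !mulr_ge0 ?invr_ge0 ?exprn_ge0 ?(ltW g0) ?(le_trans _ hCq) ?(le_trans _ (log1_ge1 _)).
Qed.

Lemma k_bounds : Ck * (gamma^-1 * log1 Z) <= k%:R <= Ck * (gamma^-1 * log1 Z) + 1.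
Proof.
have /andP[g0 _] := hgamma; apply: ceiln_bounds.
have := Ck_ge => ?.
by rewrite !mulr_ge0 ?invr_ge0 ?(ltW g0) ?(le_trans _ (log1_ge1 _)) //; lra.
Qed.

Lemma log1_ge0 (x : R) : 0 <= log1 x.
Proof. exact: le_trans (log1_ge1 x). Qed.

Lemma q_le : q.+1%:R <= (Cq + 2) * Z ^+ 2.
Proof.
have /andP[e0 e1] := heps; have /andP[g0 g1] := hgamma.
have /andP[_ h] := q_bounds; have z1 := Z_ge1; have hq := hCq.
have l1 : log1 (1 / eps) <= 1 / eps.
  by apply: log1_le_id; rewrite ler_pdivlMr // mul1r ltW.
have h2 : gamma ^- 2 * log1 (1 / eps) <= Z ^+ 2.
  have -> : Z ^+ 2 = gamma ^- 2 * (1 / eps ^+ 2).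
    by rewrite /Z; field; rewrite !gt_eqF.
  rewrite ler_wpM2l ?invr_ge0 ?exprn_ge0 ?(ltW g0) //.
  apply: le_trans l1 _; rewrite !mul1r lef_pV2 ?posrE ?exprn_gt0 // expr2.
  by rewrite ler_piMr // ltW.
have z21 : 1 <= Z ^+ 2 by rewrite exprn_ege1.
have : Cq * (gamma ^- 2 * log1 (1 / eps)) <= Cq * Z ^+ 2 by rewrite ler_wpM2l //; lra.
by rewrite -natr1; lra.
Qed.

Lemma k_le : k%:R <= (Ck + 1) * Z ^+ 2.
Proof.
have /andP[g0 g1] := hgamma.
have /andP[_ h] := k_bounds; have z1 := Z_ge1; have hk := Ck_ge.
have l1 := log1_le_id z1.
have h2 : gamma^-1 * log1 Z <= Z * Z.
  by rewrite ler_pM ?invr_ge0 ?(ltW g0) ?log1_ge0 ?gamma_inv_le.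
have z21 : 1 <= Z ^+ 2 by rewrite exprn_ege1.
have : Ck * (gamma^-1 * log1 Z) <= Ck * (Z * Z) by rewrite ler_wpM2l //; lra.
by rewrite -expr2; lra.
Qed.

Lemma k_ge : 100 <= k%:R :> R.
Proof.
have /andP[g0 g1] := hgamma.
have /andP[h _] := k_bounds; have hk := Ck_ge; apply: le_trans h.
have Ck0 : 0 <= Ck by lra.
apply: le_trans hk _; rewrite ler_peMr //.
rewrite -[1]mulr1 ler_pM ?ler01 ?log1_ge1 //.
by rewrite -[1]invr1 lef_pV2 ?posrE // ltW.
Qed.

(** From 1 - gamma^2 <= exp (- gamma^2), it suffices that gamma^2 q >= log (1 / eps), which Cq >= 1
    guarantees. *)
Lemma sign_decay : (1 - gamma ^+ 2) ^+ q.+1 <= eps.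
Proof.
have /andP[e0 e1] := heps; have /andP[g0 g1] := hgamma.
have g21 : gamma ^+ 2 <= 1 by rewrite expr_le1 // ltW.
apply: (@le_trans _ _ (expR (- gamma ^+ 2) ^+ q.+1)).
  rewrite lerXn2r ?nnegrE ?expR_ge0 ?subr_ge0 //; exact: expR_ge1Dx.
rewrite -expRM_natl -[leRHS]lnK ?posrE // ler_expR mulrN lerNl.
have -> : - ln eps = ln (1 / eps) by rewrite mul1r lnV // posrE.
apply: le_trans (ln_le_log1 _) _.
have /andP[h _] := q_bounds.
have h' : gamma ^+ 2 * (Cq * (gamma ^- 2 * log1 (1 / eps))) <= gamma ^+ 2 * q%:R.
  by rewrite ler_wpM2l // exprn_ge0 // ltW.
have E : gamma ^+ 2 * (Cq * (gamma ^- 2 * log1 (1 / eps))) = Cq * log1 (1 / eps).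
  by field; rewrite gt_eqF.
have : log1 (1 / eps) <= Cq * log1 (1 / eps) by rewrite ler_peMl // log1_ge0.
have : 0 <= gamma ^+ 2 by rewrite exprn_ge0 // ltW.
by rewrite -natr1; lra.
Qed.

(** Degree l in Y is degree 2 l in x; a quarter of k keeps the Krylov vectors away from the
    uncontrolled last column. *)
Lemma d_half : (2 * (k %/ 4) <= k.-1)%N.
Proof.
clear hn.
have : (1 < k)%N by rewrite -(ltr_nat R); have := k_ge; lra.
by have := leq_divM k 4; lia.
Qed.

Lemma krylov_decay (z := 1 + gamma) :
  24 * q.+1%:R * k%:R * ((z + z^-1) / 2) ^+ q / z ^+ (k %/ 4) <= eps / 2.
Proof.
have /andP[e0 e1] := heps; have /andP[g0 g1] := hgamma.
have hE := cosh_power_decay q (k %/ 4) hgamma; rewrite /= -/z in hE.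
have kd : k%:R <= 4 * (k %/ 4)%:R + 4 :> R.
  rewrite -natrM -natrD ler_nat; have := divn_eq k 4; have := ltn_pmod k (isT : 0 < 4)%N.
  by clear hn; lia.
have invZ : Z^-1 <= eps.
  have -> : Z^-1 = eps * gamma by rewrite /Z mul1r invrK.
  by rewrite ler_piMr // ltW.
have h := krylov_decay_real hCq hCk e0 hgamma Z_ge1 invZ (log1_ge1 Z) (ln_le_log1 Z)
  log1_eps_le q_bounds k_bounds kd q_le k_le (ler0n _ _) (ler0n _ _).
by apply: le_trans h; rewrite -3!mulrA !ler_wpM2l //.
Qed.

End ParameterBounds.

End Budget.

(** * Error budget for rounding and time budget *)

Section FinalBudget.
Context {R : realType}.

(** Every rounding term is a multiple of a monomial below N^3 P K^4 u <= Pp Kp^4 X^13 u. One more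
    factor X compares it with eps >= 1 / X, hence X^14; in the same way K P^2 e1 <= Kp Pp^2 X^6 e1
    leads to X^7. *)
Lemma rounding_budget (N P K d X Kp Pp e1 u eps c : R) :
  1 <= N -> N <= X -> 1 <= P -> P <= Pp * X ^+ 2 -> 1 <= K -> K <= Kp * X ^+ 2 ->
  0 <= d -> d <= K -> 1 <= X -> 1 <= Kp -> 1 <= Pp -> 0 <= u -> 0 <= e1 ->
  X^-1 <= eps -> 0 <= c -> (6 * 60) * Kp * Pp ^+ 2 * X ^+ 7 * e1 <= 1 ->
  (50 * 50 * 50 * 8 * Pp * Kp ^+ 4 + c * Kp ^+ 4) * X ^+ 14 * u <= e1 ->
  let eta := 12 * N ^+ 2 * K * u in
  [/\ K ^+ 2 * eta <= 1 / 50 / 50 / 20, e1 <= 1 / 100, c * K ^+ 4 * u <= e1 &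
      5 * P * eta + 3 * (84 * N * K ^+ 3 * eta + 30 * K * P ^+ 2 * e1 +
        P * ((4 * d ^+ 2 + 1) * (13 * K * eta))) <= eps / 2].
Proof.
move=> N1 NX P1 PX K1 KX d0 dK X1 Kp1 Pp1 u0 e10 epsX c0 hA1 hA2 eta.
have N0 : 0 <= N by lra. have P0 : 0 <= P by lra. have K0 : 0 <= K by lra.
have X0 : 0 <= X by lra. have Kp0 : 0 <= Kp by lra. have Pp0 : 0 <= Pp by lra.
have Xpos : 0 < X by lra.
have big0 m (a : R) : 0 <= a -> 0 <= a * X ^+ m * u.
  by move=> a0; rewrite !mulr_ge0 ?exprn_ge0.
have Kp4 : 1 <= Kp ^+ 4 by rewrite exprn_ege1.
have ck0 : 0 <= c * Kp ^+ 4 by rewrite mulr_ge0 ?exprn_ge0.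
have pk0 : 0 <= 50 * 50 * 50 * 8 * Pp * Kp ^+ 4 by rewrite !mulr_ge0 ?exprn_ge0.
have U1 : 50 * 50 * 50 * 8 * (Pp * Kp ^+ 4 * X ^+ 14 * u) <= e1.
  by have := big0 14%N _ ck0; lra.
have U2 : c * Kp ^+ 4 * X ^+ 14 * u <= e1 by have := big0 14%N _ pk0; lra.
have e1le : e1 <= 1 / (6 * 60).
  have : 1 * e1 <= Kp * Pp ^+ 2 * X ^+ 7 * e1.
    by rewrite ler_wpM2r // !mulr_ege1 // exprn_ege1.
  lra.
have K4 : K ^+ 4 <= Kp ^+ 4 * X ^+ 8.
  have -> : Kp ^+ 4 * X ^+ 8 = (Kp * X ^+ 2) ^+ 4 by ring.
  by rewrite lerXn2r ?nnegrE // mulr_ge0 ?exprn_ge0.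
have N3 : N ^+ 3 <= X ^+ 3 by rewrite lerXn2r ?nnegrE.
set S := N ^+ 3 * P * K ^+ 4 * u.
have hS : S <= Pp * Kp ^+ 4 * X ^+ 13 * u.
  have -> : Pp * Kp ^+ 4 * X ^+ 13 * u = X ^+ 3 * (Pp * X ^+ 2) * (Kp ^+ 4 * X ^+ 8) * u.
    by ring.
  rewrite ler_wpM2r // ler_pM ?mulr_ge0 ?exprn_ge0 // ler_pM ?exprn_ge0 //.
have X1314 : X ^+ 13 <= X ^+ 14 by rewrite ler_weXn2l.
have hS1 : 50 * 50 * 50 * 8 * S <= e1.
  have : Pp * Kp ^+ 4 * X ^+ 13 * u <= Pp * Kp ^+ 4 * X ^+ 14 * u.
    by rewrite ler_wpM2r // ler_wpM2l // mulr_ge0 ?exprn_ge0.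
  lra.
have hSeps : 50 * 50 * 50 * 8 * S <= eps.
  apply: le_trans epsX; rewrite -[X in _ <= X]mul1r ler_pdivlMr //.
  have : S * X <= Pp * Kp ^+ 4 * X ^+ 13 * u * X by rewrite ler_wpM2r.
  have -> : Pp * Kp ^+ 4 * X ^+ 13 * u * X = Pp * Kp ^+ 4 * X ^+ 14 * u by ring.
  lra.
have leS (a : R) m1 m2 m3 : (m1 <= 3)%N -> (m2 <= 1)%N -> (m3 <= 4)%N ->
    N ^+ m1 * P ^+ m2 * K ^+ m3 * u <= S.
  move=> h1 h2 h3; rewrite /S ler_wpM2r // ler_pM ?mulr_ge0 ?exprn_ge0 //; last first.
    by rewrite ler_weXn2l.
  by apply: ler_pM; rewrite ?exprn_ge0 // ?ler_weXn2l // -[X in _ <= X]expr1 ler_weXn2l.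
split.
- have -> : K ^+ 2 * eta = 12 * (N ^+ 2 * P ^+ 0 * K ^+ 3 * u) by rewrite /eta expr0; ring.
  have := leS 0 2%N 0%N 3%N isT isT isT; lra.
- lra.
- apply: le_trans U2; rewrite ler_wpM2r // -mulrA ler_wpM2l //.
  by apply: le_trans K4 _; rewrite ler_wpM2l ?exprn_ge0 // ler_weXn2l.
have hd : 4 * d ^+ 2 + 1 <= 5 * K ^+ 2.
  have : d ^+ 2 <= K ^+ 2 by rewrite lerXn2r ?nnegrE.
  by have : 1 <= K ^+ 2; [rewrite exprn_ege1|lra].
have t1 : P * eta <= 12 * S.
  have -> : P * eta = 12 * (N ^+ 2 * P ^+ 1 * K ^+ 1 * u) by rewrite /eta; ring.
  by rewrite ler_wpM2l // leS.
have t2 : N * K ^+ 3 * eta <= 12 * S.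
  have -> : N * K ^+ 3 * eta = 12 * (N ^+ 3 * P ^+ 0 * K ^+ 4 * u).
    by rewrite /eta expr0; ring.
  by rewrite ler_wpM2l // leS.
have eta0 : 0 <= eta by rewrite /eta !mulr_ge0 ?exprn_ge0.
have t3 : P * ((4 * d ^+ 2 + 1) * (13 * K * eta)) <= (12 * 65) * S.
  apply: (@le_trans _ _ (P * (5 * K ^+ 2 * (13 * K * eta)))).
    by rewrite ler_wpM2l // ler_wpM2r // !mulr_ge0.
  have -> : P * (5 * K ^+ 2 * (13 * K * eta)) = (12 * 65) * (N ^+ 2 * P ^+ 1 * K ^+ 4 * u).
    by rewrite /eta; ring.
  by rewrite ler_wpM2l // leS.
have t4 : 90 * (K * P ^+ 2 * e1) <= eps / 4.
  have : K * P ^+ 2 * e1 <= Kp * X ^+ 2 * (Pp * X ^+ 2) ^+ 2 * e1.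
    rewrite ler_wpM2r // ler_pM ?exprn_ge0 // lerXn2r ?nnegrE // mulr_ge0 ?exprn_ge0 //.
  have -> : Kp * X ^+ 2 * (Pp * X ^+ 2) ^+ 2 * e1 = Kp * Pp ^+ 2 * X ^+ 6 * e1 by ring.
  have : (6 * 60) * (Kp * Pp ^+ 2 * X ^+ 6 * e1) <= X^-1.
    rewrite -[X in _ <= X]mul1r ler_pdivlMr //.
    by apply: le_trans hA1; rewrite le_eqVlt; apply/orP; left; apply/eqP; ring.
  lra.
have eps0 : 0 <= eps by apply: le_trans epsX; rewrite invr_ge0.
lra.
Qed.

(** The lower bound on mv charges the vector operations to mv K, as 11 K N + 4 N <= 15 K N. The 8
    collects 3 K + 1 + 4 K^2, charged to K^2 bits. *)
Lemma time_budget (mv N K bits l lam C Cf cmv : R) :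
  0 < cmv -> 0 <= C -> 0 <= Cf -> 0 <= N -> cmv * N <= mv -> 1 <= K -> 1 <= bits ->
  1 <= l -> l <= lam * bits ->
  K * (mv + 11 * N + 3 + Cf) + 4 * N + 1 + 4 * K ^+ 2 + C * (K ^+ 2 * l + K * l ^+ 2) <=
  (1 + 15 / cmv + 8 + Cf + C * lam + C * lam ^+ 2) *
    (mv * K + K ^+ 2 * bits + K * bits ^+ 2).
Proof.
move=> cmv0 C0 Cf0 N0 Nmv K1 b1 l1 lb.
have K0 : 0 <= K by lra. have b0 : 0 <= bits by lra.
have mv0 : 0 <= mv by apply: le_trans Nmv; rewrite mulr_ge0 // ltW.
have lam0 : 0 <= lam by rewrite -(pmulr_lge0 _ (lt_le_trans ltr01 b1)); lra.
set S1 := mv * K; set S2 := K ^+ 2 * bits; set S3 := K * bits ^+ 2.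
have S10 : 0 <= S1 by rewrite mulr_ge0.
have S20 : 0 <= S2 by rewrite mulr_ge0 ?exprn_ge0.
have S30 : 0 <= S3 by rewrite mulr_ge0 ?exprn_ge0.
have KN : K * N <= 1 / cmv * S1.
  have -> : K * N = 1 / cmv * (cmv * N * K) by field; rewrite gt_eqF.
  by rewrite ler_wpM2l ?divr_ge0 ?(ltW cmv0) // ler_wpM2r.
have NKN : N <= K * N by rewrite ler_peMl.
have K2 : 1 <= K ^+ 2 by rewrite exprn_ege1.
have KK : K <= K ^+ 2 by rewrite expr2 ler_peMl.
have K2S : K ^+ 2 <= S2 by rewrite ler_peMr ?exprn_ge0.
have l0 : 0 <= l by lra.
have t1 : K ^+ 2 * l <= lam * S2.
  have -> : lam * S2 = K ^+ 2 * (lam * bits) by rewrite /S2; ring.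
  by rewrite ler_wpM2l ?exprn_ge0.
have t2 : K * l ^+ 2 <= lam ^+ 2 * S3.
  have -> : lam ^+ 2 * S3 = K * (lam * bits) ^+ 2 by rewrite /S3; ring.
  by rewrite ler_wpM2l // lerXn2r ?nnegrE // mulr_ge0.
have t3 : C * (K ^+ 2 * l + K * l ^+ 2) <= C * (lam * S2 + lam ^+ 2 * S3).
  by rewrite ler_wpM2l // lerD.
have t4 : Cf * K <= Cf * S2 by rewrite ler_wpM2l //; lra.
have i0 : 0 <= 15 / cmv by rewrite divr_ge0 // ltW.
have p1 (a : R) : 0 <= a -> [/\ 0 <= a * S1, 0 <= a * S2 & 0 <= a * S3].
  by move=> a0; split; rewrite mulr_ge0.
have [? ? ?] := p1 _ i0; have [? ? ?] := p1 _ Cf0.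
have [? ? ?] := p1 (C * lam) (mulr_ge0 C0 lam0).
have [? ? ?] := p1 (C * lam ^+ 2) (mulr_ge0 C0 (sqr_ge0 lam)).
have Ks1 : K * mv = S1 by rewrite /S1 mulrC.
have -> : K * (mv + 11 * N + 3 + Cf) = S1 + 11 * (K * N) + 3 * K + Cf * K.
  by rewrite -Ks1; ring.
have c15 : 15 * (1 / cmv * S1) = 15 / cmv * S1 by ring.
lra.
Qed.

End FinalBudget.

Section Final.
Context {R : realType}.

(* Exponents A such that exp (- A bits) meets the requirements on the accuracy of the
   eigensolver, resp. on eps_mach. *)
Definition eig_exponent (Cq Ck : R) : R := 6 * 60 * (Ck + 1) * (Cq + 2) ^+ 2 + 7.
Definition mach_exponent (Cq Ck c : R) : R :=
  50 * 50 * 50 * 8 * (Cq + 2) * (Ck + 1) ^+ 4 + c * (Ck + 1) ^+ 4 + 14.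

Lemma eig_exponent_ge1 (Cq Ck : R) : 0 <= Cq -> 0 <= Ck -> 1 <= eig_exponent Cq Ck.
Proof.
move=> cq0 ck0; have : 0 <= 6 * 60 * (Ck + 1) * (Cq + 2) ^+ 2.
  by rewrite !mulr_ge0 ?exprn_ge0 ?addr_ge0.
by rewrite /eig_exponent; lra.
Qed.

Lemma mach_exponent_ge1 (Cq Ck c : R) : 0 <= Cq -> 0 <= Ck -> 0 <= c ->
  1 <= mach_exponent Cq Ck c.
Proof.
move=> cq0 ck0 c0; have : 0 <= 50 * 50 * 50 * 8 * (Cq + 2) * (Ck + 1) ^+ 4.
  by rewrite !mulr_ge0 ?exprn_ge0 ?addr_ge0.
have : 0 <= c * (Ck + 1) ^+ 4 by rewrite mulr_ge0 ?exprn_ge0 ?addr_ge0.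
by rewrite /mach_exponent; lra.
Qed.

(** The logarithm is ln K + A bits, and K is polynomial in X; the logarithm in the cost of the
    eigensolver thus becomes a multiple of bits. *)
Lemma log1_accuracy_le (K X Kp A bits : R) : 1 <= K -> 0 < X -> 1 <= Kp ->
  K <= Kp * X ^+ 2 -> 1 <= bits -> ln X <= bits -> 0 <= A ->
  log1 (K / expR (- (A * bits))) <= (Kp + 2 + A) * bits.
Proof.
move=> K1 X0 Kp1 hK b1 hX A0.
have K0 : 0 < K by lra. have Kp0 : 0 < Kp by lra.
have lam0 : 1 <= (Kp + 2 + A) * bits by apply: mulr_ege1 => //; lra.
rewrite /log1 ge_max lam0 /= expRN invrK lnM ?posrE ?expR_gt0 // expRK.
have : ln K <= Kp + 2 * bits.
  apply: (@le_trans _ _ (ln (Kp * X ^+ 2))).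
    by rewrite ler_ln ?posrE ?mulr_gt0 ?exprn_gt0.
  rewrite lnM ?posrE ?exprn_gt0 // lnXn // -[_ *+ 2]mulr_natl.
  by have := ltW (ln_sublinear Kp0); lra.
have : Kp * 1 <= Kp * bits by rewrite ler_wpM2l // ltW.
lra.
Qed.

End Final.

(** [Ck0] follows [Cq] because a larger degree q weakens the decay exp (gamma^2 q / 2 - gamma d / 2)
    of the discarded degrees. *)
Theorem theorem14 (R : realType) (c_eig C_eig C_f c_mv : R)
    (hc_eig : 0 < c_eig) (hC_eig : 0 < C_eig) (hC_f : 0 < C_f)
    (hc_mv : 0 < c_mv) :
  exists2 Cq0 : R, 0 < Cq0 & forall Cq : R, Cq0 <= Cq ->
  exists2 Ck0 : R, 0 < Ck0 & forall Ck : R, Ck0 <= Ck ->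
  exists C1 Cm Ct : R, [/\ 0 < C1, 0 < Cm, 0 < Ct &
  forall (n : nat) (B : 'M[R]_n) (x : 'cV[R]_n) (eps gamma : R),
    B^T = B -> spnorm B <= 1 / 2 -> x != 0 ->
    0 < eps < 1 -> 0 < gamma < 1 ->
    let bits := log1 (n%:R / (eps * gamma)) in
    let q := ceiln (Cq * (gamma ^- 2 * log1 (1 / eps))) in
    let k := ceiln (Ck * (gamma^-1 * log1 (1 / (eps * gamma)))) in
    let p := step_poly q in
    [/\ approx_sign gamma eps p,
        approx_step gamma eps (fun t => (1 + p t) / 2) &
    forall (eps_mach : R) (F : arith R)
        (mulB : 'cV[R]_n -> timed 'cV[R]_n) (mv : nat) (fc : R -> timed R)
        (eig : forall m : nat, 'M[R]_m -> R -> timed ('M[R]_m * 'rV[R]_m)),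
      0 < eps_mach -> eps_mach <= 2 `^ (- (Cm * bits)) ->
      requirement1 F eps_mach ->
      requirement2 B mulB eps_mach ->
      (forall w : 'cV[R]_n, ((mulB w).2 <= mv)%N) ->
      c_mv * n%:R <= mv%:R ->
      evaluates p fc eps_mach C_f ->
      gu_eisenstat eig eps_mach c_eig C_eig ->
      let run := lanczos F mulB fc eig (2 `^ (- (C1 * bits))) k x in
      enorm (mxfun p B *m x - run.1) <= eps * enorm x /\
      run.2%:R <= Ct * (mv%:R * k%:R + k%:R ^+ 2 * bits + k%:R * bits ^+ 2)]].
Proof.
(* The value 1 is what [sign_decay] asks for. *)
exists 1 => // Cq hCq.
have W0 : 0 < Ck_min Cq by rewrite /Ck_min; lra.
exists (Ck_min Cq) => // Ck hCk.
have Ck0 : 0 <= Ck by apply: le_trans hCk; exact: ltW.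
have Cq0 : 0 <= Cq by lra.
set A1 := eig_exponent Cq Ck; set A2 := mach_exponent Cq Ck c_eig.
have A11 : 1 <= A1 by exact: eig_exponent_ge1.
have A21 : 1 <= A2 by apply: mach_exponent_ge1 => //; exact: ltW.
pose lam := Ck + 1 + 2 + A1.
have lam0 : 0 <= lam by rewrite /lam; lra.
have ln20 := @ln2_gt0 R.
(* Division by ln 2 converts powers of 2 to exponentials. [Cm] exceeds [C1] by A2 / ln 2 because the
   machine precision must be small relative to the accuracy requested from the eigensolver. *)
exists (A1 / ln 2), ((A1 + A2) / ln 2),
  (1 + 15 / c_mv + 8 + C_f + C_eig * lam + C_eig * lam ^+ 2); split.
- by rewrite divr_gt0 //; lra.
- by rewrite divr_gt0 //; lra.
- have : 0 <= C_eig * lam ^+ 2 by rewrite mulr_ge0 ?exprn_ge0 // ltW.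
  have : 0 <= C_eig * lam by rewrite mulr_ge0 // ltW.
  have : 0 <= 15 / c_mv by rewrite divr_ge0 // ltW.
  by move: hC_f; clear; lra.
move=> [|n] B x eps gamma sB spB x0 heps hgamma bits q k p.
  by case/eqP: x0; apply/colP => -[].
have /andP[e0 e1] := heps; have /andP[g0 g1] := hgamma.
have hn : (0 < n.+1)%N by [].
have hsign : approx_sign gamma eps p.
  by apply: step_poly_approx_sign => //; [exact: ltW|exact: sign_decay].
split=> //; first by apply: approx_sign_step => //; exact: ltW.
move=> u F mulB mv fc eig u0 hu F1 F2 hmv hcmv hfc heig run.
pose X := n.+1%:R / (eps * gamma).
have X0 : 0 < X by exact: X_gt0.
have Z1 := Z_ge1 heps hgamma; have ZX := Z_le_X heps hgamma hn.
have X1 : 1 <= X by exact: le_trans Z1 ZX.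
have ZX2 : (1 / (eps * gamma)) ^+ 2 <= X ^+ 2.
  by rewrite lerXn2r ?nnegrE ?(ltW X0) // (le_trans _ Z1).
have NX : n.+1%:R <= X := n_le_X n.+1 heps hgamma.
have Pq : q.+1%:R <= (Cq + 2) * X ^+ 2.
  by apply: le_trans (q_le hCq heps hgamma) _; rewrite ler_wpM2l // addr_ge0.
have Kk : k%:R <= (Ck + 1) * X ^+ 2.
  by apply: le_trans (k_le hCq hCk heps hgamma) _; rewrite ler_wpM2l // addr_ge0.
have k100 := k_ge eps hCq hCk hgamma; rewrite -/k in k100.
have k0 : (0 < k)%N by rewrite -(ltr_nat R); apply: lt_le_trans k100.
have dk := d_half hCq hCk heps hgamma; rewrite -/k in dk.
have decay := krylov_decay hCq hCk heps hgamma; rewrite -/k -/q in decay.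
have epsX := eps_ge heps hgamma hn; rewrite -/X in epsX.
have b1 : 1 <= bits := log1_ge1 X; have lnX : ln X <= bits := ln_le_log1 X.
have K1 : 1 <= k%:R :> R by rewrite ler1n.
have N1 : 1 <= n.+1%:R :> R by rewrite ler1n.
have P1 : 1 <= q.+1%:R :> R by rewrite ler1n.
have dK : (k %/ 4)%:R <= k%:R :> R by rewrite ler_nat leq_div.
have z1 : 1 <= 1 + gamma by rewrite lerDl ltW.
have hfc1 t : rel_approx u (step_poly q t) (fc t).1 by case: (hfc t).
have hfc2 t : (fc t).2%:R <= C_f by case: (hfc t).
rewrite /run; move: hu; rewrite !powR2E.
have lnE (A : R) : - (A / ln 2 * bits) * ln 2 = - (A * bits) by field; rewrite gt_eqF.
rewrite !lnE; set acc := expR (- (A1 * bits)) => hu.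
have acc0 : 0 < acc by exact: expR_gt0.
have hacc : 6 * 60 * (Ck + 1) * (Cq + 2) ^+ 2 * X ^+ 7 * acc <= 1.
  by apply: expR_budget => //; rewrite !mulr_ge0 ?exprn_ge0 ?addr_ge0.
have hmach : (50 * 50 * 50 * 8 * (Cq + 2) * (Ck + 1) ^+ 4 + c_eig * (Ck + 1) ^+ 4)
    * X ^+ 14 * u <= acc.
  have c40 : 0 <= 50 * 50 * 50 * 8 * (Cq + 2) * (Ck + 1) ^+ 4 + c_eig * (Ck + 1) ^+ 4.
    by rewrite addr_ge0 ?mulr_ge0 ?exprn_ge0 ?addr_ge0 // ltW.
  have := expR_budget 14 c40 b1 X0 lnX; rewrite -/(mach_exponent Cq Ck c_eig) -/A2.
  set G := _ + _ in c40 * => h.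
  have hu' : u <= acc * expR (- (A2 * bits)).
    by rewrite -expRD -opprD -mulrDl.
  apply: (@le_trans _ _ (G * X ^+ 14 * (acc * expR (- (A2 * bits))))).
    by rewrite ler_wpM2l // mulr_ge0 // exprn_ge0 // ltW.
  by rewrite mulrCA ler_piMr // ltW.
have Ck1 : 1 <= Ck + 1 by rewrite lerDr.
have Cq2 : 1 <= Cq + 2 by move: Cq0; clear; lra.
have [small acc1 cK4 errb] := rounding_budget N1 NX P1 Pq K1 Kk (ler0n _ (k %/ 4)) dK X1
  Ck1 Cq2 (ltW u0) (ltW acc0) epsX (ltW hc_eig) hacc hmach.
have cacc : c_eig * k%:R ^+ 3 * log1 k%:R * u <= acc.
  apply: le_trans cK4; rewrite ler_wpM2r ?(ltW u0) // (exprSr _ 3) mulrA.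
  by rewrite ler_wpM2l ?log1_le_id // mulr_ge0 ?exprn_ge0 // ltW.
split.
  have := lanczos_accuracy sB spB x0 k0 dk z1 (ltW u0) F1 F2 hfc1 heig (ltW hc_eig)
    small acc0 acc1 cacc.
  move=> h; apply: le_trans h _; rewrite ler_wpM2r ?enorm_ge0 //.
  move: errb decay; rewrite /krylov_err; clear.
  set y := _ ^+ q; set zd := _ ^+ (k %/ 4); set eta := 12 * _ * _ * _.
  move: (q.+1%:R) (k%:R) ((k %/ 4)%:R) (n.+1%:R) eta y zd acc => P K d N eta y zd acc.
  by move=> errb decay; lra.
have acc2 : acc <= 1 / 2 by move: acc1; clear; lra.
have := lanczos_time x F k0 (ltW u0) (ltW hc_eig) (ltW hC_eig) (ltW hC_f) hmv hfc2 heig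
  acc0 acc2 cacc.
move=> h; apply: le_trans h _.
apply: time_budget => //; try exact: ltW.
  exact: log1_ge1.
apply: (log1_accuracy_le K1 X0 Ck1 Kk b1 lnX); exact: le_trans ler01 A11.
Qed.
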